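(* Let $k\ge 3$ be an integer. There exists $n_0\in\mathbb{N}$ such that for every $n\ge n_0$ with $(2k-1)\mid n$, every $k$-graph $H$ on $n$ vertices with $\delta(H)\ge \frac{2n}{2k-1}$ admits a perfect $T_k$-tiling.
   Context: A $k$-graph $H=(V,E)$ is a $k$-uniform hypergraph: a finite vertex set $V=V(H)$ with a collection $E=E(H)$ of $k$-subsets of $V$ (edges). For a $(k-1)$-subset $S\subseteq V(H)$, the codegree of $S$ is $d_H(S)=|\{v\in V\setminus S: S\cup\{v\}\in E(H)\}|$, and $\delta(H)=\min_{S\in\binom{V}{k-1}} d_H(S)$ is the minimum codegree of $H$. $T_k$ (the generalised triangle) is the $k$-graph with vertex set $\{1,2,\dots,2k-1\}$ and exactly three edges $\{1,\dots,k-1,k\}$, $\{1,\dots,k-1,k+1\}$ and $\{k,k+1,\dots,2k-1\}$. An $F$-tiling in $H$ is a family of vertex-disjoint copies of $F$ in $H$ (a copy of $F$ is a not necessarily induced subgraph of $H$ isomorphic to $F$). It is perfect if it covers all vertices of $H$. *)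

(* Defs.v *)
From HB Require Import structures.
From mathcomp Require Import all_boot all_order all_algebra.
From mathcomp Require Import zify.

Set Implicit Arguments.
Unset Strict Implicit.
Unset Printing Implicit Defensive.

(* A hypergraph with vertex set V is given by its set of edges. *)
Definition hypergraph (V : finType) := {set {set V}}.

Definition uniform (k : nat) (V : finType) (H : hypergraph V) : Prop :=
  forall e : {set V}, e \in H -> #|e| = k.

Definition codegree (V : finType) (H : hypergraph V) (S : {set V}) : nat :=
  #|[set v | (v \notin S) && (v |: S \in H)]|.

(* The starting value #|V| bounds every codegree, so it does not affect the
   minimum; it is the value returned only when V has no (k-1)-subset. *)
Definition min_codegree (k : nat) (V : finType) (H : hypergraph V) : nat :=
  \big[minn/#|V|]_(S : {set V} | #|S| == k.-1) codegree H S.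

(* The vertex i : 'I_(2 * k - 1) stands for the label i.+1 in {1, ..., 2k-1};
   the edges are {1, ..., k-1, k}, {1, ..., k-1, k+1} and {k, ..., 2k-1}. *)
Definition gen_triangle (k : nat) : hypergraph 'I_(2 * k - 1) :=
  [set [set i : 'I_(2 * k - 1) | i.+1 <= k];
       [set i : 'I_(2 * k - 1) | (i.+1 <= k.-1) || (i.+1 == k.+1)];
       [set i : 'I_(2 * k - 1) | k <= i.+1]].

(* The pair C = (vertex set, edge set) is a (not necessarily induced) subgraph
   of H isomorphic to F; f is the isomorphism. *)
Definition is_copy (W V : finType) (F : hypergraph W) (H : hypergraph V)
    (C : {set V} * {set {set V}}) : Prop :=
  C.2 \subset H /\
  exists f : W -> V,
    [/\ injective f, f @: [set: W] = C.1 & [set f @: e | e : {set W} in F] = C.2].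

Definition is_tiling (W V : finType) (F : hypergraph W) (H : hypergraph V)
    (T : {set {set V} * {set {set V}}}) : Prop :=
  (forall C, C \in T -> is_copy F H C) /\
  (forall C1 C2, C1 \in T -> C2 \in T -> C1 != C2 -> [disjoint C1.1 & C2.1]).

Definition is_perfect_tiling (W V : finType) (F : hypergraph W)
    (H : hypergraph V) (T : {set {set V} * {set {set V}}}) : Prop :=
  is_tiling F H T /\ \bigcup_(C in T) C.1 = [set: V].

Lemma card_ord_iota (n a m : nat) (P : pred nat) :
    (forall i, i < n -> P i = (a <= i < a + m)) -> a + m <= n ->
  #|[set i : 'I_n | P i]| = m.
Proof.
move=> HP le_n; rewrite cardsE cardE size_filter -(count_map val P).
rewrite -enumT val_enum_ord (@eq_in_count _ _ (mem (iota a m))); last first.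
  by move=> i; rewrite mem_iota add0n /= mem_iota => /HP.
have -> : n = a + (m + (n - (a + m))) by lia.
rewrite !iotaD !count_cat add0n.
rewrite (@eq_in_count _ _ pred0 (iota 0 a)); last first.
  by move=> i; rewrite /= !mem_iota; lia.
rewrite (@eq_in_count _ _ pred0 (iota (a + m) _)); last first.
  by move=> i; rewrite /= !mem_iota; lia.
rewrite (@eq_in_count _ _ predT (iota a m)); last by move=> i /= ->.
by rewrite !count_pred0 count_predT size_iota addn0.
Qed.

Lemma gen_triangle_uniform (k : nat) : 2 <= k -> uniform k (gen_triangle k).
Proof.
move=> k2 e; rewrite !inE => /orP[/orP[]|] /eqP->.
- by apply: (@card_ord_iota _ 0 k (fun i => i.+1 <= k)) => [i|]; lia.
- have kn : k < 2 * k - 1 by lia.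
  have -> : [set i : 'I_(2 * k - 1) | (i.+1 <= k.-1) || (i.+1 == k.+1)] =
            Ordinal kn |: [set i : 'I_(2 * k - 1) | i.+1 <= k.-1].
    apply/setP=> i; rewrite !inE -val_eqE /=; lia.
  rewrite cardsU1 inE /= (@card_ord_iota _ 0 k.-1 (fun i => i.+1 <= k.-1)).
  + by lia.
  + by move=> i; lia.
  + by lia.
- by apply: (@card_ord_iota _ k.-1 k (fun i => k <= i.+1)) => [i|]; lia.
Qed.

(* Main.v *)
(* Write k = j + 3, q = 2k - 1 and n = q m, so that every (k-1)-set has at least 2m neighbours.  A
   copy of T_k is S ++ x :: y :: W with |S| = k - 1, |W| = k - 2 and edges S x, S y, x y W.

   Absorption.  For any two vertices v and w there are positively many sets G of 6k - 4 vertices such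
   that both G + v and G + w split into three copies of T_k; only a linear codegree is needed.  Hence
   O(log n) disjoint absorbers, chosen greedily, serve every q-set and can swallow any bounded leftover.

   Almost perfect tiling.  A cherry is a pair of edges sharing k - 1 vertices; it needs one more
   covering vertex, just as T_k needs two.  Take disjoint copies of T_k (weight a little more than 2)
   and cherries (weight 1) of maximal total weight and let U be the uncovered set.  Two cherries that
   see two different vertices of a copy turn it into two copies, so there are few cherries.  If U is
   larger than a constant, then most copies contain exactly two vertices with dense links in U: three
   such vertices would yield three cherries.  Freeing the other 2k - 3 vertices of a bounded number of
   copies costs no weight, so the set B of these vertices contains no cherry at all.

   Extremal case.  So U is bounded, and absorption finishes the proof, or nearly all of B, with
   |B| close to (2k - 3) m, spans almost no edge.  Then every (k-1)-subset of B is joined to almost all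
   of the complement A of B, and a copy of T_k should use two vertices of A.  A surplus in A is
   repaired by copies with three vertices in A, a deficit by a matching inside B, the few atypical
   vertices are covered one by one, and the rest of B is cut into blocks with two slots each, which a
   perfect matching fills with the rest of A. *)

(* The threshold comes from the extremal case: no vertex lies on all three edges of T_k, so when B
   spans no edge every copy needs two vertices outside B, and a perfect tiling needs 2m of them. A
   greedy family of absorbers has only O(log n) members, and for a given q-set it is sure to contain
   just one. It can therefore be spent only once, and the leftover of the packing has to be bounded,
   not merely a small proportion of n. This is why weights are compared exactly: every exchange must
   win at least one unit, and no error term linear in n may enter. The absorbing vertices are set
   aside before the packing is chosen. If the sparse set appears instead, they are given back, since
   that case tiles the whole vertex set directly. Densities are recorded by their reciprocals, so
   that all constants are natural numbers. Tiles are sequences, and their disjointness is expressed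
   by multiplicities, so that the validity of an exchange is a system of linear inequalities. *)
From Stdlib Require Import Classical_Prop.
Require Import Defs.
From HB Require Import structures.
From mathcomp Require Import all_boot all_order all_fingroup all_algebra.
From mathcomp Require Import zify.

Set Implicit Arguments.
Unset Strict Implicit.
Unset Printing Implicit Defensive.

(** * Sequences, triangles and tilings *)

(* [lia] splits on every boolean in sight, so the counts are generalized first. *)
Ltac perm_by_count :=
  let p := fresh "p" in
  apply/seq.permP => p; rewrite /= ?count_cat /= ?count_cat /= ?count_cat /=;
  repeat match goal with
  | |- context [nat_of_bool ?b] => generalize (nat_of_bool b)
  | |- context [@count ?T ?q ?s] => generalize (@count T q s)
  end; clear; intros; lia.

(* [size] and [count] over the same type may be displayed alike while their
   type arguments are only convertible, which makes them distinct for [lia]. *)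
Ltac goal_lia :=
  change (nat_of_bool true) with 1; change (nat_of_bool false) with 0;
  try match goal with V : finType |- _ =>
    change (Equality.sort (Datatypes_list__canonical__eqtype_Equality V)) with (seq V);
    change (Equality.sort V) with (Finite.sort V)
  end;
  repeat match goal with |- context [nat_of_bool ?b] => generalize (nat_of_bool b) end;
  clear; intros; lia.

Section Sequences.
Variable T : eqType.
Implicit Types (s t : seq T) (ss : seq (seq T)).

(** Disjointness survives an exchange as soon as no multiplicity grows; this is the form in which it
    is verified throughout. *)
Lemma uniq_count_le s1 s2 :
  (forall x, count_mem x s1 <= count_mem x s2) -> uniq s2 -> uniq s1.
Proof.
move=> le12 u2.
elim: s1 le12 => //= x s IH le12.
have ux := count_uniq_mem x u2.
rewrite IH ?andbT; last by move=> y; have := le12 y; lia.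
apply/negP=> xs; have := le12 x; rewrite eqxx ux.
have : 0 < count_mem x s by rewrite -has_count has_pred1.
by case: (x \in s2); lia.
Qed.

Lemma uniq_count_le1 s : (forall x, count_mem x s <= 1) -> uniq s.
Proof.
elim: s => //= x s IH le1; rewrite IH ?andbT; last by move=> y; have := le1 y; lia.
apply/negP=> xs; have := le1 x; rewrite eqxx.
have : 0 < count_mem x s by rewrite -has_count has_pred1.
by lia.
Qed.

Lemma count_flatten_mem p ss s : s \in ss -> count p s <= count p (flatten ss).
Proof. by elim: ss => //= a ss IH; rewrite inE count_cat => /orP[/eqP->|/IH]; lia. Qed.

Lemma count_flatten_cons p s ss : count p (flatten (s :: ss)) = count p s + count p (flatten ss).
Proof. by rewrite -count_cat. Qed.

Lemma perm_flatten2 ss1 ss2 : perm_eq ss1 ss2 -> perm_eq (flatten ss1) (flatten ss2).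
Proof.
move=> p12; apply/seq.permP=> p; rewrite !count_flatten.
by apply: perm_sumn; apply: perm_map.
Qed.

Lemma size_flatten_const ss l :
  (forall s, s \in ss -> size s = l) -> size (flatten ss) = l * size ss.
Proof.
elim: ss => [|s ss IH] hs /=; first by rewrite muln0.
by rewrite size_cat (hs s) ?mem_head // IH ?mulnS // => t tss; apply: hs; rewrite inE tss orbT.
Qed.

Lemma count_flatten_const p ss l :
  (forall s, s \in ss -> count p s = l) -> count p (flatten ss) = l * size ss.
Proof.
elim: ss => [|s ss IH] hs /=; first by rewrite muln0.
by rewrite count_cat (hs s) ?mem_head // IH ?mulnS // => t tss; apply: hs; rewrite inE tss orbT.
Qed.

Lemma uniq_flatten_mem ss s : uniq (flatten ss) -> s \in ss -> uniq s.
Proof.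
by move=> u sss; apply: uniq_count_le u => x; apply: count_flatten_mem.
Qed.

Lemma uniq_flatten_eq ss s t x :
  uniq (flatten ss) -> s \in ss -> t \in ss -> x \in s -> x \in t -> s = t.
Proof.
elim: ss => //= a ss IH; rewrite cat_uniq => /and3P[_ /hasPn aN u].
have no b : b \in ss -> x \in a -> x \in b -> False.
  by move=> bss xa xb; have := aN x; rewrite xa; move=> /(_ _)/negP; apply=> //; apply/flattenP; exists b.
rewrite !inE => /orP[/eqP->|sss] /orP[/eqP->|tss] // xs xt.
- by case: (no t).
- by case: (no s).
- exact: IH.
Qed.

End Sequences.

Lemma card_set_seq (V : finType) (s : seq V) : uniq s -> #|[set z in s]| = size s.
Proof. by move=> u; rewrite cardsE; apply/card_uniqP. Qed.

Lemma perm_enum_set (V : finType) (A : {set V}) (s : seq V) :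
  uniq s -> (forall x, (x \in s) = (x \in A)) -> perm_eq s (enum A).
Proof. by move=> u h; apply: uniq_perm => // [|x]; rewrite ?enum_uniq // h mem_enum. Qed.

Lemma fresh_seq (V : finType) (D F : {set V}) l :
  l + #|F| <= #|D| ->
  exists s, [/\ uniq s, size s = l & forall x, x \in s -> (x \in D) && (x \notin F)].
Proof.
move=> le; exists (take l (enum (D :\: F))); split.
- by rewrite take_uniq ?enum_uniq.
- rewrite size_takel // -cardE cardsD.
  have := subset_leq_card (subsetIr D F); lia.
- by move=> x /mem_take; rewrite mem_enum inE andbC.
Qed.

Lemma fresh_vertex (V : finType) (D F : {set V}) :
  #|F| < #|D| -> exists x, (x \in D) && (x \notin F).
Proof.
move=> /(@fresh_seq _ D F 1)[[|x [|? ?]] [] // _ _ h].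
by exists x; apply: h; rewrite mem_head.
Qed.

Section Tiles.
Variables (V : finType) (H : hypergraph V) (j : nat).

Definition edge (s : seq V) := [set z in s] \in H.

Lemma edge_perm s1 s2 : perm_eq s1 s2 -> edge s1 = edge s2.
Proof.
move=> /perm_mem h; rewrite /edge.
by have -> : [set z in s1] = [set z in s2] by apply/setP=> x; rewrite !inE h.
Qed.

(** Positions encode the labels 1, ..., 2k-1: a common part of k-1 entries, the two tips, then k-2
    further entries that form the third edge with the tips. Repetitions are excluded not here but by
    the sequence that is being tiled. *)
Definition triangle (t : seq V) :=
  [&& size t == 2 * j + 5, edge (take (j + 3) t),
      edge (take (j + 2) t ++ take 1 (drop (j + 3) t)) & edge (drop (j + 2) t)].

Lemma triangle_cat S x y W : size S = j.+2 -> size W = j.+1 ->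
  triangle (S ++ x :: y :: W) = [&& edge (x :: S), edge (y :: S) & edge (x :: y :: W)].
Proof.
move=> sS sW; rewrite /triangle size_cat /= sS sW.
rewrite (_ : j.+2 + j.+3 == 2 * j + 5); last by lia.
have E : S ++ x :: y :: W = (S ++ [:: x]) ++ y :: W by rewrite -catA.
have sx : size (S ++ [:: x]) = j + 3 by rewrite size_cat sS /=; lia.
have sS' : size S = j + 2 by lia.
rewrite {1 3}E !take_size_cat // !drop_size_cat //= take0.
by congr [&& _, _ & _]; apply: edge_perm; rewrite cats1 perm_rcons.
Qed.

Lemma triangle_size t : triangle t -> size t = 2 * j + 5.
Proof. by case/and4P=> /eqP. Qed.

Definition tileable (s : seq V) :=
  exists2 ts, all triangle ts & perm_eq s (flatten ts).

Lemma tileable_perm s1 s2 : perm_eq s1 s2 -> tileable s1 -> tileable s2.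
Proof.
by move=> p [ts h1 h2]; exists ts => //; apply: perm_trans h2; rewrite perm_sym.
Qed.

Lemma tileable_nil : tileable [::].
Proof. by exists [::]. Qed.

Lemma tileable_cat s1 s2 : tileable s1 -> tileable s2 -> tileable (s1 ++ s2).
Proof.
move=> [t1 a1 p1] [t2 a2 p2]; exists (t1 ++ t2); first by rewrite all_cat a1.
by rewrite flatten_cat perm_cat.
Qed.

Lemma tileable_flatten ss : (forall s, s \in ss -> tileable s) -> tileable (flatten ss).
Proof.
elim: ss => [|s ss IH] h /=; first exact: tileable_nil.
apply: tileable_cat; first by apply: h; rewrite mem_head.
by apply: IH => t ht; apply: h; rewrite inE ht orbT.
Qed.

Lemma tileable_triangle t : triangle t -> tileable t.
Proof. by move=> ht; exists [:: t]; rewrite /= ?ht ?cats0. Qed.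

Lemma tileable_cons S x y W s :
  size S = j.+2 -> size W = j.+1 ->
  edge (x :: S) -> edge (y :: S) -> edge (x :: y :: W) ->
  perm_eq s (S ++ x :: y :: W) -> tileable s.
Proof.
move=> sS sW e1 e2 e3 p; apply: (@tileable_perm (S ++ x :: y :: W)).
  by rewrite perm_sym.
by apply: tileable_triangle; rewrite triangle_cat // e1 e2.
Qed.

Lemma tileable_size s : tileable s -> 2 * j + 5 %| size s.
Proof.
move=> [ts /allP h p]; rewrite (perm_size p) (@size_flatten_const _ _ (2 * j + 5)).
  exact: dvdn_mulr.
by move=> t /h /triangle_size.
Qed.

End Tiles.

Section TilingOfSequence.
Variables (V : finType) (H : hypergraph V) (j : nat).
Local Notation k := j.+3.

Lemma triangle_copy t : triangle H j t -> uniq t ->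
  exists E, is_copy (gen_triangle k) H ([set z in t], E).
Proof.
move=> ht ut; have st := triangle_size ht.
have [d _] : exists d : V, True by case: t st {ht ut} => [|d t]; [move=> /=; lia|exists d].
pose f (i : 'I_(2 * k - 1)) := nth d t i.
(* The vertex set and all three edges of the copy are images of index sets under [f]; [im]
   identifies such an image with the entries of a subsequence of [t]. *)
have im (s : seq V) (P : pred nat) :
    (forall i, i < 2 * k - 1 -> P i -> nth d t i \in s) ->
    (forall z, z \in s -> exists i, [/\ i < 2 * k - 1, P i & nth d t i = z]) ->
    [set f i | i in [set i : 'I_(2 * k - 1) | P i]] = [set z in s].
  move=> h1 h2; apply/setP=> z; rewrite inE; apply/imsetP/idP.
    by move=> [i]; rewrite inE => Pi ->; apply: h1.
  by move=> /h2[i [lti Pi <-]]; exists (Ordinal lti); rewrite ?inE.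
exists [set f @: (e : {set _}) | e in gen_triangle k]; split=> /=.
  apply/subsetP=> ? /imsetP[e + ->]; rewrite !inE => /orP[/orP[]|] /eqP->.
  - rewrite (im (take (j + 3) t) (fun i => i < k)); first by case/and4P: ht.
      move=> i _ /= ?; rewrite -(@nth_take (j + 3)); last by lia.
by apply: mem_nth; rewrite size_takel ?st; lia.
    move=> z /(nthP d)[i]; rewrite size_takel ?st; last by lia.
    by move=> lti; rewrite nth_take // => <-; exists i; split => //; lia.
  - rewrite (im (take (j + 2) t ++ take 1 (drop (j + 3) t))
      (fun i => (i.+1 <= k.-1) || (i.+1 == k.+1))); first by case/and4P: ht.
      move=> i _ /= /orP[?|/eqP[->]]; rewrite mem_cat; apply/orP; [left|right].
        rewrite -(@nth_take (j + 2)); last by lia.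
        by apply: mem_nth; rewrite size_takel ?st; lia.
      have -> : k = j + 3 + 0 by lia.
      rewrite -nth_drop -(@nth_take 1) //; apply: mem_nth.
      by rewrite size_takel ?size_drop ?st; lia.
    move=> z; rewrite mem_cat => /orP[] /(nthP d)[i]; rewrite size_takel ?size_drop ?st; try lia.
      by move=> lti; rewrite nth_take // => <-; exists i; split => //; lia.
    move=> lti; rewrite nth_take // nth_drop => <-; exists (j + 3 + i).
    by split => //; lia.
  - rewrite (im (drop (j + 2) t) (fun i => k <= i.+1)); first by case/and4P: ht.
      move=> i lti /= ki; have -> : i = j + 2 + (i - (j + 2)) by lia.
      by rewrite -nth_drop; apply: mem_nth; rewrite size_drop st; lia.
    move=> z /(nthP d)[i]; rewrite size_drop st => lti; rewrite nth_drop => <-.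
    by exists (j + 2 + i); split => //; lia.
exists f; split=> //.
- move=> a b /eqP; rewrite nth_uniq ?st //; first by move=> /eqP/val_inj.
    by have := ltn_ord a; lia.
  by have := ltn_ord b; lia.
- have -> : [set: 'I_(2 * k - 1)] = [set i : 'I_(2 * k - 1) | predT (i : nat)].
    by apply/setP=> i; rewrite !inE.
  rewrite (im t predT) //; first by move=> i lti _; apply: mem_nth; rewrite st; lia.
  by move=> z /(nthP d)[i]; rewrite st => lti <-; exists i; split=> //; lia.
Qed.

Lemma perfect_tiling_of_tileable :
  tileable H j (enum V) -> exists T, is_perfect_tiling (gen_triangle k) H T.
Proof.
move=> [ts /allP tri pV]; have uts : uniq (flatten ts) by rewrite -(perm_uniq pV) enum_uniq.
(* The edge set of each copy is only known to exist, so a choice function is built along the list of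
   tiles. *)
have [c hc] : exists c : seq V -> {set V} * {set {set V}},
    forall t, t \in ts -> (c t).1 = [set z in t] /\ is_copy (gen_triangle k) H (c t).
  have {pV}: {in ts, forall t, triangle H j t /\ uniq t}.
    by move=> t tin; split; [apply: tri|apply: uniq_flatten_mem tin].
  elim: ts {tri uts} => [|t ts IH] h; first by exists (fun=> (set0, set0)).
  have [|c hc] := IH; first by move=> s sin; apply: h; rewrite inE sin orbT.
  have [ht ut] := h t (mem_head _ _); have [E hE] := triangle_copy ht ut.
  exists (fun s => if s == t then ([set z in t], E) else c s) => s.
  by rewrite inE; case: eqP => [-> _|_ /hc] /=.
exists [set C in map c ts]; split; [split|].
- by move=> C; rewrite inE => /mapP[t /hc[_ ?] ->].
- move=> C1 C2; rewrite !inE => /mapP[t1 i1 ->] /mapP[t2 i2 ->] neq.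
  rewrite (hc _ i1).1 (hc _ i2).1; apply/pred0P=> z /=; rewrite !inE.
  apply/negP=> /andP[z1 z2]; case/eqP: neq.
  by rewrite (uniq_flatten_eq uts i1 i2 z1 z2).
- apply/setP=> z; rewrite inE; apply/bigcupP.
  have : z \in flatten ts by rewrite -(perm_mem pV) mem_enum.
  move=> /flattenP[t tin zt]; exists (c t); first by rewrite inE map_f.
  by rewrite (hc _ tin).1 inE.
Qed.

End TilingOfSequence.

Lemma codegree_ge_min (V : finType) (H : hypergraph V) k (S : {set V}) :
  #|S| = k.-1 -> min_codegree k H <= codegree H S.
Proof.
move=> cS; rewrite /min_codegree; have := mem_index_enum S.
elim: (index_enum _) => //= A r IH; rewrite big_cons inE => /orP[/eqP <-|/IH le].
  by rewrite cS eqxx geq_minl.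
by case: ifP => // _; apply: leq_trans le; apply: geq_minr.
Qed.

(** * Counting with positive density *)

(** The density of [P] in [T] is at least 1/K, stated without division. *)
Definition many (T : finType) (K : nat) (P : pred T) := #|T| <= K * #|P|.

Section Many.
Implicit Types T : finType.

Lemma many_sub T K (P Q : pred T) : many K P -> (forall x, P x -> Q x) -> many K Q.
Proof.
move=> h PQ; apply: leq_trans h _; rewrite leq_mul2l; apply/orP; right.
by apply: subset_leq_card; apply/subsetP.
Qed.

Lemma many_weaken T K K' (P : pred T) : many K P -> K <= K' -> many K' P.
Proof. by move=> h le; apply: leq_trans h _; rewrite leq_mul2r le orbT. Qed.

Lemma many_exists T K (P : pred T) : many K P -> 0 < #|T| -> exists x, P x.
Proof.
move=> h T0; have : 0 < #|P| by move: h; rewrite /many; case: #|P| => //; lia.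
by move=> /card_gt0P[x]; exists x.
Qed.

Lemma many_predT T : many 1 (xpredT : pred T).
Proof. by rewrite /many mul1n. Qed.

Lemma card_prod_sum T1 T2 (P : pred (T1 * T2)) :
  #|P| = \sum_x #|[pred y | P (x, y)]|.
Proof.
rewrite -sum1_card big_mkcond /= (eq_bigr (fun p => if P (p.1, p.2) then 1 else 0)).
  rewrite -(pair_bigA _ (fun x y => if P (x, y) then 1 else 0)) /=.
  by apply: eq_bigr => x _; rewrite -sum1_card [RHS]big_mkcond.
by case.
Qed.

Lemma many_join T1 T2 K K' (P : T1 -> T2 -> bool) :
  many K (fun x => many K' (P x)) -> many (K * K') (fun p => P p.1 p.2).
Proof.
move=> h; rewrite /many card_prod card_prod_sum /=.
have: #|T1| * #|T2| <= K * \sum_(x | many K' (P x)) #|T2|.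
  by rewrite sum_nat_const mulnA leq_mul2r; apply/orP; right; apply: h.
move=> /leq_trans; apply; rewrite -mulnA leq_mul2l big_distrr /=; apply/orP; right.
rewrite big_mkcond; apply: leq_sum => x _; case: ifP => // hx.
Qed.

(** Averaging: fibres of density below 1/(2K+1) carry less than half of [P], so the remaining fibres
    carry the rest. The successor keeps the constant positive. *)
Lemma many_split T1 T2 K (P : pred (T1 * T2)) : many K P ->
  many (2 * K).+1 (fun x => many (2 * K).+1 (fun y => P (x, y))).
Proof.
rewrite /many card_prod card_prod_sum => h.
have [M lM] : exists M, M = (2 * K).+1 by exists (2 * K).+1.
rewrite -lM; have {lM} [lM M0] : 2 * K <= M /\ 0 < M by lia.
have [T20|T2p] := posnP #|T2|.
  rewrite T20; apply: leq_trans (leq_pmull _ M0).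
  by apply: subset_leq_card; apply/subsetP.
pose c x := #|[pred y | P (x, y)]|; rewrite -/c in h.
set G := #|_|; rewrite -(leq_pmul2r T2p).
have cle x : c x <= #|T2| by apply: max_card.
have: \sum_x M * c x <= \sum_x (M * #|T2| * (#|T2| <= M * c x) + #|T2|).
  apply: leq_sum => x _; have le := cle x.
  case: (leqP #|T2|) => [_|lt]; last by rewrite /= muln0; apply: ltnW.
  by rewrite muln1; apply: leq_trans (leq_addr _ _); rewrite leq_mul2l le orbT.
rewrite big_split.
have -> : \sum_(x : T1) #|T2| = #|T1| * #|T2| by rewrite -sum_nat_const; apply: eq_bigl.
rewrite -!big_distrr.
have -> : \sum_x (#|T2| <= M * c x : nat) = G.
  rewrite /G -sum1_card [RHS]big_mkcond; apply: eq_bigr => x _.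
  by rewrite -topredE /= -/(c x); case: (_ <= _).
move: h; set s := \sum_i c i => /= h1 h2.
have : 2 * K * s <= M * s by rewrite leq_mul2r lM orbT.
by move: h1 h2; rewrite (mulnAC M); set a := _ * #|T2|; set b := _ * #|T2|; lia.
Qed.

Lemma many_bij T T' (f : T' -> T) K (P : pred T) :
  bijective f -> many K P -> many K (fun x => P (f x)).
Proof.
move=> bf; rewrite /many (bij_eq_card bf) => /leq_trans; apply.
rewrite leq_mul2l; apply/orP; right.
rewrite -(card_imset _ (bij_inj bf)); apply: subset_leq_card; apply/subsetP=> y Py.
case: bf => g fK gK; apply/imsetP; exists (g y); rewrite ?gK //.
by rewrite -topredE /= gK.
Qed.

(** Exchanging two density quantifiers costs only a constant: count the pairs, then average over the
    other coordinate. *)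
Lemma many_comm T1 T2 K K' (P : T1 -> T2 -> bool) :
  many K (fun x => many K' (P x)) ->
  many (2 * (K * K')).+1 (fun y => many (2 * (K * K')).+1 (fun x => P x y)).
Proof.
move=> /many_join h.
apply: (@many_split T2 T1 _ (fun p => P p.2 p.1)).
apply: (@many_bij _ _ (fun p : T2 * T1 => (p.2, p.1)) _ (fun p => P p.1 p.2)) => //.
by exists (fun p => (p.2, p.1)); case.
Qed.

Lemma many_avoid T K (P : pred T) (F : {set T}) :
  many K P -> 2 * K * #|F| <= #|T| -> many (2 * K) (fun x => P x && (x \notin F)).
Proof.
rewrite /many => h le.
have: #|P| <= #|((fun x => P x && (x \notin F)) : pred T)| + #|F|.
  rewrite -cardUI; apply: leq_trans (leq_addr _ _); apply: subset_leq_card.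
  apply/subsetP=> x Px; rewrite inE; case xF: (x \in F); first by rewrite orbT.
  by rewrite orbF -topredE /= xF andbT; apply: Px.
nia.
Qed.

(** A union bound multiplied through by n: each of the l entries is spoiled by the f forbidden
    values or by one of the fewer than l earlier entries. *)
Lemma ffact_lower_bound n f l :
  n * n ^ l <= n * (n - f) ^_ l + l * (l + f) * n ^ l.
Proof.
elim: l => [|l IH]; first by rewrite expn0 ffactn0; lia.
have le : (n - f) ^_ l <= n ^ l.
  elim: l {IH} => // l IH; rewrite ffactnSr expnSr leq_mul //; lia.
rewrite ffactnSr expnSr; set a := _ ^_ _ in IH le *; set b := n ^ l in IH le *.
have : n <= (n - f - l) + (f + l) by lia.
set c := n - f - l; nia.
Qed.

(* Only [O(n ^ (l - 1))] of the [l]-tuples repeat an entry or meet [F]. *)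
Lemma many_uniq (V : finType) T (f : T -> seq V) l K (P : pred T) (F : {set V}) :
  (forall x, size (f x) = l) -> injective f -> #|T| = #|V| ^ l ->
  0 < #|V| -> 2 * K * (l * (l + #|F|)) <= #|V| -> many K P ->
  many (2 * K) (fun x => [&& P x, uniq (f x) & all (fun z => z \notin F) (f x)]).
Proof.
move=> sf injf cT V0 le h; set n := #|V| in cT V0 le.
pose good x := uniq (f x) && all (fun z => z \notin F) (f x).
have cg : (n - #|F|) ^_ l <= #|good|.
  have cF : #|[predC F]| = n - #|F| by rewrite /n -(cardC F) addKn.
  rewrite -cF -card_uniq_tuples; set A := [set _ | _].
  have f2 x : size (f x) == l by apply/eqP.
  pose g x := Tuple (f2 x).
  have ig : injective g by move=> x y /(congr1 val)/injf.
  have bg : bijective g by apply: inj_card_bij; rewrite // card_tuple cT.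
  case: (bg) => h1 h1K h2K; rewrite -(card_imset A (can_inj h2K)).
  apply: subset_leq_card; apply/subsetP=> _ /imsetP[t + ->]; rewrite inE => /andP[at_ ut].
  rewrite -topredE /good /= -[f _]/(val (g (h1 t))) h2K ut /=.
  by apply: sub_all at_ => z.
have ffl := ffact_lower_bound n #|F| l.
set B := (fun x => ~~ good x) : pred T.
have cB : #|good| + #|B| = n ^ l.
  by rewrite -cT -(cardC good); congr (_ + _); apply: eq_card => x; rewrite !inE -topredE.
set Q := (fun x : T => [&& _, _ & _]).
have PQ : #|P| <= #|Q| + #|B|.
  rewrite -cardUI; apply: leq_trans (leq_addr _ _); apply: subset_leq_card.
  apply/subsetP=> x Px; rewrite inE -!topredE /= /Q /B /good.
  by rewrite (Px : P x) /=; case: (_ && _).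
rewrite /many -/Q cT; rewrite /many cT in h.
set N := n ^ l in h cB ffl *; set L := l * _ in ffl le.
have b1 : n * #|B| <= L * N.
  by move: ffl; rewrite -{1}cB mulnDr => /leq_trans - /(_ (n * #|good| + L * N)); rewrite leq_add2r leq_mul2l cg orbT leq_add2l; apply.
have b2 : 2 * K * (n * #|B|) <= n * N.
  by apply: leq_trans (leq_mul (leqnn _) b1) _; rewrite mulnA leq_mul2r le orbT.
rewrite -(leq_pmul2l V0) -/n.
have : n * N <= n * (K * (#|Q| + #|B|)).
  by rewrite leq_mul2l (leq_trans h) ?orbT // leq_mul2l PQ orbT.
move: b2; set q := #|Q|; set b := #|B|; rewrite !mulnDr.
have -> : 2 * K * (n * b) = 2 * (n * (K * b)) by lia.
have -> : n * (2 * K * q) = 2 * (n * (K * q)) by lia.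
lia.
Qed.
End Many.

(** * Exchanging a vertex *)

Lemma many_nest (T1 T2 : finType) K K' (P : pred (T1 * T2)) :
  many K (fun x => many K' (fun y => P (x, y))) -> many (K * K') P.
Proof. by move=> /many_join h; apply: many_sub h _ => -[]. Qed.

Section Switch.
Variable j : nat.
Local Notation k := j.+3.

Definition codegree_dense (V : finType) (H : hypergraph V) :=
  forall S : {set V}, #|S| = j.+2 -> #|V| <= k * codegree H S.

Lemma many_neighbor (V : finType) (H : hypergraph V) s :
  codegree_dense H -> uniq s -> size s = j.+2 -> many k (fun x => edge H (x :: s)).
Proof.
move=> cd us ss; apply: (@many_sub _ _ [pred v | (v \notin [set z in s]) && (v |: [set z in s] \in H)]).
  apply: leq_trans (cd [set z in s] _) _; first by rewrite card_set_seq.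
  by rewrite /codegree cardsE leqnn.
move=> x /= /andP[_ h]; rewrite /edge; suff -> : [set z in x :: s] = x |: [set z in s] by [].
by apply/setP=> z; rewrite !inE.
Qed.

(** All but one of the entries of [W] are free, up to distinctness, and the codegree condition
    supplies the last one. *)
Lemma many_edge (V : finType) (H : hypergraph V) x y :
  codegree_dense H -> 2 * (j * j.+2) <= #|V| -> x != y ->
  many (2 * k) (fun W : j.+1.-tuple V => edge H (x :: y :: W)).
Proof.
move=> cd nV xy.
have V0 : 0 < #|V| by apply/card_gt0P; exists x.
have h : many 2 (fun W : j.-tuple V => uniq (x :: y :: W)).
  have h := @many_uniq V _ (fun W : j.-tuple V => W : seq V) j 1 xpredT [set x; y].
  apply: many_sub (h _ _ _ _ _ _) _ => //; try by move=> ?; rewrite size_tuple.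
  - exact: val_inj.
  - by rewrite card_tuple.
  - by rewrite cards2 xy; lia.
  - exact: many_predT.
  - move=> W /= /andP[-> /allP hW]; rewrite inE negb_or xy /= andbT.
    by apply/andP; split; apply/negP=> /hW; rewrite !inE eqxx ?orbT.
have h2 : many (2 * k) (fun p : j.-tuple V * V => edge H (p.2 :: x :: y :: p.1)).
  apply: many_nest; apply: many_sub h _ => W uW /=; apply: many_neighbor => //=.
  by rewrite size_tuple.
pose f (W : j.+1.-tuple V) := (behead_tuple W, thead W).
have bf : bijective f.
  exists (fun p => cons_tuple p.2 p.1); first by move=> W; rewrite [RHS]tuple_eta.
  by move=> [W z]; rewrite /f /thead (tnth_nth z) /=; congr (_, _); apply: val_inj.
apply: many_sub (many_bij bf h2) _ => W; rewrite [in X in _ -> X](tuple_eta W) /=.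
by rewrite (@edge_perm _ _ _ (x :: y :: thead W :: behead W)) //; perm_by_count.
Qed.

(** The loss of commuting twice: [c] is the constant after the first exchange, where 2K pays for
    avoiding [y] and 2k for the edge through [x] and [y]. *)
Definition pair_const K := let c := (2 * (2 * K * (2 * k))).+1 in (2 * (c * c)).+1.

(* Commuting [x] past [W] shows that many [W] have many partners in [D]; commuting back keeps one of
   them as [x] and leaves the others available. *)
Lemma many_pairs (V : finType) (H : hypergraph V) K (D : pred V) y :
  codegree_dense H -> 2 * (j * j.+2) <= #|V| -> 2 * K <= #|V| -> many K D ->
  many (pair_const K) (fun x => many (pair_const K) (fun W : j.+1.-tuple V =>
    [&& D x, edge H (x :: y :: W) & many (pair_const K) (fun a => D a && edge H (a :: y :: W))])).
Proof.
move=> cd nV nK mD.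
have h : many (2 * K) (fun x => many (2 * k) (fun W : j.+1.-tuple V => D x && edge H (x :: y :: W))).
  have := many_avoid (F := [set y]) mD; rewrite cards1 muln1 => /(_ nK) h.
  apply: many_sub h _ => x /= /andP[Dx]; rewrite inE => xy.
  by apply: many_sub (many_edge cd nV xy) _ => W; rewrite Dx.
have {}h := many_comm h.
set c := (2 * (2 * K * (2 * k))).+1 in h.
have -> : pair_const K = (2 * (c * c)).+1 by [].
have cg : c <= (2 * (c * c)).+1 by nia.
apply: (@many_comm _ _ c c); apply: many_sub h _ => W h.
apply: many_sub (h) _ => x /andP[-> ->] /=; exact: many_weaken h cg.
Qed.

Definition switch_type (V : finType) : finType :=
  let T := j.+1.-tuple V in
  (T * ((V * T) * (V * ((V * T) * (V * (V * (T * ((V * T) * (V * (V * T))))))))))%type.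

(* With [G] the entries of a switch, [w :: G] splits into the triangles [(w0 e; x, y; W)],
   [(w e'; a, b; W2)], [(y' W1; a', b'; W3)], and [v :: G] into [(x e; w0, y'; W1)],
   [(v e'; a', b'; W3)], [(y W; a, b; W2)], where [(S; x, y; W)] has edges [S x], [S y], [x y W]. *)
Definition switch (V : finType) (H : hypergraph V) (v w : V) (g : switch_type V) : bool :=
  let: (e', ((x, e), (w0, ((y, W), (a, (b, (W2, ((y', W1), (a', (b', W3)))))))))) := g in
  all (edge H) [:: x :: w0 :: e; y :: w0 :: e; y' :: x :: e; x :: y :: W; w0 :: y' :: W1;
    a :: y :: W; b :: y :: W; a' :: y' :: W1; b' :: y' :: W1;
    a :: w :: e'; b :: w :: e'; a' :: v :: e'; b' :: v :: e'; a :: b :: W2; a' :: b' :: W3].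

Definition switch_seq (V : finType) (g : switch_type V) : seq V :=
  let: (e', ((x, e), (w0, ((y, W), (a, (b, (W2, ((y', W1), (a', (b', W3)))))))))) := g in
  flatten [:: e' : seq V; e : seq V; W : seq V; W2 : seq V; W1 : seq V; W3 : seq V;
    [:: x; w0; y; a; b; y'; a'; b']].

Lemma size_switch_seq (V : finType) (g : switch_type V) : size (switch_seq g) = 6 * j + 14.
Proof.
move: g => [e' [[x e] [w0 [[y W] [a [b [W2 [[y' W1] [a' [b' W3]]]]]]]]]].
rewrite /switch_seq /= !size_cat /= !size_tuple; lia.
Qed.

Lemma switch_seq_inj (V : finType) : injective (@switch_seq V).
Proof.
move=> [e' [[x e] [w0 [[y W] [a [b [W2 [[y' W1] [a' [b' W3]]]]]]]]]].
move=> [e1' [[x1 e1] [w1 [[y1 W1'] [a1 [b1 [W21 [[y1' W11] [a1' [b1' W31]]]]]]]]]].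
move=> /eq_from_flatten_shape; rewrite /shape /= !size_tuple => /(_ erefl).
by case=> /val_inj-> /val_inj-> /val_inj-> /val_inj-> /val_inj-> /val_inj-> -> -> -> -> -> -> -> ->.
Qed.

Lemma card_switch_type (V : finType) : #|switch_type V| = #|V| ^ (6 * j + 14).
Proof.
rewrite /switch_type !card_prod !card_tuple.
have -> : 6 * j + 14 = 6 * j.+1 + 8 by lia.
rewrite expnD (mulnC 6) expnM; set m := #|V| ^ j.+1; set n := #|V|.
rewrite !expnS !expn0; lia.
Qed.

Lemma switch_tileable_r (V : finType) (H : hypergraph V) v w g :
  switch H v w g -> tileable H j (w :: switch_seq g).
Proof.
move: g => [e' [[x e] [w0 [[y W] [a [b [W2 [[y' W1] [a' [b' W3]]]]]]]]]] /=.
move=> /and5P[h1 h2 h3 h4 /and5P[h5 h6 h7 h8 /and5P[h9 h10 h11 h12 /and4P[h13 h14 h15 _]]]].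
have h := tileable_cat (@tileable_cons _ H j (w0 :: e) x y W _ _ _ h1 h2 h4 (perm_refl _))
  (tileable_cat (@tileable_cons _ H j (w :: e') a b W2 _ _ _ h10 h11 h14 (perm_refl _))
  (@tileable_cons _ H j (y' :: W1) a' b' W3 _ _ _ h8 h9 h15 (perm_refl _))).
apply: tileable_perm (h _ _ _ _ _ _); rewrite /= ?size_tuple //.
by perm_by_count.
Qed.

Lemma switch_tileable_l (V : finType) (H : hypergraph V) v w g :
  switch H v w g -> tileable H j (v :: switch_seq g).
Proof.
move: g => [e' [[x e] [w0 [[y W] [a [b [W2 [[y' W1] [a' [b' W3]]]]]]]]]] /=.
move=> /and5P[h1 h2 h3 h4 /and5P[h5 h6 h7 h8 /and5P[h9 h10 h11 h12 /and4P[h13 h14 h15 _]]]].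
have h1' : edge H (w0 :: x :: e).
  by rewrite (@edge_perm _ _ _ (x :: w0 :: e)) //; perm_by_count.
have h := tileable_cat (@tileable_cons _ H j (x :: e) w0 y' W1 _ _ _ h1' h3 h5 (perm_refl _))
  (tileable_cat (@tileable_cons _ H j (v :: e') a' b' W3 _ _ _ h12 h13 h15 (perm_refl _))
  (@tileable_cons _ H j (y :: W) a b W2 _ _ _ h6 h7 h14 (perm_refl _))).
apply: tileable_perm (h _ _ _ _ _ _); rewrite /= ?size_tuple //.
by perm_by_count.
Qed.

(** The vertices are drawn from nested dense sets, so that the edges required later are inherited.
    With u = (w0, e), both x and y come from [B u], which lies in the link [D] of w e'; the common
    neighbours a, b are found there too. Then w0, y', a', b' are drawn from a dense set of vertices
    that can all play the part of w0 for the same x and e, hence lie in the link [D'] of v e'. *)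
Lemma many_switch : exists K N, forall (V : finType) (H : hypergraph V) v w,
  codegree_dense H -> N <= #|V| -> many K (switch H v w).
Proof.
pose K0 := 2 * k.
pose c1 := (2 * (k * (2 * k * K0))).+1.
pose g1 := pair_const c1.
pose c2 := (2 * (c1 * g1)).+1.
pose c3 := c2 * g1.
pose c4 := (2 * (c1 * c2)).+1.
pose g4 := pair_const c4.
pose c5 := (2 * (c4 * g4)).+1.
pose c6 := c5 * g4.
exists (2 * (c4 * (c5 * (c3 * (g1 * (2 * g1 * (K0 * (c6 * (g4 * (2 * g4 * K0)))))))))).
exists (2 * (j.+1 * (j.+1 + 2)) + 2 * k + 2 * c1 + 2 * c4 + 2 * g1 + 2 * g4).
move=> V H v w cd nV.
have {nV}[n0 n2 n3 n4 [n5 n6]] : [/\ 2 * (j.+1 * (j.+1 + 2)) <= #|V|, 2 * k <= #|V|,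
    2 * c1 <= #|V|, 2 * c4 <= #|V| & 2 * g1 <= #|V| /\ 2 * g4 <= #|V|].
  move: nV; move: (2 * (_ * _)) (2 * k) (2 * c1) (2 * c4) (2 * g1) (2 * g4); clear.
  by move=> *; split; try split; lia.
have n1 : 2 * (j * j.+2) <= #|V| by move: n0; clear; nia.
have avoid K (P : pred V) x : many K P -> 2 * K <= #|V| -> many (2 * K) (fun z => P z && (z != x)).
  move=> mP le; have := many_avoid (F := [set x]) mP; rewrite cards1 muln1 => /(_ le) h.
  by apply: many_sub h _ => z /=; rewrite inE.
have V0 : 0 < #|V| by apply/card_gt0P; exists v.
apply: many_nest.
have me : many 2 (fun e' : j.+1.-tuple V => uniq (v :: e') && uniq (w :: e')).
  have h := @many_uniq V _ (fun W : j.+1.-tuple V => W : seq V) j.+1 1 xpredT [set v; w].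
  apply: many_sub (h _ _ _ _ _ _) _ => //; try by move=> ?; rewrite size_tuple.
  - exact: val_inj.
  - by rewrite card_tuple.
  - by move: n0; rewrite cards2 muln1; case: (v != w); clear; nia.
  - exact: many_predT.
  - move=> W /= /andP[-> /allP hW]; rewrite !andbT.
    by apply/andP; split; apply/negP=> /hW; rewrite !inE eqxx ?orbT.
apply: many_sub me _ => e' /andP[uv uw].
pose D x := edge H (x :: w :: e'); pose D' x := edge H (x :: v :: e').
have mD : many k D by apply: many_neighbor; rewrite //= size_tuple.
have mD' : many k D' by apply: many_neighbor; rewrite //= size_tuple.
pose B (u : V * j.+1.-tuple V) x := [&& D x, D' u.1 & edge H (x :: u.1 :: u.2)].
have m1 : many c1 (fun u => many c1 (B u)).
  apply: (@many_comm _ _ k (2 * k * K0) (fun x u => B u x)).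
  apply: many_sub mD _ => x Dx; apply: many_nest.
  apply: many_sub (avoid _ _ x mD' n2) _ => w0 /andP[Dw0 xw0].
  rewrite eq_sym in xw0; apply: many_sub (many_edge cd n1 xw0) _ => e he.
  by rewrite /B /= Dx Dw0.
pose Psi u x (p : V * j.+1.-tuple V) := [&& B u x, B u p.1, edge H (x :: p.1 :: p.2)
  & many g1 (fun a => D a && edge H (a :: p.1 :: p.2))].
have m2 : many c1 (fun u => many c2 (fun x => many c3 (Psi u x))).
  apply: many_sub m1 _ => u mB.
  have h : many c2 (fun x => many c2 (fun y => B u y && many g1 (fun W => Psi u x (y, W)))).
    apply: (@many_comm _ _ c1 g1 (fun y x => B u y && many g1 (fun W => Psi u x (y, W)))).
    apply: many_sub (mB) _ => y By; rewrite By.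
    apply: many_sub (many_pairs y cd n1 n3 mB) _ => x /= h.
    apply: many_sub h _ => W /and3P[Bx exy h]; rewrite /Psi /= Bx By exy /=.
    by apply: many_sub h _ => a /andP[/and3P[-> _ _] ->].
  apply: many_sub h _ => x h; apply: many_nest; apply: many_sub h _ => y /andP[_ h].
  exact: h.
pose R (x : V) (e : j.+1.-tuple V) w0 := many c3 (Psi (w0, e) x).
(* The roles are exchanged: x and e become fixed and w0 varies over a dense set, to which
   [many_pairs] is applied a second time. *)
have m3 : many c4 (fun u : V * j.+1.-tuple V => many c4 (R u.1 u.2)).
  apply: (@many_split _ _ _ (fun p : V * j.+1.-tuple V * V => R p.1.1 p.1.2 p.2)).
  apply: (@many_bij _ _ (fun p : V * j.+1.-tuple V * V => ((p.2, p.1.2), p.1.1)) _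
           (fun p => many c3 (Psi p.1 p.2))).
    by exists (fun p => ((p.2, p.1.2), p.1.1)) => -[[]].
  exact: many_join m2.
apply: many_nest; apply: many_sub m3 _ => -[x e] /= mR.
(* A witness of density unfolds the condition on w0: it lies in [D'] and forms an edge with x and e.
   Applied to y', a' and b', this yields the edges y' x e, a' v e' and b' v e'. *)
have RB w0 : R x e w0 -> B (w0, e) x.
  move=> /many_exists[|[y W] /and4P[]//].
  by rewrite card_prod card_tuple muln_gt0 V0 expn_gt0 V0.
pose Psi' w0 (p : V * j.+1.-tuple V) := [&& R x e w0, R x e p.1, edge H (w0 :: p.1 :: p.2)
  & many g4 (fun a => R x e a && edge H (a :: p.1 :: p.2))].
have m4 : many c5 (fun w0 => many c6 (Psi' w0)).
  have h : many c5 (fun w0 => many c5 (fun y => R x e y && many g4 (fun W => Psi' w0 (y, W)))).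
    apply: (@many_comm _ _ c4 g4 (fun y w0 => R x e y && many g4 (fun W => Psi' w0 (y, W)))).
    apply: many_sub (mR) _ => y Ry; rewrite Ry.
    apply: many_sub (many_pairs y cd n1 n4 mR) _ => w0 /= h.
    by apply: many_sub h _ => W /and3P[Rw ew h]; rewrite /Psi' /= Rw Ry ew.
  apply: many_sub h _ => w0 h; apply: many_nest; apply: many_sub h _ => y /andP[_ h].
  exact: h.
have nT : 0 < #|{: V * j.+1.-tuple V}|.
  by rewrite card_prod card_tuple muln_gt0 V0 expn_gt0 V0.
apply: many_nest; apply: many_sub m4 _ => w0 mPsi'.
have [Rw0 mPsi] : R x e w0 /\ many c3 (Psi (w0, e) x).
  by have [p /and4P[Rw _ _ _]] := many_exists mPsi' nT.
apply: many_nest; apply: many_sub mPsi _ => -[y W] /and4P[Bx By exy /= ma].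
apply: many_nest; apply: many_sub (ma) _ => a /andP[Da ea].
apply: many_nest; apply: many_sub (avoid _ _ a ma n5) _ => b /andP[/andP[Db eb] ba].
rewrite eq_sym in ba; apply: many_nest; apply: many_sub (many_edge cd n1 ba) _ => W2 eW2.
apply: many_nest; apply: many_sub mPsi' _ => -[y' W1] /and4P[_ /RB By' ewy /= ma'].
apply: many_nest; apply: many_sub (ma') _ => a' /andP[/RB Ba' ea'].
apply: many_nest; apply: many_sub (avoid _ _ a' ma' n6) _ => b' /andP[/andP[/RB Bb' eb'] ba'].
rewrite eq_sym in ba'; apply: many_sub (many_edge cd n1 ba') _ => W3 eW3 /=.
move: Bx By By' Ba' Bb'; rewrite /B /D' /D /= in Da Db *.
move=> /and3P[_ _ ->] /and3P[_ _ ->] /and3P[_ _ hy] /and3P[_ -> _] /and3P[_ -> _].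
rewrite exy ewy ea eb ea' eb' Da Db eW2 eW3 !andbT /=.
by rewrite (@edge_perm _ _ _ (x :: y' :: e)) //; perm_by_count.
Qed.

End Switch.

(** * Absorption *)

Lemma many_ffun (I T : finType) K (P : I -> pred T) :
  (forall i, many K (P i)) -> many (K ^ #|I|) (fun f : {ffun I -> T} => [forall i, P i (f i)]).
Proof.
move=> h; rewrite /many card_ffun.
have -> : #|((fun f : {ffun I -> T} => [forall i, P i (f i)]) : pred _)| = \prod_i #|P i|.
  transitivity #|(family P : pred {ffun I -> T})|; last first.
    by rewrite card_family foldrE big_map big_enum.
  by apply: eq_card => f; rewrite -topredE; apply: eq_forallb.
rewrite -[#|T| ^ _]prod_nat_const -[K ^ _]prod_nat_const -big_split /=.
by apply: leq_prod => i _; apply: h.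
Qed.

Lemma exp2_ge_linear A l : 2 * A + 2 <= l -> A * l.+1 <= 2 ^ l.
Proof.
move=> le; have -> : l = A + (l - A) by lia.
set p := l - A; have pA : A + 2 <= p by rewrite /p; lia.
rewrite expnD; apply: leq_mul; first by apply: ltnW; apply: ltn_expl.
have : p.-1 < 2 ^ p.-1 by apply: ltn_expl.
have -> : 2 ^ p = 2 * 2 ^ p.-1 by rewrite -expnS; congr (_ ^ _); lia.
lia.
Qed.

Lemma bernoulli_nat a m : a ^ m + m * a ^ m.-1 <= a.+1 ^ m.
Proof.
elim: m => // -[|m] IH; first by rewrite !expn1 expn0; lia.
rewrite /= in IH *; rewrite (expnS a.+1).
apply: leq_trans (leq_mul (leqnn _) IH); rewrite (expnS a m.+1) (expnS a m); nia.
Qed.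

(** Since (1 + 1/a)^a is at least 2, taking s = a q (log n + 1) steps, with logarithm to base 2,
    beats n^q, while s is still far below n. *)
Lemma exp_ratio_beats_poly a q C : 0 < a -> 0 < q -> exists N, forall n, N <= n ->
  exists s, C * s.+1 <= n /\ a ^ s * n ^ q < a.+1 ^ s.
Proof.
move=> a0 q0; pose A := C * (a * q).+1.
exists (2 ^ (2 * A + 2)) => n le.
have n0 : 0 < n by apply: leq_trans le; rewrite expn_gt0.
pose l := trunc_log 2 n; exists (a * (q * l.+1)).
have ln : 2 ^ l <= n by apply: trunc_logP.
have nl : n < 2 ^ l.+1 by apply: trunc_log_ltn.
have lA : 2 * A + 2 <= l by apply: trunc_log_max.
split.
  apply: leq_trans ln; apply: leq_trans (exp2_ge_linear lA).
  by rewrite /A -mulnA leq_mul2l; apply/orP; right; clear; nia.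
have h : 2 * a ^ a <= a.+1 ^ a.
  apply: leq_trans (bernoulli_nat a a); rewrite -{3}(prednK a0) -expnS prednK //; lia.
rewrite (expnM a.+1); apply: leq_trans (_ : (2 * a ^ a) ^ (q * l.+1) <= _); last first.
  by rewrite leq_exp2r ?muln_gt0 ?q0.
rewrite expnMn -expnM mulnC ltn_pmul2r ?expn_gt0 ?a0 //.
by rewrite mulnC expnM ltn_exp2r.
Qed.

(** Counting pairs in U x Y: if every [x] accepts a proportion 1/(K+1) of [Y], then some [y] serves
    that proportion of [U]. *)
Lemma greedy_step (X Y : finType) K (R : X -> Y -> bool) (P : pred Y) (U : {set X}) :
  0 < #|Y| -> (forall x, many K.+1 (fun y => R x y && P y)) ->
  U != set0 -> exists y, [/\ P y, exists x, R x y & K.+1 * #|[set x in U | ~~ R x y]| <= K * #|U|].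
Proof.
move=> Y0 h U0.
pose c y := #|[set x in U | R x y && P y]|.
have [y hy] : exists y, #|U| <= K.+1 * c y.
  apply/existsP; apply: contraT => /existsPn hn.
  have : \sum_(y : Y) (K.+1 * c y).+1 <= \sum_(y : Y) #|U| by apply: leq_sum => y _; rewrite ltnNge hn.
  rewrite (eq_bigr (fun y => K.+1 * c y + 1)); last by move=> y _; rewrite addn1.
  rewrite big_split /= -big_distrr /= sum1_card.
  have -> : \sum_(y : Y) #|U| = #|Y| * #|U| by rewrite -sum_nat_const; apply: eq_bigl.
  have -> : \sum_y c y = \sum_(x in U) #|[pred y | R x y && P y]|.
    rewrite (eq_bigr (fun y => \sum_(x in U) (R x y && P y : nat))); last first.
      move=> y _; rewrite /c -sum1_card big_mkcond [RHS]big_mkcond; apply: eq_bigr => x _.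
      by rewrite inE; case: (x \in U); case: (R x y && P y).
    rewrite exchange_big; apply: eq_bigr => x _; rewrite -sum1_card [RHS]big_mkcond /=.
    by apply: eq_bigr => y _; rewrite inE; case: (R x y && P y).
  have : \sum_(x in U) #|Y| <= \sum_(x in U) K.+1 * #|[pred y | R x y && P y]|.
    by apply: leq_sum => x _; apply: h.
  rewrite sum_nat_const -big_distrr /= -[\sum_(i in U) _]/(\sum_(x in U) #|[pred y | R x y && P y]|).
  set S := \sum_(x in U) _; rewrite -[#|xpredT|]/#|Y| => h1 h2.
  by have := leq_trans h2 (leq_trans (eq_leq (mulnC _ _)) h1); lia.
have cy : 0 < c y.
  by rewrite -card_gt0 in U0; case: (c y) hy => // hy; move: U0; rewrite ltnNge (leq_trans hy) // muln0.
have /set0Pn[x] : [set x in U | R x y && P y] != set0 by rewrite -card_gt0.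
rewrite inE => /and3P[_ Rx Py]; exists y; split=> //; first by exists x.
have : #|[set x in U | ~~ R x y]| + c y = #|U|.
  rewrite /c -(cardsID [set x | R x y] U) addnC; congr (_ + _).
    by apply: eq_card => z; rewrite !inE Py andbT.
  by apply: eq_card => z; rewrite !inE andbC.
rewrite mulSn in hy *; set a := #|[set _ in _ | _]|; rewrite -/(c y) in hy *; nia.
Qed.

(** Each step multiplies the number of unserved elements by at most K/(K+1), so after s steps fewer
    than one is left. The supports used so far join the forbidden set, whose size stays within
    [f]. *)
Lemma greedy_cover (X Y V : finType) K L f (R : X -> Y -> bool) (supp : Y -> seq V) :
  0 < #|Y| -> (forall y, size (supp y) = L) ->
  (forall (F : {set V}) x, #|F| <= f ->
     many K.+1 (fun y => R x y && (uniq (supp y) && all (fun z => z \notin F) (supp y)))) ->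
  forall s (F : {set V}), #|F| + L * s <= f -> K ^ s * #|X| < K.+1 ^ s ->
  exists ys, [/\ size ys <= s, uniq (flatten (map supp ys)),
    forall z, z \in flatten (map supp ys) -> z \notin F,
    forall y, y \in ys -> exists x, R x y & forall x, exists2 y, y \in ys & R x y].
Proof.
move=> Y0 sL h s F lef ltX.
suff [ys [h1 h2 h3 h4 h5]] : exists ys, [/\ size ys <= s, uniq (flatten (map supp ys)),
    forall z, z \in flatten (map supp ys) -> z \notin F,
    forall y, y \in ys -> exists x, R x y &
    K.+1 ^ s * #|[set x | ~~ has (R x) ys]| <= K ^ s * #|X|].
  exists ys; split=> // x; apply/hasP; apply: contraT => nh.
  have : 0 < #|[set x | ~~ has (R x) ys]| by apply/card_gt0P; exists x; rewrite inE.
  move=> p; have := leq_trans (leq_pmulr (K.+1 ^ s) p) (leq_trans h5 (ltnW ltX)).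
  by move=> _; move: (leq_ltn_trans h5 ltX); rewrite -{2}[K.+1 ^ s]muln1 ltn_mul2l => /andP[_]; lia.
elim: s lef {ltX} => [|s IH] lef.
  by exists [::]; split=> //; rewrite !expn0 !mul1n max_card.
have [|ys [h1 h2 h3 h4 h5]] := IH; first by rewrite mulnS in lef; lia.
have [U0|U0] := eqVneq [set x | ~~ has (R x) ys] set0.
  by exists ys; split=> //; [apply: leqW|rewrite U0 cards0 muln0].
pose F' := F :|: [set z in flatten (map supp ys)].
have leF' : #|F'| <= f.
  apply: leq_trans (leq_card_setU _ _) _; rewrite card_set_seq // (@size_flatten_const _ _ L).
    by rewrite size_map; move: h1 lef; clear; nia.
  by move=> _ /mapP[y _ ->].
have [y [/andP[uy /allP ay] ex le]] := greedy_step Y0 (fun x => h F' x leF') U0.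
exists (y :: ys); split=> //=.
- rewrite cat_uniq uy h2 andbT; apply/hasPn=> z zin; apply/negP=> /ay.
  by rewrite !inE zin orbT.
- by move=> z; rewrite mem_cat => /orP[/ay|/h3 //]; rewrite inE negb_or => /andP[].
- by move=> z; rewrite inE => /orP[/eqP-> //|/h4].
- have -> : [set x | ~~ (R x y || has (R x) ys)] = [set x in [set x | ~~ has (R x) ys] | ~~ R x y].
    by apply/setP=> x; rewrite !inE negb_or andbC.
  rewrite !expnS -!mulnA mulnCA; apply: leq_trans (leq_mul (leqnn _) le) _.
  by rewrite mulnCA leq_mul2l h5 orbT.
Qed.

(** * Absorbers of q-tuples and the absorbing set *)

Section Absorbers.
Variable j : nat.
Local Notation k := j.+3.
Local Notation q := (2 * j + 5).

Definition triangle_type (V : finType) : finType :=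
  (j.+2.-tuple V * (V * (V * j.+1.-tuple V)))%type.

Definition triangle_seq (V : finType) (g : triangle_type V) : seq V :=
  let: (A, (x, (y, W))) := g in A ++ x :: y :: W.

Lemma size_triangle_seq (V : finType) (g : triangle_type V) : size (triangle_seq g) == q.
Proof. by move: g => [S [x [y W]]]; rewrite /= size_cat /= !size_tuple; apply/eqP; lia. Qed.

Definition triangle_tuple (V : finType) (g : triangle_type V) : q.-tuple V :=
  Tuple (size_triangle_seq g).

Lemma triangle_seq_inj (V : finType) : injective (@triangle_seq V).
Proof.
move=> [S [x [y W]]] [S' [x' [y' W']]] /= /eqP; rewrite eqseq_cat ?size_tuple // => /andP[/eqP/val_inj->].
by move=> /eqP[-> -> /val_inj->].
Qed.

Lemma many_triangle : exists K N, forall (V : finType) (H : hypergraph V),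
  codegree_dense j H -> N <= #|V| -> 0 < #|V| ->
  many K (fun g : triangle_type V => triangle H j (triangle_seq g)).
Proof.
exists (2 * (k * (2 * k * (2 * k)))), (2 * (j.+2 * j.+2) + 2 * k + 2 * (j * j.+2)) => V H cd nV V0.
have [n0 n1 n2] : [/\ 2 * (j.+2 * j.+2) <= #|V|, 2 * k <= #|V| & 2 * (j * j.+2) <= #|V|].
  by move: nV; move: (2 * (_ * _)) (2 * k) (2 * (_ * _)); clear; move=> *; split; lia.
have mS : many 2 (fun S : j.+2.-tuple V => uniq S).
  have h := @many_uniq V _ (fun W : j.+2.-tuple V => W : seq V) j.+2 1 xpredT set0.
  apply: many_sub (h _ _ _ _ _ _) _ => //; try by move=> ?; rewrite size_tuple.
  - exact: val_inj.
  - by rewrite card_tuple.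
  - by rewrite cards0 muln1 addn0.
  - exact: many_predT.
  - by move=> S /= /andP[].
apply: many_nest; apply: many_sub mS _ => S uS.
have mx : many k (fun x => edge H (x :: S)) by apply: many_neighbor; rewrite ?size_tuple.
apply: many_nest; apply: many_sub (mx) _ => x ex.
have := many_avoid (F := [set x]) mx; rewrite cards1 muln1 => /(_ n1) my.
apply: many_nest; apply: many_sub my _ => y /andP[ey]; rewrite inE eq_sym => xy.
apply: many_sub (many_edge cd n2 xy) _ => W eW.
by rewrite /triangle_seq triangle_cat ?size_tuple // ex ey.
Qed.

(** A central triangle together with one switch per position, which exchanges the vertex of the
    triangle in that position with the vertex of the absorbed tuple. *)
Definition absorber_type (V : finType) : finType :=
  (triangle_type V * {ffun 'I_q -> switch_type j V})%type.

Definition absorber_seq (V : finType) (a : absorber_type V) : seq V :=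
  triangle_seq a.1 ++ flatten [seq switch_seq (a.2 i) | i <- enum 'I_q].

Definition absorbs (V : finType) (H : hypergraph V) (t : q.-tuple V) (a : absorber_type V) :=
  triangle H j (triangle_seq a.1) &&
  [forall i, switch H (tnth t i) (tnth (triangle_tuple a.1) i) (a.2 i)].

Lemma size_absorber_seq (V : finType) (a : absorber_type V) :
  size (absorber_seq a) = q + q * (6 * j + 14).
Proof.
rewrite size_cat (eqP (size_triangle_seq _)) (@size_flatten_const _ _ (6 * j + 14)).
  by rewrite size_map size_enum_ord (mulnC q).
by move=> _ /mapP[i _ ->]; rewrite size_switch_seq.
Qed.

Lemma absorber_seq_inj (V : finType) : injective (@absorber_seq V).
Proof.
move=> [g f] [g' f'] /eqP; rewrite /absorber_seq eqseq_cat; last first.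
  by rewrite !(eqP (size_triangle_seq _)).
move=> /andP[/eqP/triangle_seq_inj /= -> /eqP h]; congr (_, _).
apply/ffunP=> i; apply: switch_seq_inj.
have /eq_in_map e : [seq switch_seq (f i) | i <- enum 'I_q] = [seq switch_seq (f' i) | i <- enum 'I_q].
  apply: eq_from_flatten_shape h _; rewrite /shape -!map_comp; apply: eq_map => l /=.
  by rewrite !size_switch_seq.
by apply: e; rewrite mem_enum.
Qed.

Lemma card_absorber_type (V : finType) :
  #|absorber_type V| = #|V| ^ (q + q * (6 * j + 14)).
Proof.
rewrite /absorber_type card_prod card_ffun card_switch_type card_ord [in RHS]expnD (mulnC q) (expnM _ _ q).
congr (_ * _); rewrite !card_prod !card_tuple.
have -> : 2 * j + 5 = j.+2 + (1 + (1 + j.+1)) by lia.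
by rewrite !expnD expn1.
Qed.

Lemma perm_flatten_zip (I T : eqType) (f : I -> T) (g : I -> seq T) s :
  perm_eq (flatten [seq f i :: g i | i <- s]) (map f s ++ flatten (map g s)).
Proof.
elim: s => //= i s IH; rewrite perm_cons (perm_trans (_ : perm_eq _ (g i ++ map f s ++ flatten (map g s)))) //.
  by rewrite perm_cat2l.
by perm_by_count.
Qed.

(** Alone, each switch is completed by its vertex of the central triangle; in the presence of [t] it
    is completed by an entry of [t], and the central triangle becomes a tile itself. *)
Lemma absorbs_tileable (V : finType) (H : hypergraph V) t a :
  absorbs H t a -> tileable H j (absorber_seq a) /\ tileable H j (t ++ absorber_seq a).
Proof.
case: a => g f /andP[/= tg /forallP sw]; rewrite /absorber_seq /=; split.
  rewrite -[triangle_seq g]/(tval (triangle_tuple g)) -(map_tnth_enum (triangle_tuple g)).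
  apply: tileable_perm (perm_flatten_zip (tnth (triangle_tuple g)) (fun i => switch_seq (f i)) _) _.
  by apply: tileable_flatten => _ /mapP[i _ ->]; apply: switch_tileable_r (sw i).
apply: (@tileable_perm _ _ _ (triangle_seq g ++ (t ++ flatten [seq switch_seq (f i) | i <- enum 'I_q]))).
  by perm_by_count.
apply: tileable_cat; first exact: tileable_triangle.
rewrite -{1}(map_tnth_enum t).
apply: tileable_perm (perm_flatten_zip (tnth t) (fun i => switch_seq (f i)) _) _.
by apply: tileable_flatten => _ /mapP[i _ ->]; apply: switch_tileable_l (sw i).
Qed.

Lemma many_absorbs : exists K N, forall (V : finType) (H : hypergraph V) t,
  codegree_dense j H -> N <= #|V| -> 0 < #|V| -> many K (absorbs H t).
Proof.
have [K1 [N1 h1]] := many_triangle; have [K2 [N2 h2]] := many_switch j.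
exists (K1 * K2 ^ q), (N1 + N2) => V H t cd nV V0.
apply: many_nest; apply: many_sub (h1 V H cd _ V0) _; first by lia.
move=> g tg.
have := @many_ffun 'I_q _ K2 (fun i => switch H (tnth t i) (tnth (triangle_tuple g) i)).
rewrite card_ord => /(_ j) h; apply: many_sub (h _) _ => [i|f hf]; first by apply: h2 => //; lia.
by rewrite /absorbs /= tg.
Qed.

(** One family is spent on each block of q vertices of [U]: the absorber of that block is used, and
    the other members of the family tile themselves. *)
Lemma absorber_rounds (V : finType) (H : hypergraph V) (yss : seq (seq (absorber_type V))) U :
  (forall ys, ys \in yss -> (forall y, y \in ys -> exists t, absorbs H t y) /\
     forall t, exists2 y, y \in ys & absorbs H t y) ->
  q %| size U -> size U <= q * size yss ->
  tileable H j (U ++ flatten [seq flatten (map (@absorber_seq V) ys) | ys <- yss]).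
Proof.
elim: yss U => [|ys yss IH] U h dU leU.
  by move: leU; rewrite muln0 leqn0 size_eq0 => /eqP->; apply: tileable_nil.
have [hys1 hys2] := h ys (mem_head _ _).
have {}IH := IH _ (fun zs hzs => h zs (@mem_behead _ (ys :: yss) zs hzs)).
have tl zs : {subset zs <= ys} -> tileable H j (flatten (map (@absorber_seq V) zs)).
  move=> sub; apply: tileable_flatten => _ /mapP[y /sub/hys1[t ay] ->].
  by case: (absorbs_tileable ay).
have [U0|Up] := posnP (size U).
  rewrite (size0nil U0) /=; apply: tileable_cat; first exact: tl.
  exact: (IH [::]).
have qU : q <= size U by apply: dvdn_leq.
have st : size (take q U) == q by rewrite size_takel.
have [y yin ay] := hys2 (Tuple st); have [_ ty] := absorbs_tileable ay.
have pys := perm_to_rem yin.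
apply: (@tileable_perm _ _ _ ((take q U ++ absorber_seq y) ++
  (flatten (map (@absorber_seq V) (rem y ys)) ++
  (drop q U ++ flatten [seq flatten (map (@absorber_seq V) ys) | ys <- yss])))).
  have pf := perm_flatten2 (perm_map (@absorber_seq V) pys); rewrite /= in pf.
  rewrite -{3}(cat_take_drop q U) /=; apply/seq.permP=> p; have /seq.permP/(_ p) := pf.
  rewrite !count_cat; lia.
apply: tileable_cat => //; apply: tileable_cat; first by apply: tl; apply: mem_rem.
apply: IH; rewrite size_drop; first by rewrite dvdn_subr.
by move: leU; rewrite /= mulnS; lia.
Qed.

Lemma absorbing_set zeta c : exists N, forall (V : finType) (H : hypergraph V),
  codegree_dense j H -> N <= #|V| -> exists Z, [/\ uniq Z, zeta * size Z <= #|V| &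
    forall U, q %| size U -> size U <= c -> tileable H j (U ++ Z)].
Proof.
have [K [N1 h1]] := many_absorbs.
pose L := q + q * (6 * j + 14); pose M := (2 * K).+1.
have q0 : 0 < q by lia.
(* At most L s c vertices are used in c rounds of s steps. The summand [zeta] makes the resulting
   set small, and the other summand keeps the absorbers that avoid all vertices used so far dense.
   The exponent q counts the n^q tuples to be served. *)
have [N2 h2] := @exp_ratio_beats_poly M q ((zeta + 2 * K * (L * (q + L))) * (L * c + 1) + 1) isT q0.
exists (N1 + N2 + 1) => V H cd nV.
have V0 : 0 < #|V| by lia.
have [|s [le1 le2]] := h2 #|V|; first by lia.
pose f := L * s * c.
pose R (t : q.-tuple V) (a : absorber_type V) := absorbs H t a.
have mR (F : {set V}) t : #|F| <= f ->
   many M.+1 (fun a => R t a && (uniq (absorber_seq a) && all (fun z => z \notin F) (absorber_seq a))).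
  move=> leF; apply: (@many_weaken _ (2 * K)); last by rewrite /M; lia.
  apply: (@many_uniq V _ (@absorber_seq V) L) => //.
  - exact: size_absorber_seq.
  - exact: absorber_seq_inj.
  - exact: card_absorber_type.
  - apply: leq_trans le1; rewrite /f in leF; apply: leq_trans (_ : 2 * K * (L * (q + L)) * (L * c + 1) * s.+1 <= _); last first.
      by rewrite leq_mul2r; apply/orP; right; clear; nia.
    rewrite -!mulnA !leq_mul2l; apply/orP; right; apply/orP; right; apply/orP; right.
    by move: leF; clear; nia.
  - by apply: h1 => //; lia.
have Y0 : 0 < #|absorber_type V| by rewrite card_absorber_type expn_gt0 V0.
have rounds r : r <= c -> exists yss, [/\ size yss = r,
    uniq (flatten [seq flatten (map (@absorber_seq V) ys) | ys <- yss]),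
    size (flatten [seq flatten (map (@absorber_seq V) ys) | ys <- yss]) <= L * s * r &
    forall ys, ys \in yss -> (forall y, y \in ys -> exists t, absorbs H t y) /\
      forall t, exists2 y, y \in ys & absorbs H t y].
  elim: r => [|r IH] ler; first by exists [::].
  have [yss [e1 e2 e3 e4]] := IH (ltnW ler).
  set Z := flatten _ in e2 e3.
  have [||ys [g1 g2 g3 g4 g5]] := greedy_cover Y0 (@size_absorber_seq V) mR (s := s) (F := [set z in Z]).
  - rewrite card_set_seq //; apply: leq_trans (_ : L * s * r + L * s <= _); first by rewrite leq_add2r.
    by rewrite /f -mulnSr leq_mul2l ler orbT.
  - by rewrite card_tuple.
  exists (ys :: yss); split=> /=.
  - by rewrite e1.
  - rewrite cat_uniq g2 e2 andbT; apply/hasPn=> z zZ; apply/negP=> /g3.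
    by rewrite inE zZ.
  - rewrite size_cat -/Z mulnS leq_add // (@size_flatten_const _ _ L).
      by rewrite size_map leq_mul2l g1 orbT.
    by move=> _ /mapP[y _ ->]; rewrite size_absorber_seq.
  - by move=> zs; rewrite inE => /orP[/eqP->|/e4].
have [yss [e1 e2 e3 e4]] := rounds c (leqnn c).
exists (flatten [seq flatten (map (@absorber_seq V) ys) | ys <- yss]); split=> //.
  apply: leq_trans le1; apply: leq_trans (leq_mul (leqnn _) e3) _.
  by clear; nia.
move=> U dU leU; apply: absorber_rounds => //; rewrite e1; apply: leq_trans leU _.
by rewrite leq_pmull //; lia.
Qed.

End Absorbers.

(** * Heaviest packings of triangles and cherries *)

Lemma exists_maximum (P : nat -> Prop) n0 b :
  P n0 -> (forall n, P n -> n <= b) -> exists2 n, P n & forall n', P n' -> n' <= n.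
Proof.
move=> + hb; move e : (b - n0) => d; elim/ltn_ind: d n0 e => d IH n0 e Pn0.
have [[n' [Pn' lt]]|nex] := classic (exists n', P n' /\ n0 < n').
  have [lb lb'] := (hb _ Pn', hb _ Pn0).
  by apply: IH (erefl _) Pn'; lia.
exists n0 => // n' Pn'; rewrite leqNgt; apply/negP=> lt; apply: nex; by exists n'.
Qed.

(* In a bipartite graph without two disjoint edges, all the edges share a vertex. *)
Lemma two_disjoint_incidences (I T : finType) (A : {set T}) (r : I -> T -> bool) M :
  #|I| <= M -> #|A| <= M -> M < \sum_i #|[set z in A | r i z]| ->
  exists i i' z z', [/\ i != i', z != z', (z \in A) && (z' \in A) & r i z && r i' z'].
Proof.
move=> leI leA ltM; apply: NNPP => nex.
pose row i := [set z in A | r i z].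
have same i i' z z' : i != i' -> z \in row i -> z' \in row i' -> z = z'.
  rewrite !inE => neq /andP[zA rz] /andP[zA' rz']; apply/eqP; apply: contraT => nz.
  by case: nex; exists i, i', z, z'; rewrite zA zA' rz rz'.
move: ltM; rewrite ltnNge => /negP; apply; rewrite -/(row _).
have [/existsP[i0 /set0Pn[z0 h0]]|/existsPn all0] := boolP [exists i, row i != set0]; last first.
  by rewrite big1 // => i _; have := all0 i; rewrite negbK -/(row i) => /eqP->; rewrite cards0.
have [/existsP[i1 /andP[n1 /set0Pn[z1 h1]]]|/existsPn all1] := boolP [exists i, (i != i0) && (row i != set0)].
  apply: leq_trans leI; rewrite -sum1_card; apply: leq_sum => i _.
  rewrite -(cards1 z0); apply: subset_leq_card; apply/subsetP=> z hz; rewrite inE; apply/eqP.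
  have [ei|ni] := eqVneq i i0; last exact: same ni hz h0.
  rewrite ei in hz.
  by rewrite -(same _ _ _ _ n1 h1 hz) (same _ _ _ _ n1 h1 h0).
rewrite (bigD1 i0) //= big1 ?addn0; last first.
  by move=> i ni; have := all1 i; rewrite ni /= negbK => /eqP; rewrite /row => ->; rewrite cards0.
by apply: leq_trans leA; apply: subset_leq_card; apply/subsetP=> z; rewrite inE => /andP[].
Qed.

Section ListPicking.
Variable T : eqType.
Implicit Types (ss : seq (seq T)) (s : seq T).

Lemma perm_pick2 ss i i' : i < size ss -> i' < size ss -> i != i' ->
  exists rest, perm_eq ss (nth [::] ss i :: nth [::] ss i' :: rest).
Proof.
elim: ss i i' => // s ss IH [|i] [|i'] //=; rewrite ?ltnS => lti lti' neq.
- exists (rem (nth [::] ss i') ss); rewrite perm_cons; apply: perm_to_rem; exact: mem_nth.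
- exists (rem (nth [::] ss i) ss); rewrite perm_sym -cat1s perm_catC /= perm_cons perm_catC /=.
  by rewrite perm_sym perm_to_rem // mem_nth.
- have [rest p] := IH i i' lti lti' neq; exists (s :: rest).
  rewrite (perm_trans (_ : perm_eq _ (s :: nth [::] ss i :: nth [::] ss i' :: rest))) ?perm_cons //.
  by rewrite -[s :: _ :: _ :: _]cat1s perm_catC /= !perm_cons perm_catC.
Qed.

Lemma count_pick2 p ss i i' : i < size ss -> i' < size ss -> i != i' ->
  count p (nth [::] ss i) + count p (nth [::] ss i') <= count p (flatten ss).
Proof.
move=> lti lti' neq; have [rest /perm_flatten2/seq.permP->] := perm_pick2 lti lti' neq.
by rewrite /= !count_cat; lia.
Qed.

Lemma count_pick1 p ss i : count p (nth [::] ss i) <= count p (flatten ss).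
Proof.
have [lt|ge] := ltnP i (size ss); last by rewrite nth_default.
by apply: count_flatten_mem; apply: mem_nth.
Qed.

Definition blocks r b s := reshape (nseq r b) s.

Lemma flatten_blocks r b s : r * b <= size s -> flatten (blocks r b s) = take (r * b) s.
Proof.
move=> le; have -> : blocks r b s = reshape (nseq r b) (take (r * b) s).
  rewrite /blocks; elim: r s le => //= r IH s le; rewrite take_takel; last by rewrite mulSn; lia.
  rewrite (IH (drop b s)); last by rewrite size_drop; rewrite mulSn in le; lia.
  by congr (_ :: reshape _ _); rewrite take_drop mulSn addnC.
by rewrite reshapeKr // sumn_nseq size_takel // mulnC.
Qed.

Lemma size_blocks r b s : size (blocks r b s) = r.
Proof. by rewrite size_reshape size_nseq. Qed.

Lemma size_nth_blocks r b s i : r * b <= size s -> i < r -> size (nth [::] (blocks r b s) i) = b.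
Proof.
elim: r s i => // r IH s [|i] le lti /=; first by rewrite size_takel //; rewrite mulSn in le; lia.
by apply: IH => //; rewrite size_drop; rewrite mulSn in le; lia.
Qed.

Lemma count_blocks p r b s : r * b <= size s -> count p (flatten (blocks r b s)) <= count p s.
Proof.
by move=> le; rewrite flatten_blocks // -{2}(cat_take_drop (r * b) s) count_cat leq_addr.
Qed.

End ListPicking.

Section Cherries.
Variables (V : finType) (H : hypergraph V) (j : nat).

Definition cherry (c : seq V) := exists S x y,
  [/\ c = S ++ [:: x; y], size S = j.+2, edge H (x :: S) & edge H (y :: S)].

Lemma size_cherry c : cherry c -> size c = j + 4.
Proof. by move=> [S [x [y [-> sS _ _]]]]; rewrite size_cat sS /=; lia. Qed.

(** The vertices x and y are the tips of the cherry. As [W] is arbitrary, only z has to be found,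
    namely a neighbour of the (k-1)-set formed by x, y and [W]. *)
Lemma cherry_extend c : cherry c -> exists x y,
  (forall p : pred V, count p [:: x; y] <= count p c) /\
  forall W z, size W = j -> edge H (z :: x :: y :: W) ->
    exists2 t, triangle H j t & perm_eq t (z :: c ++ W).
Proof.
move=> [S [x [y [-> sS ex ey]]]]; exists x, y; split; first by move=> p; rewrite count_cat leq_addl.
move=> W z sW ez; exists (S ++ x :: y :: rcons W z).
  rewrite triangle_cat ?size_rcons ?sW // ex ey /=.
  by rewrite (@edge_perm _ _ _ (z :: x :: y :: W)) // -cats1; perm_by_count.
by rewrite -cats1; perm_by_count.
Qed.

Definition nb (s : seq V) := [set x | (x \notin s) && edge H (x :: s)].

End Cherries.

Lemma count_set (V : finType) (p : pred V) (s : seq V) :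
  uniq s -> count p s = #|[set z in s | p z]|.
Proof.
move=> us; rewrite -size_filter -card_set_seq ?filter_uniq //.
by apply: eq_card => z; rewrite !inE mem_filter andbC.
Qed.

Lemma sum_count_flatten (T : Type) (p : pred T) (ss : seq (seq T)) :
  count p (flatten ss) = \sum_(s <- ss) count p s.
Proof. by elim: ss => [|s ss IH] /=; rewrite ?big_nil // big_cons count_cat IH. Qed.

Lemma count_two (T : eqType) (s : seq T) z z' v : z != z' -> z \in s -> z' \in s ->
  count_mem v [:: z; z'] <= count_mem v s.
Proof.
move=> neq zs zs'; rewrite /= addn0.
have [<-|_] := eqVneq z v; last by case: eqP => [<-|//]; rewrite -has_count has_pred1.
by rewrite eq_sym (negbTE neq) addn0 -has_count has_pred1.
Qed.

Section Packing.
Variables (j : nat) (V : finType) (H : hypergraph V) (m : nat) (Z : {set V}).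
Local Notation q := (2 * j + 5).
Hypothesis cV : #|V| = q * m.
Hypothesis cod : forall S : {set V}, #|S| = j.+2 -> 2 * m <= codegree H S.

Lemma card_nb s : uniq s -> size s = j.+2 -> 2 * m <= #|nb H s|.
Proof.
move=> us ss; apply: leq_trans (cod (S := [set z in s]) _) _; first by rewrite card_set_seq.
apply: subset_leq_card; apply/subsetP=> x; rewrite !inE => /andP[-> h]; rewrite /edge.
by have -> : [set z in x :: s] = x |: [set z in s] by apply/setP=> z; rewrite !inE.
Qed.

(* The reserve of [q * j] uncovered vertices supplies the free vertices of
   the triangles built from cherries. *)
Definition packing (ts cs : seq (seq V)) := [/\ forall t, t \in ts -> triangle H j t,
  forall c, c \in cs -> cherry H j c,
  forall v, count_mem v (flatten ts) + count_mem v (flatten cs) <= (v \notin Z) &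
  q * size ts + (j + 4) * size cs + q * j <= #|~: Z|].

(* A triangle weighs slightly more than two cherries, but less than three. *)
Definition weight (ts cs : seq (seq V)) := (2 * j + 11) * size ts + (j + 5) * size cs.

Variables ts cs : seq (seq V).
Hypothesis pk : packing ts cs.
Hypothesis maxw : forall ts' cs', packing ts' cs' -> weight ts' cs' <= weight ts cs.

Definition uncovered : seq V := [seq v <- enum (~: Z) | (v \notin flatten ts) && (v \notin flatten cs)].
Local Notation u := uncovered.

Lemma packing_count v :
  count_mem v (flatten ts) + count_mem v (flatten cs) + count_mem v u = (v \notin Z).
Proof.
case: pk => _ _ le _; have := le v.
rewrite (count_uniq_mem v (filter_uniq _ (enum_uniq _))) mem_filter mem_enum inE.
have m1 := has_pred1 v (flatten ts); have m2 := has_pred1 v (flatten cs).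
rewrite !has_count in m1 m2; rewrite -m1 -m2.
move: (count_mem v (flatten ts)) (count_mem v (flatten cs)) => a b.
by case: (v \in Z) => /=; case: a => [|a]; case: b => [|b] /=; lia.
Qed.

Lemma packing_uniq_ts : uniq (flatten ts).
Proof. by apply: uniq_count_le1 => v; have := packing_count v; case: (v \notin Z); lia. Qed.

Lemma packing_uniq_u : uniq u.
Proof. by rewrite filter_uniq ?enum_uniq. Qed.

Lemma packing_perm : perm_eq (flatten ts ++ flatten cs ++ u) (enum (~: Z)).
Proof.
apply: perm_enum_set => [|x].
  by apply: uniq_count_le1 => v; rewrite !count_cat; have := packing_count v; case: (v \notin Z); lia.
rewrite -has_pred1 has_count !count_cat inE; have := packing_count x.
by case: (x \notin Z) => /=; lia.
Qed.

Lemma size_flatten_ts : size (flatten ts) = q * size ts.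
Proof. by case: pk => h _ _ _; apply: size_flatten_const => t /h/triangle_size. Qed.

Lemma size_flatten_cs : size (flatten cs) = (j + 4) * size cs.
Proof. by case: pk => _ h _ _; apply: size_flatten_const => t /h/size_cherry. Qed.

Lemma packing_size : q * size ts + (j + 4) * size cs + size u = #|~: Z|.
Proof.
rewrite cardE -(perm_size packing_perm) !size_cat.
by rewrite -size_flatten_ts -size_flatten_cs addnA.
Qed.

Lemma reserve : q * j <= size u.
Proof. by case: pk => _ _ _; rewrite -packing_size; lia. Qed.

Lemma size_ts : size ts <= m.
Proof.
have q0 : 0 < q by lia.
rewrite -(leq_pmul2l q0) -cV; apply: leq_trans (max_card [in ~: Z]).
by rewrite -packing_size; lia.
Qed.

Lemma no_heavier ts' cs' : (forall t, t \in ts' -> triangle H j t) ->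
  (forall c, c \in cs' -> cherry H j c) ->
  (forall v, count_mem v (flatten ts') + count_mem v (flatten cs') <=
     count_mem v (flatten ts) + count_mem v (flatten cs) + count_mem v u) ->
  q * size ts' + (j + 4) * size cs' + q * j <= q * size ts + (j + 4) * size cs + size u ->
  weight ts' cs' <= weight ts cs.
Proof.
move=> h1 h2 h3 h4; apply: maxw; split=> //; last by rewrite -packing_size.
by move=> v; apply: leq_trans (h3 v) _; rewrite packing_count.
Qed.

Lemma triangles_ts t : t \in ts -> triangle H j t.
Proof. by case: pk => h _ _ _; apply: h. Qed.

Lemma cherries_cs c : c \in cs -> cherry H j c.
Proof. by case: pk => _ h _ _; apply: h. Qed.

(** Suppose there are q cherries and give each its own j reserved vertices. A covering vertex in
    another cherry turns two cherries into a triangle, which gains 1; one in the uncovered set turns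
    a cherry into a triangle. So nearly all of the 2m covering vertices of each cherry lie in
    triangles, of which there are at most m. *)
Lemma few_cherries : #|Z| + (j + 4) + (q * j + j + 1) < m -> size cs < q.
Proof.
move=> ltm; rewrite ltnNge; apply/negP=> lecs.
pose ws := blocks q j u.
have ltc (i : 'I_q) : i < size cs by apply: leq_trans lecs.
have cc (i : 'I_q) : cherry H j (nth [::] cs i) by apply: cherries_cs; apply: mem_nth.
have /fin_all_exists[f hf] : forall i : 'I_q, exists xy : V * V,
    (forall p : pred V, count p [:: xy.1; xy.2] <= count p (nth [::] cs i)) /\
    forall W z, size W = j -> edge H (z :: xy.1 :: xy.2 :: W) ->
    exists2 t, triangle H j t & perm_eq t (z :: nth [::] cs i ++ W).
  by move=> i; have [x [y h]] := cherry_extend (cc i); exists (x, y).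
pose s (i : 'I_q) := (f i).1 :: (f i).2 :: nth [::] ws i.
have sws (i : 'I_q) : size (nth [::] ws i) = j by rewrite size_nth_blocks // reserve.
have wsu p : count p (flatten ws) <= count p u by rewrite count_blocks ?reserve.
have us i : uniq (s i).
  apply: uniq_count_le1 => v; have := packing_count v.
  have := leq_trans (count_pick1 (pred1 v) ws i) (wsu _).
  have := (hf i).1 (pred1 v); have := count_pick1 (pred1 v) cs i.
  by rewrite /s /=; case: (v \notin Z); goal_lia.
have lower i : 2 * m <= #|Z| + (j + 4) + (q * j + j + 1) + count [in nb H (s i)] (flatten ts).
  apply: leq_trans (card_nb (us i) _) _; first by rewrite /s /= sws.
  (* Turning a cherry into a triangle consumes j+1 uncovered vertices. If this would cut into the
     reserve, the uncovered set has at most q j + j elements and is discounted as a whole. *)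
  pose U := if size u <= q * j + j then [set z in u] else set0.
  have cU : #|U| <= q * j + j + 1.
    rewrite /U; case: ifP => [le|_]; last by rewrite cards0.
    by rewrite card_set_seq ?packing_uniq_u //; move: le; goal_lia.
  rewrite (count_set _ packing_uniq_ts); set F := [set z in flatten ts | _].
  apply: leq_trans (_ : #|Z :|: [set z in nth [::] cs i] :|: U :|: F| <= _); last first.
    apply: leq_trans (leq_card_setU _ _) _; rewrite leq_add2r.
    apply: leq_trans (leq_card_setU _ _) _; apply: leq_add => //.
    apply: leq_trans (leq_card_setU _ _) _; rewrite leq_add2l.
    by apply: leq_trans (eq_leq (cardsE _)) _; apply: leq_trans (card_size _) _; rewrite (size_cherry (cc i)).
  apply: subset_leq_card; apply/subsetP=> z zn; rewrite !inE.
  move: (zn); rewrite inE => /andP[zs ez].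
  have [//|zZ] := boolP (z \in Z); have [//|zc] := boolP (z \in nth [::] cs i).
  have [zt|zt] := boolP (z \in flatten ts); first by rewrite /= ?zn ?zs ?ez ?orbT.
  rewrite orbF /=.
  have [t tt pt] := (hf i).2 _ z (sws i) ez.
  have pcs := perm_to_rem (mem_nth [::] (ltc i)).
  have zwN : z \notin nth [::] ws i by move: zs; rewrite /s !inE !negb_or => /and3P[].
  have := packing_perm; move=> /perm_mem/(_ z); rewrite mem_enum !mem_cat inE zZ (negbTE zt) /=.
  have [/flattenP[c cin zcin] _|zcs /= zu] := boolP (z \in flatten cs).
    have crem : c \in rem (nth [::] cs i) cs.
      move: cin; rewrite (perm_mem pcs) inE => /orP[/eqP e|//].
      by rewrite -e zcin in zc.
    have pc2 := perm_to_rem crem; set cs2 := rem c _ in pc2.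
    have e1 := perm_size pcs; have e2 := perm_size pc2; rewrite /= in e1 e2.
    suff : weight (t :: ts) cs2 <= weight ts cs by rewrite /weight e1 e2 /=; goal_lia.
    apply: no_heavier.
    - by move=> a; rewrite inE => /orP[/eqP->//|]; apply: triangles_ts.
    - by move=> a acs; apply: cherries_cs; rewrite (perm_mem pcs) inE (perm_mem pc2) inE acs !orbT.
    - move=> v; rewrite count_flatten_cons; have /seq.permP/(_ (pred1 v)) := perm_flatten2 pcs.
      have /seq.permP/(_ (pred1 v)) := perm_flatten2 pc2; rewrite !count_flatten_cons.
      have /seq.permP/(_ (pred1 v)) := pt; rewrite [count _ (z :: _)]/= count_cat.
      have := leq_trans (count_pick1 (pred1 v) ws i) (wsu (pred1 v)).
      have : (z == v) <= count_mem v c.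
        by case: eqP => // <-; rewrite -has_count has_pred1.
      by goal_lia.
    - by rewrite e1 e2; have := reserve; rewrite /=; goal_lia.
  rewrite /U; case: leqP => [_|ltu]; first by rewrite inE zu.
  have e1 := perm_size pcs; rewrite /= in e1.
  suff : weight (t :: ts) (rem (nth [::] cs i) cs) <= weight ts cs by rewrite /weight e1 /=; goal_lia.
  apply: no_heavier.
  - by move=> a; rewrite inE => /orP[/eqP->//|]; apply: triangles_ts.
  - by move=> a acs; apply: cherries_cs; rewrite (perm_mem pcs) inE acs orbT.
  - move=> v; rewrite count_flatten_cons; have /seq.permP/(_ (pred1 v)) := perm_flatten2 pcs.
    rewrite !count_flatten_cons; have /seq.permP/(_ (pred1 v)) := pt; rewrite [count _ (z :: _)]/= count_cat.
    have := leq_trans (count_pick1 (pred1 v) ws i) (wsu (pred1 v)).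
    have : (z == v) + count_mem v (nth [::] ws i) <= count_mem v u.
      have := leq_trans (count_pick1 (pred1 v) ws i) (wsu (pred1 v)).
      case: eqP => // <- _; rewrite (count_memPn zwN) addn0 -has_count has_pred1 //.
    by goal_lia.
  - by move: ltu; rewrite e1 /=; goal_lia.
(* The q cherries have more than q m incidences with at most m triangles, so some triangle receives
   more than q of them. *)
have [t tin ht] : exists2 t, t \in ts & q < \sum_(i < q) count [in nb H (s i)] t.
  apply/hasP; apply: contraT => /hasPn hn.
  set E := #|Z| + _ + _ in lower ltm.
  have h1 : q * (2 * m) <= q * E + \sum_(i < q) count [in nb H (s i)] (flatten ts).
    rewrite -{1 2}(card_ord q) -!sum_nat_const -big_split; apply: leq_sum => i _; exact: lower.
  rewrite (eq_bigr (fun i => \sum_(t <- ts) count [in nb H (s i)] t)) in h1; last first.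
    by move=> i _; rewrite sum_count_flatten.
  rewrite exchange_big /= in h1.
  have : \sum_(t <- ts) \sum_(i < q) count [in nb H (s i)] t <= \sum_(t <- ts) q.
    by rewrite big_seq [X in _ <= X]big_seq; apply: leq_sum => t /hn; rewrite -leqNgt.
  rewrite big_const_seq count_predT iter_addn addn0 => h2.
  have h3 : q * (2 * m) <= q * (E + m).
    rewrite mulnDr; apply: leq_trans h1 _; rewrite leq_add2l; apply: leq_trans h2 _.
    by rewrite leq_mul2l size_ts orbT.
  by move: h3; rewrite leq_mul2l => /orP[/eqP|]; move: ltm; goal_lia.
have ut : uniq t by apply: uniq_flatten_mem packing_uniq_ts tin.
(* Two cherries take different vertices of [t]: the triangle and both cherries become two triangles,
   which gains 1. *)
have [|||i [i' [z [z' [nii nzz /andP[]]]]]] := @two_disjoint_incidences 'I_q _ [set z in t]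
  (fun i z => z \in nb H (s i)) q.
- by rewrite card_ord.
- by rewrite card_set_seq // (triangle_size (triangles_ts tin)).
- by apply: leq_trans ht _; apply: leq_sum => i _; rewrite count_set //; apply: eq_leq; apply: eq_card => z; rewrite !inE.
rewrite !inE => zt zt' /andP[/andP[_ ez] /andP[_ ez']].
have [t1 tt1 pt1] := (hf i).2 _ z (sws i) ez.
have [t2 tt2 pt2] := (hf i').2 _ z' (sws i') ez'.
have [rest pcs] := perm_pick2 (ltc i) (ltc i') nii.
have pts := perm_to_rem tin.
suff : weight (t1 :: t2 :: rem t ts) rest <= weight ts cs.
  by rewrite /weight (perm_size pts) (perm_size pcs) /=; goal_lia.
apply: no_heavier.
- by move=> a; rewrite !inE => /or3P[/eqP->|/eqP->|/mem_rem/triangles_ts].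
- by move=> a ain; apply: cherries_cs; rewrite (perm_mem pcs) !inE ain !orbT.
- move=> v; rewrite !count_flatten_cons.
  have /seq.permP/(_ (pred1 v)) := perm_flatten2 pcs; have /seq.permP/(_ (pred1 v)) := perm_flatten2 pts.
  rewrite !count_flatten_cons; have /seq.permP/(_ (pred1 v)) := pt1; have /seq.permP/(_ (pred1 v)) := pt2.
  rewrite [count _ (z :: _)]/= [count _ (z' :: _)]/= !count_cat.
  have := count_two v nzz zt zt'; rewrite [count _ [:: _; _]]/=.
  have h1 : count_mem v (nth [::] ws i) + count_mem v (nth [::] ws i') <= count_mem v u.
    by apply: leq_trans (wsu _); apply: count_pick2 => //; rewrite size_blocks.
  by move: h1; goal_lia.
- by have := reserve; rewrite (perm_size pts) (perm_size pcs) /=; goal_lia.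
Qed.

(** Two neighbours would be the tips of a cherry inside the uncovered set; the size condition
    ensures that adding it leaves the reserve intact. *)
Lemma few_neighbors_uncovered s : uniq s -> size s = j.+2 -> {subset s <= u} ->
  q * j + (j + 4) <= size u -> #|[set z in u | z \in nb H s]| <= 1.
Proof.
move=> us ss su leu; rewrite leqNgt; apply/negP=> lt1.
have [|[|p [|p' [|? ?]]] [] // ul _ hl] := @fresh_seq V [set z in u | z \in nb H s] set0 2.
  by rewrite cards0 addn0.
have [hp hp'] : p \in [set z in u | z \in nb H s] /\ p' \in [set z in u | z \in nb H s].
  by split; [have := hl p|have := hl p']; rewrite !inE eqxx ?orbT => /(_ isT)/andP[].
move: hp hp'; rewrite !inE => /and3P[pu ps ep] /and3P[pu' ps' ep'].
suff : weight ts ((s ++ [:: p; p']) :: cs) <= weight ts cs by rewrite /weight /=; goal_lia.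
apply: no_heavier.
- exact: triangles_ts.
- move=> c; rewrite inE => /orP[/eqP->|]; last exact: cherries_cs.
  by exists s, p, p'.
- move=> v; rewrite count_flatten_cons count_cat.
  have : count_mem v s + count_mem v [:: p; p'] <= count_mem v u.
    rewrite -count_cat; apply: leq_uniq_count; last first.
      by move=> z; rewrite mem_cat !inE => /or3P[/su|/eqP->|/eqP->].
    rewrite cat_uniq us ul andbT /=; apply/norP; split => //.
    by rewrite (negbTE ps').
  by goal_lia.
- by move: leu; rewrite /=; goal_lia.
Qed.

(** * Dense links into a large uncovered set *)

Variable r : nat.
Hypothesis size_u : r * (j.+1 + r) + q * j + (j + 4) * (2 * j + 9) <= size u.

(** The uncovered set is sampled by r disjoint groups, each a fixed core of k-2 vertices with r test
    vertices. Two test vertices in the link of a and the core are the tips of a cherry whose common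
    part is a together with the core. *)
Definition group (i : nat) := nth [::] (blocks r (j.+1 + r) u) i.
Definition group_core i := take j.+1 (group i).
Definition group_rest i := drop j.+1 (group i).
Definition link_degree i (a : V) := count (fun x => edge H (a :: x :: group_core i)) (group_rest i).
(* The [k + 1] copies met by a cherry contain [2k + 2] popular vertices, which need different groups. *)
Definition popular (a : V) := 2 * j + 8 <= #|[set i : 'I_r | 2 <= link_degree i a]|.

Lemma size_rest : q * j + (j + 4) * (2 * j + 9) <= size u.
Proof. by move: size_u; lia. Qed.

Lemma size_groups : r * (j.+1 + r) <= size u.
Proof. by move: size_u; lia. Qed.

Lemma size_group (i : 'I_r) : size (group i) = j.+1 + r.
Proof. by rewrite size_nth_blocks ?size_groups. Qed.

Lemma size_group_core (i : 'I_r) : size (group_core i) = j.+1.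
Proof. by rewrite size_takel // size_group leq_addr. Qed.

Lemma size_group_rest (i : 'I_r) : size (group_rest i) = r.
Proof. by rewrite size_drop size_group addKn. Qed.

Lemma sum_groups p : \sum_(i < r) count p (group i) <= count p u.
Proof.
apply: leq_trans (count_blocks p size_groups); rewrite sum_count_flatten (big_nth [::]) size_blocks.
by rewrite big_mkord.
Qed.

Lemma popular_cherry (i : 'I_r) a : 2 <= link_degree i a ->
  exists2 c, cherry H j c & forall v, count_mem v c <= count_mem v [:: a] + count_mem v (group i).
Proof.
rewrite /link_degree -size_filter; set l := filter _ _ => le2.
have : forall x, x \in l -> edge H (a :: x :: group_core i) by move=> x; rewrite mem_filter => /andP[].
have cl v : count_mem v l <= count_mem v (group_rest i).
  by rewrite count_filter; apply: sub_count => x /= /andP[].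
case: l le2 cl => [|x [|x' l]] // _ cl hl.
exists ((a :: group_core i) ++ [:: x; x']).
  have ex := hl x (mem_head _ _); have ex' : edge H (a :: x' :: group_core i).
    by apply: hl; rewrite !inE eqxx orbT.
  exists (a :: group_core i), x, x'; split=> //; first by rewrite /= size_group_core.
    by rewrite (@edge_perm _ _ _ (a :: x :: group_core i)) //; perm_by_count.
  by rewrite (@edge_perm _ _ _ (a :: x' :: group_core i)) //; perm_by_count.
move=> v; have := cl v; rewrite -[group i](cat_take_drop j.+1) !count_cat /=.
by rewrite -/(group_core i) -/(group_rest i); goal_lia.
Qed.

Lemma popular_cherries l : all popular l -> size l <= 2 * j + 8 -> exists ds,
  [/\ size ds = size l, forall c, c \in ds -> cherry H j c &
      forall v, count_mem v (flatten ds) <= count_mem v l + count_mem v u].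
Proof.
move=> pl sl; suff [ds [is_ [h1 h2 h3 h4 h5]]] : exists (ds : seq (seq V)) (is_ : seq 'I_r),
   [/\ size ds = size l, forall c, c \in ds -> cherry H j c, uniq is_, size is_ = size l &
      forall v, count_mem v (flatten ds) <= count_mem v l + \sum_(i <- is_) count_mem v (group i)].
  exists ds; split=> // v; apply: leq_trans (h5 v) _; rewrite leq_add2l.
  apply: leq_trans (sum_groups _); rewrite big_uniq //=.
  by rewrite [X in _ <= X](bigID (mem is_)) /= leq_addr.
elim: l pl sl => [|a l IH] /=; first by exists [::], [::]; split=> //= v; rewrite big_nil.
move=> /andP[pa pl] sl; have [ds [is_ [h1 h2 h3 h4 h5]]] := IH pl (ltnW sl).
have [i] : exists i, (i \in [set i : 'I_r | 2 <= link_degree i a]) && (i \notin [set i in is_]).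
  apply: fresh_vertex; rewrite card_set_seq // h4; exact: leq_trans sl pa.
rewrite !inE => /andP[/popular_cherry[c cc cv] iN].
exists (c :: ds), (i :: is_); split=> /=; rewrite ?h1 ?h4 ?iN //.
  by move=> d; rewrite inE => /orP[/eqP->|/h2].
move=> v; rewrite big_cons count_cat; have := cv v; have := h5 v; rewrite /=.
by move: (\sum_(_ <- _) _) => x; goal_lia.
Qed.

(** Three cherries weigh 3(j+5), more than the 2j+11 of the triangle that they would replace. *)
Lemma few_popular t : t \in ts -> count popular t <= 2.
Proof.
move=> tin; rewrite leqNgt -size_filter; apply/negP; set l := filter _ _ => lt.
have pts := perm_to_rem tin.
have cl v : count_mem v (take 3 l) <= count_mem v t.
  apply: (@leq_trans (count_mem v l)); first by rewrite -{2}(cat_take_drop 3 l) count_cat leq_addr.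
  by rewrite count_filter; apply: sub_count => x /= /andP[].
have [||ds [h1 h2 h3]] := @popular_cherries (take 3 l).
- by apply/allP=> x /mem_take; rewrite mem_filter => /andP[].
- by rewrite size_takel //; lia.
rewrite size_takel // in h1.
suff : weight (rem t ts) (ds ++ cs) <= weight ts cs.
  by rewrite /weight (perm_size pts) size_cat h1 /=; goal_lia.
apply: no_heavier.
- by move=> a /mem_rem/triangles_ts.
- by move=> c; rewrite mem_cat => /orP[/h2|/cherries_cs].
- move=> v; rewrite flatten_cat count_cat; have /seq.permP/(_ (pred1 v)) := perm_flatten2 pts.
  by rewrite count_flatten_cons; have := h3 v; have := cl v; goal_lia.
- rewrite (perm_size pts) size_cat h1 /=; have := size_rest.
  have : (j + 4) * 3 <= (j + 4) * (2 * j + 9) by rewrite leq_mul2l; lia.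
  by goal_lia.
Qed.

Definition good t := 2 <= count popular t.

Lemma good_popular t : t \in ts -> good t -> count popular t = 2.
Proof. by move=> tin gt; apply/eqP; rewrite eqn_leq few_popular. Qed.

Definition sparse_set := [set v in flatten (filter good ts) | ~~ popular v].

Lemma card_sparse_set : #|sparse_set| = (2 * j + 3) * count good ts.
Proof.
have ug : uniq (flatten (filter good ts)).
  apply: uniq_count_le packing_uniq_ts => v.
  have /seq.permP/(_ (pred1 v)) := perm_flatten2 (permEl (perm_filterC good ts)).
  by rewrite flatten_cat count_cat; goal_lia.
rewrite /sparse_set -(count_set _ ug) -size_filter -[RHS]/((2 * j + 3) * count good ts) -size_filter.
rewrite size_filter (@count_flatten_const _ _ _ (2 * j + 3)) // => t.
rewrite mem_filter => /andP[gt tin].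
have := count_predC popular t; rewrite (good_popular tin gt) (triangle_size (triangles_ts tin)).
rewrite (@eq_count _ (predC popular) (fun v => ~~ popular v)) //; lia.
Qed.

(** A cherry meets at most j+4 triangles, its number of vertices. Each of them loses only 1 when
    replaced by the two cherries through its popular vertices, and the new cherry contributes j+5,
    so the total weight would increase. *)
Lemma sparse_set_cherry_free s x y : uniq (s ++ [:: x; y]) -> size s = j.+2 ->
  {subset s ++ [:: x; y] <= sparse_set} -> edge H (x :: s) -> edge H (y :: s) -> False.
Proof.
move=> uc ss sub ex ey; set c := s ++ [:: x; y] in uc sub.
pose hit t := has (mem c) t; pose ts1 := filter hit ts; pose ts2 := filter (predC hit) ts.
have pts : perm_eq ts (ts1 ++ ts2) by rewrite perm_sym; apply/seq.permPl/perm_filterC.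
have fts v := seq.permP (perm_flatten2 pts) (pred1 v).
have good1 t : t \in ts1 -> t \in ts /\ good t.
  rewrite mem_filter => /andP[/hasP[v vt /= vc] tin]; split=> //.
  have := sub v vc; rewrite inE => /andP[/flattenP[t']]; rewrite mem_filter => /andP[gt' tin'] vt' _.
  by rewrite (uniq_flatten_eq packing_uniq_ts tin tin' vt vt').
have c2 t : t \in ts1 -> count popular t = 2 by move=> /good1[]; apply: good_popular.
pose l := filter popular (flatten ts1).
have sl : size l = 2 * size ts1 by rewrite size_filter (count_flatten_const c2).
have size1 : size ts1 <= j + 4.
  have sc : size c = j + 4 by rewrite size_cat ss /=; lia.
  rewrite -sc; apply: (@leq_trans (count (mem c) (flatten ts1))).
    have : forall t, t \in ts1 -> 1 <= count (mem c) t.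
      by move=> t; rewrite mem_filter -has_count => /andP[].
    elim: (ts1) => //= t ss' IH h; rewrite count_cat -add1n leq_add ?h ?mem_head //.
    by apply: IH => t' ht'; apply: h; rewrite inE ht' orbT.
  rewrite -size_filter; apply: uniq_leq_size; last by move=> z; rewrite mem_filter => /andP[].
  apply: filter_uniq; apply: uniq_count_le packing_uniq_ts => v.
  by rewrite fts flatten_cat count_cat leq_addr.
have [||ds [h1 h2 h3]] := @popular_cherries l.
- exact: filter_all.
- by rewrite sl; lia.
have e1 : size ts = size ts1 + size ts2 by rewrite (perm_size pts) size_cat.
have e2 : size ds = 2 * size ts1 by rewrite h1 sl.
suff : weight ts2 (c :: ds ++ cs) <= weight ts cs.
  by rewrite /weight /= size_cat e1 e2; move: size1; goal_lia.
apply: no_heavier.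
- by move=> t; rewrite mem_filter => /andP[_ /triangles_ts].
- move=> d; rewrite inE mem_cat => /or3P[/eqP->|/h2|/cherries_cs] //.
  by exists s, x, y.
- move=> v; rewrite count_flatten_cons flatten_cat count_cat.
  have : count_mem v c + count_mem v l <= count_mem v (flatten ts1).
    have [vc|vc] := boolP (v \in c).
      have := sub v vc; rewrite inE => /andP[/flattenP[t]]; rewrite mem_filter => /andP[gt tin] vt np.
      have -> : count_mem v l = 0 by apply/count_memPn; rewrite mem_filter negb_and np.
      rewrite (count_uniq_mem _ uc) vc addn0 -has_count has_pred1; apply/flattenP; exists t => //.
      by rewrite mem_filter tin andbT; apply/hasP; exists v.
    rewrite (count_memPn vc) add0n count_filter; apply: sub_count => z /= /andP[] //.
  have := fts v; rewrite flatten_cat count_cat; have := h3 v; goal_lia.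
- rewrite /= size_cat e1 e2; have := size_rest.
  have : (j + 4) * (2 * size ts1 + 1) <= (j + 4) * (2 * j + 9) by rewrite leq_mul2l; lia.
  by goal_lia.
Qed.

(** Double counting of the edges formed by a covered vertex, a test vertex and its core. Each of the
    r^2 pairs of a group and a test vertex sends nearly 2m edges to the triangles. A popular vertex
    receives about r^2 of them and any other vertex only O(r), so most triangles need two popular
    vertices. The inequality has been divided by r. *)
Lemma many_good : size cs < q ->
  r * (2 * m) <= r * (#|Z| + q * (j + 4) + 1) + r * (m + count good ts) + m * q * (2 * j + 9).
Proof.
move=> lecs.
set E := #|Z| + q * (j + 4) + 1.
have sub_u (i : 'I_r) : {subset group i <= u}.
  move=> z zi; rewrite -has_pred1 has_count; apply: leq_trans (sum_groups _).
  by rewrite (bigD1 i) //= addn_gt0 -has_count has_pred1 zi.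
have ug (i : 'I_r) : uniq (group i).
  apply: uniq_count_le packing_uniq_u => v; apply: leq_trans (sum_groups _).
  by rewrite (bigD1 i) //= leq_addr.
have lower (i : 'I_r) x : x \in group_rest i ->
    2 * m <= E + \sum_(a <- flatten ts) (edge H (a :: x :: group_core i) : nat).
  move=> xi; set s := x :: group_core i.
  have gE : group i = group_core i ++ group_rest i by rewrite cat_take_drop.
  have us : uniq s.
    have := ug i; rewrite gE cat_uniq /s /= => /and3P[-> /hasPn/(_ x xi) /= -> _] //.
  have ss : size s = j.+2 by rewrite /= size_group_core.
  have su : {subset s <= u}.
    move=> z; rewrite inE => zs; apply: (sub_u i); rewrite gE mem_cat.
    by case/orP: zs => [/eqP->|->] //; rewrite xi orbT.
  have few := few_neighbors_uncovered us ss su; rewrite /= in few.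
  apply: leq_trans (card_nb us ss) _.
  apply: (@leq_trans #|Z :|: [set z in flatten cs] :|: [set z in u | z \in nb H s] :|:
    [set z in flatten ts | edge H (z :: s)]|).
    apply: subset_leq_card; apply/subsetP=> z zn; move: (zn); rewrite inE => /andP[zs ez].
    rewrite !inE ez zs /= !andbT; have [//|zZ] := boolP (z \in Z).
    have := packing_perm; move=> /perm_mem/(_ z); rewrite mem_enum !mem_cat inE zZ.
    by case: (z \in flatten ts); case: (z \in flatten cs); case: (z \in u).
  apply: leq_trans (leq_card_setU _ _) _; apply: leq_add; last first.
    by rewrite -(count_set _ packing_uniq_ts) -sum1_count big_mkcond.
  apply: leq_trans (leq_card_setU _ _) _; apply: leq_add; last first.
    by apply: few; have := size_rest; clear; nia.
  apply: leq_trans (leq_card_setU _ _) _; rewrite leq_add2l.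
  apply: leq_trans (eq_leq (cardsE _)) _; apply: leq_trans (card_size _) _.
  by rewrite size_flatten_cs mulnC leq_mul2r (ltnW lecs) orbT.
pose w a := \sum_(i < r) link_degree i a.
have h1 : r * (r * (2 * m)) <= r * (r * E) + \sum_(a <- flatten ts) w a.
  have -> : \sum_(a <- flatten ts) w a =
      \sum_(i < r) \sum_(x <- group_rest i) \sum_(a <- flatten ts) (edge H (a :: x :: group_core i) : nat).
    rewrite exchange_big; apply: eq_bigr => i _; rewrite exchange_big; apply: eq_bigr => a _.
    by rewrite /link_degree -sum1_count big_mkcond.
  rewrite -{1 3}(card_ord r) -!sum_nat_const -big_split; apply: leq_sum => i _.
  have cst K : \sum_(x <- group_rest i) K = r * K.
    by rewrite big_const_seq count_predT iter_addn addn0 size_group_rest mulnC.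
  rewrite -!cst -big_split.
  by rewrite big_seq [X in _ <= X]big_seq; apply: leq_sum => x xi; apply: lower.
(* An unpopular vertex has fewer than 2j+8 groups that count up to r; every other group counts at
   most 1, which adds r in total. *)
have wle a : w a <= popular a * (r * r) + (2 * j + 9) * r.
  have dle (i : 'I_r) : link_degree i a <= r * (2 <= link_degree i a) + 1.
    have : link_degree i a <= r by apply: leq_trans (count_size _ _) _; rewrite size_group_rest.
    by move: (link_degree i a) => [|[|d]] /= h; rewrite ?muln0 ?muln1 //; lia.
  have : w a <= r * #|[set i : 'I_r | 2 <= link_degree i a]| + r.
    apply: (@leq_trans (\sum_(i < r) (r * (2 <= link_degree i a) + 1))).
      by apply: leq_sum => i _; apply: dle.
    rewrite big_split sum1_card card_ord leq_add2r -big_distrr leq_mul2l; apply/orP; right.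
    by rewrite -sum1_card [X in _ <= X]big_mkcond; apply: leq_sum => i _; rewrite inE; case: (1 < _).
  have cle : #|[set i : 'I_r | 2 <= link_degree i a]| <= r.
    by apply: leq_trans (max_card _) _; rewrite card_ord.
  rewrite /popular; case: (leqP (2 * j + 8)) => [_|lt] le; apply: leq_trans le _.
    by rewrite mul1n; apply: leq_add; [rewrite leq_mul2l cle orbT|clear; nia].
  by rewrite mul0n add0n; move: lt; clear; move: #|_| => x; nia.
have h2 : \sum_(a <- flatten ts) w a <= (size ts + count good ts) * (r * r) + size ts * (q * ((2 * j + 9) * r)).
  rewrite big_flatten /=.
  have -> : size ts + count good ts = \sum_(t <- ts) (1 + good t).
    by rewrite big_split /= sum1_size -sum1_count [\sum_(_ <- _ | good _) _]big_mkcond.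
  have -> : size ts = \sum_(t <- ts) 1 by rewrite sum1_size.
  rewrite !big_distrl -big_split /= big_seq [X in _ <= X]big_seq; apply: leq_sum => t tin.
  apply: (@leq_trans (\sum_(a <- t) (popular a * (r * r) + (2 * j + 9) * r))).
    by apply: leq_sum => a _; apply: wle.
  rewrite big_split /=; apply: leq_add.
    rewrite -big_distrl leq_mul2r /=; apply/orP; right.
    have -> : \sum_(a <- t) popular a = count popular t by rewrite -sum1_count [RHS]big_mkcond.
    by rewrite /good; have := few_popular tin; move: (count _ _) => [|[|[|]]].
  by rewrite big_const_seq count_predT iter_addn addn0 mul1n (triangle_size (triangles_ts tin)) mulnC.
have [->|rp] := posnP r; first by rewrite !mul0n.
rewrite -(leq_pmul2l rp); apply: leq_trans h1 _; rewrite -addnA mulnDr leq_add2l.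
apply: leq_trans h2 _; have := size_ts; move: (count good ts) (size ts); clear; move=> g n le.
have : (n + g) * (r * r) <= r * (r * (m + g)) by rewrite (mulnA r r) (mulnC (n + g)) leq_mul2l leq_add2r le orbT.
have : n * (q * ((2 * j + 9) * r)) <= r * (m * q * (2 * j + 9)).
  rewrite (_ : r * _ = m * (q * ((2 * j + 9) * r))); last by lia.
  by rewrite leq_mul2r le orbT.
rewrite mulnDr; lia.
Qed.

End Packing.

(** Both outcomes come from one heaviest packing: either few vertices are uncovered, and [C] also
    accounts for the vertices of the fewer than q cherries, or the unpopular vertices of the good
    triangles form [B]. *)
Lemma tiling_or_sparse_set j N : exists C D,
  forall (V : finType) (H : hypergraph V) m (Z : {set V}),
  #|V| = (2 * j + 5) * m ->
  (forall S : {set V}, #|S| = j.+2 -> 2 * m <= codegree H S) ->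
  D <= m -> D * #|Z| <= m ->
  (exists s, [/\ uniq s, forall v, v \in s -> v \notin Z, tileable H j s &
     #|V| <= size s + #|Z| + C]) \/
  (exists2 B : {set V}, N * ((2 * j + 3) * m) <= N * #|B| + m &
     forall s x y, uniq (s ++ [:: x; y]) -> size s = j.+2 -> {subset s ++ [:: x; y] <= B} ->
       edge H (x :: s) -> edge H (y :: s) -> False).
Proof.
(* The deficit of [B], scaled by N, is at most P(|Z| + e0) + P m Q / r. The choice of [r] bounds the
   second term by m/2; the first summand of [D] does so for the first term, and the rest of [D]
   serves [few_cherries]. *)
set q := 2 * j + 5; pose P := N * (2 * j + 3); pose Q := q * (2 * j + 9).
pose e0 := q * (j + 4) + 1; pose r := (2 * P * Q).+1.
exists (r * (j.+1 + r) + q * j + (j + 4) * (2 * j + 9) + (j + 4) * q).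
exists (4 * P * e0.+1 + 2 * (q * j + 2 * j + 6) + 2) => V H m Z cV cod leD leDZ.
set D := 4 * P * _ + _ + 2 in leD leDZ.
have D1 : 4 * P * e0.+1 <= D by rewrite /D; move: (4 * _ * _) => x; clear; lia.
have D2 : 2 * (q * j + 2 * j + 6) + 2 <= D by rewrite /D; move: (4 * _ * _) => x; clear; lia.
have Z1 : 2 * #|Z| <= m.
  by apply: leq_trans leDZ; rewrite leq_mul2r; move: D2; clear; move: (q * j) => x; lia.
have lm : #|Z| + (j + 4) + (q * j + j + 1) < m.
  by move: (leq_trans D2 leD) Z1; clear; move: (q * j) #|Z| => x z; lia.
have cZ : #|~: Z| + #|Z| = q * m by rewrite addnC cardsC.
pose wt n := exists ts cs, packing j H Z ts cs /\ weight j ts cs = n.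
have wt0 : wt 0.
  exists [::], [::]; split; last by rewrite /weight /= !muln0.
  split=> //; rewrite /= !muln0.
  have : q * (j + 2) <= q * m by rewrite leq_mul2l; apply/orP; right; move: lm; clear; move: (q * j) #|Z| => a b; lia.
  by move: cZ Z1 lm; rewrite mulnDr; clear; rewrite /q; nia.
have wtb n : wt n -> n <= (2 * j + 11) * #|V| + (j + 5) * #|V|.
  move=> [ts [cs [[_ _ _ le] <-]]]; rewrite /weight; have le2 : #|~: Z| <= #|V| by apply: max_card.
  have l1 : size ts <= (2 * j + 5) * size ts by rewrite leq_pmull // addnS.
  have l2 : size cs <= (j + 4) * size cs by rewrite leq_pmull // addnS.
  apply: leq_add; rewrite leq_mul2l; apply/orP; right; apply: leq_trans le2.
    by apply: leq_trans l1 (leq_trans _ le); rewrite -addnA leq_addr.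
  by apply: leq_trans l2 (leq_trans _ le); rewrite addnAC leq_addl.
have [w [ts [cs [pk ew]]] maxw] := exists_maximum wt0 wtb.
have {}maxw ts' cs' : packing j H Z ts' cs' -> weight j ts' cs' <= weight j ts cs.
  by move=> pk'; rewrite ew; apply: maxw; exists ts', cs'.
have lecs := few_cherries cV cod pk maxw lm.
pose u := uncovered Z ts cs.
have [ltu|geu] := ltnP (size u) (r * (j.+1 + r) + q * j + (j + 4) * (2 * j + 9)).
  left; exists (flatten ts); split.
  - by have h := packing_uniq_ts cV pk; exact: h.
  - move=> v vt; have := packing_count cV pk v.
    by case: (v \notin Z) => //; have := has_pred1 v (flatten ts); rewrite vt has_count; case: (count_mem v _).
  - by apply: tileable_flatten => t tin; apply: tileable_triangle; case: pk => /(_ t tin).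
  - rewrite cV -cZ -(packing_size cV pk) -/u (size_flatten_ts pk).
    have : (j + 4) * size cs <= (j + 4) * q by rewrite leq_mul2l (ltnW lecs) orbT.
    by move: ltu; move: (r * _) (q * j) ((j + 4) * _); rewrite /q; goal_lia.
right; exists (sparse_set j H Z ts cs r).
  rewrite (card_sparse_set cV pk maxw geu).
  have := many_good cV cod pk maxw geu lecs; set G := count _ _.
  rewrite -/q => hG.
  have {hG}: r * m <= r * (#|Z| + e0) + r * G + m * Q.
    by move: hG; rewrite /Q /e0 -/q !mulnDr !mulnA addnA; lia.
  move=> hG; rewrite !mulnA -/P -(leq_pmul2l (ltn0Sn _ : 0 < r)).
  have h1 : 2 * (P * (r * (#|Z| + e0))) <= r * m.
    rewrite (_ : 2 * _ = r * (2 * P * (#|Z| + e0))); last by lia.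
    rewrite leq_mul2l; apply/orP; right; rewrite mulnDr.
    have : 4 * P * #|Z| <= m by apply: leq_trans leDZ; rewrite leq_mul2r (leq_trans _ D1) ?orbT // leq_pmulr.
    have : 4 * P * e0.+1 <= m by apply: leq_trans D1 leD.
    by move: (P) (e0) #|Z| => p e z; clear; lia.
  have h2 : 2 * (P * (m * Q)) <= r * m.
    by rewrite /r mulSn; move: (P) (Q) => p z; clear; lia.
  have := leq_mul (leqnn (2 * P)) hG; rewrite !mulnDr.
  rewrite (mulnCA r P m) (mulnCA r P G).
  move: h1 h2; rewrite !mulnDr; move: (r * m) (r * #|Z|) (r * e0) (r * G) (m * Q) (P).
  by clear; move=> *; lia.
by move=> s x y; apply: (sparse_set_cherry_free cV pk maxw geu).
Qed.

(** * Filling the slots of blocks *)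

(** Take a permutation with the most related pairs. If i is unmatched, the hypothesis leaves some l
    with r i (s l) and r l (s i); exchanging the images of i and l then matches i and spoils no
    other pair. *)
Lemma perm_matching (I : finType) (r : rel I) :
  (forall i i', #|[set l | ~~ r i l]| + #|[set l | ~~ r l i']| < #|I|) ->
  exists s : {perm I}, forall i, r i (s i).
Proof.
move=> h; pose w (s : {perm I}) := #|[set i | r i (s i)]|.
case: (arg_maxnP (fun s : {perm I} => w s) (P := predT) (i0 := 1%g) isT) => s _ hs.
exists s => i; apply: contraT => nri.
pose X := [set l | ~~ r i (s l)]; pose Y := [set l | ~~ r l (s i)].
have cX : #|X| = #|[set l | ~~ r i l]|.
  rewrite -(card_imset X (@perm_inj _ s)); apply: eq_card => l; rewrite [in RHS]inE.
  apply/imsetP/idP => [[l' + ->]|hl]; first by rewrite inE.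
  by exists (s^-1 l)%g; rewrite ?inE permKV.
have [l] : exists l, l \in ~: (X :|: Y).
  apply/existsP; apply: contraT => /existsPn hn.
  have e : #|X :|: Y| = #|I|.
    by apply: eq_card => l; have := hn l; rewrite inE negbK => ->.
  by have [+ _] := leq_card_setU X Y; rewrite e cX leqNgt h.
rewrite in_setC in_setU negb_or => /andP[]; rewrite !inE !negbK => r1 r2.
have il : l != i by apply: contraNneq nri => li; rewrite -{2}li.
have : w (tperm i l * s)%g <= w s by apply: hs.
rewrite leqNgt => /negP[]; apply: proper_card.
apply/properP; split; last first.
  by exists i; rewrite !inE ?nri // permM tpermL.
apply/subsetP=> z; rewrite !inE permM => rz.
have [->|zi] := eqVneq z i; first by rewrite tpermL.
have [->|zl] := eqVneq z l; first by rewrite tpermR.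
by rewrite tpermD // eq_sym.
Qed.

Lemma set_of_Prop (T : finType) (P : T -> Prop) : exists A : {set T}, forall x, x \in A <-> P x.
Proof.
have /fin_all_exists[b hb] : forall x, exists b : bool, b <-> P x.
  move=> x; have [px|npx] := classic (P x); [exists true|exists false]; by split.
by exists [set x | b x] => x; rewrite inE.
Qed.

Section BlockSlots.
Variables (V : finType) (H : hypergraph V) (j : nat).

(* A block [S ++ x :: y :: W] with [|S| = k - 2] and [|W| = k - 3] has two slots, to be
   filled by vertices [a], [a'] such that [(a S; x, y; W a')] is a triangle. *)
Definition slot (b : seq V) (c : bool) (a : V) :=
  if c then edge H (a :: drop j.+1 b)
  else edge H (a :: take j.+2 b) && edge H (a :: take j.+1 b ++ take 1 (drop j.+2 b)).

Lemma block_split b : size b = 2 * j + 3 -> exists S x y W,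
  [/\ b = S ++ x :: y :: W, size S = j.+1, size W = j & forall c a, slot b c a =
    if c then edge H (a :: x :: y :: W) else edge H (a :: S ++ [:: x]) && edge H (a :: S ++ [:: y])].
Proof.
move=> sb.
have [S [x [y [W [eb sS sW]]]]] : exists S x y W, [/\ b = S ++ x :: y :: W, size S = j.+1 & size W = j].
  have := cat_take_drop j.+1 b; have := size_drop j.+1 b.
  case: (drop j.+1 b) => [|x [|y W]] /= sz eb; try by move: sz; rewrite sb; lia.
  exists (take j.+1 b), x, y, W; rewrite eb; split=> //; first by rewrite size_takel // sb; lia.
  by move: sz; rewrite sb; lia.
have d1 : drop j.+1 b = x :: y :: W by rewrite eb drop_size_cat.
have t1 : take j.+1 b = S by rewrite eb take_size_cat.
have eb2 : b = (S ++ [:: x]) ++ y :: W by rewrite -catA.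
have sx : size (S ++ [:: x]) = j.+2 by rewrite size_cat sS addn1.
have d2 : drop j.+2 b = y :: W by rewrite eb2 drop_size_cat.
have t2 : take j.+2 b = S ++ [:: x] by rewrite eb2 take_size_cat.
by exists S, x, y, W; split=> // c a; rewrite /slot d1 t1 d2 t2 /= take0.
Qed.

Lemma slot_tileable b a a' : size b = 2 * j + 3 -> slot b false a -> slot b true a' ->
  tileable H j (a :: a' :: b).
Proof.
move=> /block_split[S [x [y [W [eb sS sW sl]]]]]; rewrite !sl => /andP[e1 e2] e3.
have g1 : edge H (x :: a :: S) by rewrite (@edge_perm _ _ _ (a :: S ++ [:: x])) //; perm_by_count.
have g2 : edge H (y :: a :: S) by rewrite (@edge_perm _ _ _ (a :: S ++ [:: y])) //; perm_by_count.
have g3 : edge H (x :: y :: W ++ [:: a']).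
  by rewrite (@edge_perm _ _ _ (a' :: x :: y :: W)) //; perm_by_count.
apply: (@tileable_cons _ H j (a :: S) x y (W ++ [:: a'])) => //=; rewrite ?size_cat ?sS ?sW /=; try lia.
by rewrite eb; perm_by_count.
Qed.

Section SlotMisses.
Variables (B : {set V}) (e : nat).
Hypothesis misses : forall s, uniq s -> size s = j.+2 -> {subset s <= B} ->
  #|[set a in ~: B | ~~ edge H (a :: s)]| <= e.

Lemma slot_misses b c : uniq b -> size b = 2 * j + 3 -> {subset b <= B} ->
  #|[set a in ~: B | ~~ slot b c a]| <= 2 * e.
Proof.
move=> ub /block_split[S [x [y [W [eb sS sW sl]]]]] sub.
have m (s : seq V) : size s = j.+2 -> (forall v, count_mem v s <= count_mem v b) ->
    #|[set a in ~: B | ~~ edge H (a :: s)]| <= e.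
  move=> ss le; apply: misses => //; first exact: uniq_count_le le ub.
  move=> z zs; apply: sub; rewrite -has_pred1 has_count; apply: leq_trans (le z).
  by rewrite -has_count has_pred1.
have m1 : #|[set a in ~: B | ~~ edge H (a :: S ++ [:: x])]| <= e.
  by apply: m => [|v]; rewrite ?eb ?size_cat ?sS /= ?count_cat /=; [lia|goal_lia].
have m2 : #|[set a in ~: B | ~~ edge H (a :: S ++ [:: y])]| <= e.
  by apply: m => [|v]; rewrite ?eb ?size_cat ?sS /= ?count_cat /=; [lia|goal_lia].
have m3 : #|[set a in ~: B | ~~ edge H (a :: x :: y :: W)]| <= e.
  by apply: m => [|v]; rewrite ?eb ?count_cat /= ?sW; [lia|goal_lia].
case: c.
  apply: leq_trans (leq_trans m3 _); last by lia.
  by apply: subset_leq_card; apply/subsetP=> a; rewrite !inE sl.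
apply: leq_trans (leq_trans (leq_card_setU _ _) (leq_trans (leq_add m1 m2) _)); last by lia.
by apply: subset_leq_card; apply/subsetP=> a; rewrite !inE sl negb_and; case: (a \in B).
Qed.

Definition missed bs a := \sum_(b <- bs) (~~ slot b false a + ~~ slot b true a).

Lemma sum_missed bs : uniq (flatten bs) -> (forall b, b \in bs -> size b = 2 * j + 3) ->
  {subset flatten bs <= B} -> \sum_(a in ~: B) missed bs a <= 4 * e * size bs.
Proof.
move=> u sb sub; rewrite /missed exchange_big /=.
have -> : 4 * e * size bs = \sum_(b <- bs) 4 * e by rewrite big_const_seq count_predT iter_addn addn0.
rewrite big_seq [X in _ <= X]big_seq; apply: leq_sum => b bin.
have ub := uniq_flatten_mem u bin.
have subb : {subset b <= B} by move=> z zb; apply: sub; apply/flattenP; exists b.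
have := leq_add (slot_misses false ub (sb _ bin) subb) (slot_misses true ub (sb _ bin) subb).
rewrite -!sum1_card !(big_mkcond (fun a => a \in [set _ | _])) -big_split /= => h.
rewrite big_mkcond; apply: leq_trans (leq_trans h _); last by lia.
by apply: leq_sum => a _; rewrite !inE; case: (a \in B); case: (slot b false a); case: (slot b true a).
Qed.

End SlotMisses.

End BlockSlots.

(** Slots and vertices of [A] are indexed by the same type, pairs of a block and a boolean, so a
    perfect matching between them is a permutation. *)
Lemma slots_tileable (V : finType) (H : hypergraph V) j (A : {set V}) (bs : seq (seq V)) d :
  #|A| = 2 * size bs -> (forall b, b \in bs -> size b = 2 * j + 3) ->
  (forall b c, b \in bs -> #|[set a in A | ~~ slot H j b c a]| <= d) ->
  (forall a, a \in A -> d + missed H j bs a < 2 * size bs) ->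
  tileable H j (enum A ++ flatten bs).
Proof.
move=> cA sb row col; pose I := ('I_(size bs) * bool)%type.
have cI : #|{: I}| = #|A| by rewrite card_prod card_ord card_bool cA mulnC.
pose a (i : I) := enum_val (cast_ord cI (enum_rank i)).
have ia : injective a by move=> i i' /enum_val_inj/cast_ord_inj/enum_rank_inj.
have aA i : a i \in A by apply: enum_valP.
pose r (i i' : I) := slot H j (nth [::] bs i.1) i.2 (a i').
have bsP (l : 'I_(size bs)) : nth [::] bs l \in bs by apply: mem_nth.
have [i i'|s hs] := @perm_matching _ r.
  have cr : #|[set l | ~~ r i l]| <= d.
    apply: leq_trans (row (nth [::] bs i.1) i.2 (bsP _)); rewrite -(card_imset _ ia).
    apply: subset_leq_card; apply/subsetP=> z /imsetP[l + ->]; rewrite !inE /r => ->.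
    by rewrite aA.
  have cc : #|[set l | ~~ r l i']| = missed H j bs (a i').
    rewrite /missed (big_nth [::]) big_mkord -sum1_card big_mkcond /=.
    rewrite (eq_bigr (fun p : I => (~~ r (p.1, p.2) i' : nat))); last first.
      by move=> [l c] _; rewrite inE; case: (r _ _).
    rewrite -(pair_bigA _ (fun l c => (~~ r (l, c) i' : nat))) /=.
    by apply: eq_bigr => l _; rewrite big_bool addnC.
  by rewrite cI cA cc; apply: leq_ltn_trans (col _ (aA i')); rewrite leq_add2r.
pose L := [seq a (s (l, false)) :: a (s (l, true)) :: nth [::] bs l | l : 'I_(size bs)].
have tL : tileable H j (flatten L).
  apply: tileable_flatten => _ /mapP[l _ ->].
  apply: slot_tileable; [exact: sb|exact: (hs (l, false))|exact: (hs (l, true))].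
apply: tileable_perm _ tL. apply/seq.permP=> p; rewrite count_cat sum_count_flatten /L big_map big_enum /=.
rewrite (eq_bigr (fun l : 'I_(size bs) => \sum_(c : bool) (p (a (s (l, c))) : nat) +
  count p (nth [::] bs l))); last by move=> l _; rewrite big_bool /=; lia.
rewrite big_split /= pair_bigA /=; congr (_ + _); last first.
  by rewrite sum_count_flatten (big_nth [::]) big_mkord.
rewrite (eq_bigr (fun i : I => p (a (s i)) : nat)); last by case.
rewrite -(reindex_inj (@perm_inj _ s) (P := xpredT) (F := fun i => p (a i) : nat)) /=.
have pa : perm_eq [seq a i | i : I] (enum A).
  apply: perm_enum_set => [|z]; first by rewrite map_inj_uniq ?enum_uniq.
  apply/mapP/idP => [[i _ ->] //|zA].
  exists (enum_val (cast_ord (esym cI) (enum_rank_in zA z))); first by rewrite mem_enum.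
  by rewrite /a enum_valK cast_ord_comp cast_ord_id enum_rankK_in.
rewrite -(seq.permP pa) count_map -sum1_count -big_enum /= [RHS]big_mkcond /=.
by apply: eq_bigr => i _; case: (p _).
Qed.

(** Here [s] is already tiled and contains every vertex outside [A] and [B]. Typicality refers to
    the fixed blocks [bs], so the blocks that avoid [s] are kept and only the remainder of [B] is
    cut anew. *)
Lemma finish_tiling (V : finType) (H : hypergraph V) j m (A B : {set V}) e bs s tau :
  (forall s, uniq s -> size s = j.+2 -> {subset s <= B} ->
    #|[set a in ~: B | ~~ edge H (a :: s)]| <= e) ->
  A \subset ~: B -> uniq (flatten bs) -> (forall b, b \in bs -> size b = 2 * j + 3) ->
  {subset flatten bs <= B} -> (forall a, a \in A -> 2 * missed H j bs a <= size bs) ->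
  tileable H j s -> uniq s -> (forall v, v \notin s -> (v \in A) || (v \in B)) ->
  #|[set v in A | v \notin s]| = 2 * (m - tau) -> tau <= m ->
  #|V| = (2 * j + 5) * m -> size s = (2 * j + 5) * tau ->
  4 * e + 4 * size s < 3 * size bs ->
  tileable H j (enum V).
Proof.
move=> miss AB ubs sbs subbs typ ts us cover cA' letau cV ss num.
set A' := [set v in A | v \notin s] in cA'; set M := m - tau in cA'.
pose B' := [set v in B | v \notin s].
have cAB : #|A'| + #|B'| + size s = #|V|.
  rewrite -(card_set_seq us) -[in RHS](cardsC [set z in s]) [RHS]addnC; congr (_ + _).
  have -> : ~: [set z in s] = A' :|: B'.
    apply/setP=> v; rewrite !inE; have := cover v; case: (v \in s) => /=; rewrite ?andbF //.
    by rewrite !andbT => ->.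
  rewrite cardsU (_ : A' :&: B' = set0) ?cards0 ?subn0 //.
  apply/setP=> v; rewrite !inE; apply/negP=> /andP[/andP[vA _] /andP[vB _]].
  by have := subsetP AB v vA; rewrite inE vB.
have cB' : #|B'| = (2 * j + 3) * M.
  move: cAB; rewrite cA' ss cV (_ : m = M + tau) ?mulnDr; last by rewrite /M subnK.
  by move: (tau) (M) #|B'|; clear; move=> t M b; lia.
pose hitb b := has (mem s) b.
pose bs1 := filter (predC hitb) bs.
have ps : perm_eq bs (filter hitb bs ++ bs1) by rewrite perm_sym; apply/seq.permPl/perm_filterC.
have hit_le : size (filter hitb bs) <= size s.
  apply: (@leq_trans (count (mem s) (flatten (filter hitb bs)))).
    have : forall b, b \in filter hitb bs -> 1 <= count (mem s) b.
      by move=> b; rewrite mem_filter -has_count => /andP[].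
    elim: (filter hitb bs) => //= b l IH h; rewrite count_cat -add1n leq_add ?h ?mem_head //.
    by apply: IH => t ht; apply: h; rewrite inE ht orbT.
  rewrite -size_filter; apply: uniq_leq_size; last by move=> z; rewrite mem_filter => /andP[].
  apply: filter_uniq; apply: uniq_count_le ubs => v.
  by rewrite (seq.permP (perm_flatten2 ps)) flatten_cat count_cat leq_addr.
have size_bs : size bs = size (filter hitb bs) + size bs1 by rewrite (perm_size ps) size_cat.
have sbs1 b : b \in bs1 -> size b = 2 * j + 3 by rewrite mem_filter => /andP[_ /sbs].
have ubs1 : uniq (flatten bs1).
  apply: uniq_count_le ubs => v.
  by rewrite (seq.permP (perm_flatten2 ps)) flatten_cat count_cat leq_addl.
have bs1B' v : v \in flatten bs1 -> v \in B'.
  move=> /flattenP[b]; rewrite mem_filter => /andP[/hasPn nh bin] vb; rewrite inE.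
  by rewrite (nh v vb) andbT; apply: subbs; apply/flattenP; exists b.
pose R := [seq v <- enum B' | v \notin flatten bs1].
have pR : perm_eq (flatten bs1 ++ R) (enum B').
  apply: perm_enum_set => [|v].
    rewrite cat_uniq ubs1 filter_uniq ?enum_uniq // andbT.
    by apply/hasPn=> v; rewrite mem_filter => /andP[].
  rewrite mem_cat mem_filter mem_enum; have := bs1B' v.
  by case: (v \in flatten bs1) => //= ->.
have sR : (2 * j + 3) * size bs1 + size R = (2 * j + 3) * M.
  by rewrite -cB' cardE -(perm_size pR) size_cat (size_flatten_const sbs1).
have leM : size bs1 <= M.
  have q0 : 0 < 2 * j + 3 by rewrite addnS.
  by rewrite -(leq_pmul2l q0) -sR leq_addr.
pose bs2 := blocks (M - size bs1) (2 * j + 3) R.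
have lR : (M - size bs1) * (2 * j + 3) = size R.
  by rewrite mulnC mulnBr -sR addKn.
have sbs2 b : b \in bs2 -> size b = 2 * j + 3.
  by move=> /(nthP [::])[i]; rewrite size_blocks => lti <-; rewrite size_nth_blocks // lR.
have fbs2 : flatten bs2 = R by rewrite flatten_blocks lR // take_size.
pose cs := bs1 ++ bs2.
have pcs : perm_eq (flatten cs) (enum B') by rewrite flatten_cat fbs2.
have scs : size cs = M by rewrite size_cat size_blocks subnKC.
have scs' b : b \in cs -> size b = 2 * j + 3 by rewrite mem_cat => /orP[/sbs1|/sbs2].
have h := @slots_tileable V H j A' cs (2 * e).
have {}h : tileable H j (enum A' ++ flatten cs).
  apply: h => //; first by rewrite scs.
    move=> b c bin; apply: leq_trans (slot_misses miss c _ (scs' b bin) _).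
    - by apply: subset_leq_card; apply/subsetP=> a; rewrite !inE => /andP[/andP[/(subsetP AB)]]; rewrite inE => ->.
    - have := uniq_flatten_mem (ss := cs); apply=> //; by rewrite (perm_uniq pcs) enum_uniq.
    - move=> z zb; have : z \in flatten cs by apply/flattenP; exists b.
      by rewrite (perm_mem pcs) mem_enum inE => /andP[].
  (* A vertex may miss both slots of every new block. As at most |s| old blocks are lost, the bound
     needed is 4e + 4|s| < 3|bs|. *)
  move=> a; rewrite inE => /andP[/typ]; rewrite /missed (perm_big _ ps) !big_cat /= => ha _.
  have : \sum_(b <- bs2) (~~ slot H j b false a + ~~ slot H j b true a) <= 2 * size bs2.
    rewrite -sum1_size big_distrr /=; apply: leq_sum => b _.
    by do 2 case: (~~ _).
  rewrite size_blocks scs; move: ha hit_le size_bs num leM.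
  move: (\sum_(b <- bs1) _) (\sum_(b <- bs2) _) (\sum_(b <- filter hitb bs) _) => x y z.
  by move: (size bs1) (size (filter _ _)) (M); goal_lia.
apply: tileable_perm _ (tileable_cat ts h).
apply: (@perm_trans _ (s ++ enum A' ++ enum B')); first by rewrite !perm_cat2l.
apply: uniq_perm; rewrite ?enum_uniq //.
  rewrite !cat_uniq us !enum_uniq /= andbT; apply/andP; split.
    by apply/hasPn=> v; rewrite mem_cat !mem_enum !inE => /orP[] /andP[].
  apply/hasPn=> v; rewrite !mem_enum !inE => /andP[vB _]; rewrite negb_and.
  by apply/orP; left; apply/negP=> /(subsetP AB); rewrite inE vB.
move=> v; rewrite !mem_cat !mem_enum !inE; have := cover v.
by case: (v \in s) => //=; rewrite !andbT => ->.
Qed.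

(** * The extremal case *)

Lemma uniq_cat_disjoint (T : eqType) (s1 s2 : seq T) :
  uniq s1 -> uniq s2 -> (forall v, v \in s1 -> v \notin s2) -> uniq (s1 ++ s2).
Proof.
move=> u1 u2 d; rewrite cat_uniq u1 u2 andbT /=; apply/hasPn=> v v2; apply/negP=> /d.
by rewrite v2.
Qed.

(** Augmentation from c < t edges: take j+3 fresh disjoint (k-1)-sets in [C]. If none extends
    outside the matching, some edge of the matching receives more than j+3 of the (j+3)t incidences,
    so two of the sets extend by different vertices of it and replace it by two edges. *)
Lemma matching_of_codegree (V : finType) (H : hypergraph V) j (C : {set V}) t :
  (forall s, uniq s -> size s = j.+2 -> {subset s <= C} -> t <= #|[set v in C | v \in nb H s]|) ->
  (j + 3) * t + (j + 3) * (j + 2) <= #|C| ->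
  exists ms, [/\ size ms = t, uniq (flatten ms), {subset flatten ms <= C} &
    forall g, g \in ms -> size g = j.+3 /\ edge H g].
Proof.
move=> deg leC; suff: forall c, c <= t -> exists ms, [/\ size ms = c, uniq (flatten ms),
    {subset flatten ms <= C} & forall g, g \in ms -> size g = j.+3 /\ edge H g].
  by move=> /(_ t (leqnn t)).
elim=> [|c IH] lec; first by exists [::].
have [ms [sms ums subms gms]] := IH (ltnW lec).
pose Q := [set z in flatten ms].
have sfl : size (flatten ms) = (j + 3) * c.
  by rewrite (@size_flatten_const _ _ (j + 3)) ?sms // => g /gms[-> _]; rewrite addnC.
have cQ : #|Q| = (j + 3) * c by rewrite card_set_seq.
have [|L [uL sL hL]] := @fresh_seq V C Q ((j + 3) * (j + 2)).
  rewrite cQ; apply: leq_trans leC; rewrite addnC leq_add2r leq_mul2l (ltnW lec) orbT //.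
pose bl := blocks (j + 3) (j + 2) L.
have fitL : (j + 3) * (j + 2) <= size L by rewrite sL.
have Lbl p i : count p (nth [::] bl i) <= count p L.
  by apply: leq_trans (count_pick1 p bl i) (count_blocks p fitL).
have mem_bl i v : v \in nth [::] bl i -> (v \in C) && (v \notin Q).
  by move=> vi; apply: hL; rewrite -has_pred1 has_count; apply: leq_trans (Lbl _ i); rewrite -has_count has_pred1.
have ubl i : uniq (nth [::] bl i) by apply: uniq_count_le uL => v; apply: Lbl.
have sbl (i : 'I_(j + 3)) : size (nth [::] bl i) = j.+2 by rewrite size_nth_blocks // addn2.
have [[i [z [zC zQ zn]]]|nz] := classic (exists (i : 'I_(j + 3)) z,
    [/\ z \in C, z \notin Q & z \in nb H (nth [::] bl i)]).
  move: zn; rewrite inE => /andP[zi ez].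
  exists ((z :: nth [::] bl i) :: ms); split.
  - by rewrite /= sms.
  - rewrite [flatten _]/= -cat_cons; apply: uniq_cat_disjoint => //=; first by rewrite zi ubl.
    move=> v; rewrite inE => /orP[/eqP->|/mem_bl/andP[_]]; last by rewrite inE.
    by move: zQ; rewrite inE.
  - move=> v; rewrite [flatten _]/= in_cons mem_cat => /or3P[/eqP->//|/mem_bl/andP[]//|/subms//].
  - by move=> g; rewrite in_cons => /orP[/eqP->|/gms//]; rewrite /= sbl.
have lower (i : 'I_(j + 3)) : t <= count [in nb H (nth [::] bl i)] (flatten ms).
  have subC : {subset nth [::] bl i <= C} by move=> v /mem_bl/andP[].
  rewrite (count_set _ ums); apply: leq_trans (deg _ (ubl i) (sbl i) subC) _.
  apply: subset_leq_card; apply/subsetP=> z; rewrite [z \in [set v in C | _]]inE => /andP[zC zn].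
  rewrite inE; apply/andP; split; last exact: zn.
  by apply: contraT => zQ; case: nz; exists i, z; rewrite inE.
have [g gin hg] : exists2 g, g \in ms & j + 3 < \sum_(i < j + 3) count [in nb H (nth [::] bl i)] g.
  apply/hasP; apply: contraT => /hasPn hn.
  have h1 : (j + 3) * t <= \sum_(i < j + 3) count [in nb H (nth [::] bl i)] (flatten ms).
    by rewrite -{1}(card_ord (j + 3)) -sum_nat_const; apply: leq_sum.
  rewrite (eq_bigr (fun i : 'I_(j + 3) => \sum_(g <- ms) count [in nb H (nth [::] bl i)] g)) in h1; last first.
    by move=> i _; rewrite sum_count_flatten.
  rewrite exchange_big /= in h1.
  have h2 : \sum_(g <- ms) \sum_(i < j + 3) count [in nb H (nth [::] bl i)] g <= \sum_(g <- ms) (j + 3).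
    by rewrite big_seq [X in _ <= X]big_seq; apply: leq_sum => g /hn; rewrite -leqNgt.
  have := leq_trans h1 h2; rewrite big_const_seq count_predT iter_addn addn0 sms leq_mul2l.
  by rewrite addn3 /= leqNgt lec.
have ug : uniq g by apply: uniq_flatten_mem ums gin.
have [sg _] := gms g gin.
have [|||i [i' [z [z' [nii nzz /andP[]]]]]] := @two_disjoint_incidences 'I_(j + 3) _ [set z in g]
  (fun i z => z \in nb H (nth [::] bl i)) (j + 3).
- by rewrite card_ord.
- by rewrite card_set_seq // sg addn3.
- apply: leq_trans hg _; apply: leq_sum => i _; rewrite count_set //.
  by apply: eq_leq; apply: eq_card => z; rewrite !inE.
rewrite !inE => zg zg' /andP[/andP[zi ez] /andP[zi' ez']].
have pms := perm_to_rem gin.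
have cpick v : count_mem v (nth [::] bl i) + count_mem v (nth [::] bl i') <= count_mem v L.
  by apply: leq_trans (count_blocks _ fitL); apply: count_pick2 => //; rewrite size_blocks.
pose new := (z :: nth [::] bl i) ++ (z' :: nth [::] bl i').
have cnew v : count_mem v (new ++ flatten (rem g ms)) <= count_mem v (L ++ flatten ms).
  rewrite !count_cat (seq.permP (perm_flatten2 pms)) count_flatten_cons.
  by have := cpick v; have := count_two v nzz zg zg'; rewrite /=; goal_lia.
have uLms : uniq (L ++ flatten ms).
  by apply: uniq_cat_disjoint => // v /hL/andP[_]; rewrite inE.
exists ((z :: nth [::] bl i) :: (z' :: nth [::] bl i') :: rem g ms).
have fl : flatten ((z :: nth [::] bl i) :: (z' :: nth [::] bl i') :: rem g ms) = new ++ flatten (rem g ms).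
  by rewrite /new -catA.
split.
- by move: sms; rewrite (perm_size pms) /= => <-.
- by rewrite fl; apply: uniq_count_le uLms.
- move=> v; rewrite fl => vn.
  have : v \in L ++ flatten ms.
    by rewrite -has_pred1 has_count; apply: leq_trans (cnew v); rewrite -has_count has_pred1.
  by rewrite mem_cat => /orP[/hL/andP[]|/subms].
- move=> g'; rewrite !in_cons => /or3P[/eqP->|/eqP->|/mem_rem/gms//]; by rewrite /= sbl.
Qed.

Section Extremal.
Variables (j : nat) (V : finType) (H : hypergraph V) (m : nat) (B : {set V}) (e : nat).
Local Notation q := (2 * j + 5).
Hypothesis cV : #|V| = q * m.
Hypothesis cod : forall S : {set V}, #|S| = j.+2 -> 2 * m <= codegree H S.
Hypothesis misses : forall s, uniq s -> size s = j.+2 -> {subset s <= B} ->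
  #|[set a in ~: B | ~~ edge H (a :: s)]| <= e.
Hypothesis leA : #|~: B| <= 2 * m + e.
Hypothesis geA : 2 * m <= #|~: B| + e.
Hypothesis e_gt0 : 0 < e.
Hypothesis m_large : 1000 * (q * e) <= m.
Hypothesis m_large2 : 100 * (q * q) <= m.

Lemma le_qe : q <= q * e /\ e <= q * e.
Proof. by split; [rewrite leq_pmulr|rewrite leq_pmull // addnS]. Qed.

Lemma card_B : #|B| + #|~: B| = q * m.
Proof. by rewrite cardsC. Qed.

Lemma card_B_large : (2 * j + 3) * m <= #|B| + e.
Proof. by have := card_B; move: leA; move: #|B| #|~: B| => b a; clear; lia. Qed.

(** * Reference blocks, typical and atypical vertices *)

Definition all_blocks := blocks (#|B| %/ (2 * j + 3)) (2 * j + 3) (enum B).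
Local Notation bs := all_blocks.

Lemma blocks_fit : #|B| %/ (2 * j + 3) * (2 * j + 3) <= size (enum B).
Proof. by rewrite -cardE leq_trunc_div. Qed.

Lemma uniq_blocks : uniq (flatten bs).
Proof.
apply: uniq_count_le (enum_uniq B) => v; exact: count_blocks blocks_fit.
Qed.

Lemma size_block b : b \in bs -> size b = 2 * j + 3.
Proof. by move=> /(nthP [::])[i]; rewrite size_blocks => lti <-; rewrite size_nth_blocks ?blocks_fit. Qed.

Lemma blocks_sub : {subset flatten bs <= B}.
Proof. by move=> v; rewrite flatten_blocks ?blocks_fit // => /mem_take; rewrite mem_enum. Qed.

Lemma number_of_blocks : m <= size bs + e.
Proof.
rewrite size_blocks; set b := _ %/ _.
have h : #|B| < b.+1 * (2 * j + 3) by rewrite -ltn_divLR // addnS.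
by move: h card_B_large e_gt0; move: #|B| => x; clear; nia.
Qed.

(** Each block has two slots, so a typical vertex can fill at least three quarters of all slots. *)
Definition typical := locked [set a in ~: B | 2 * missed H j bs a <= size bs].
Local Notation A1 := typical.

Lemma in_typical a : (a \in A1) = (a \notin B) && (2 * missed H j bs a <= size bs).
Proof. by rewrite /typical -lock !inE. Qed.

Definition atypical := ~: B :\: A1.
Local Notation O := atypical.

Lemma typical_sub : A1 \subset ~: B.
Proof. by apply/subsetP=> a; rewrite in_typical inE => /andP[]. Qed.

Lemma typicalNB a : a \in A1 -> a \notin B.
Proof. by move=> /(subsetP typical_sub); rewrite inE. Qed.

Lemma not_atypical v : v \notin O -> (v \in A1) || (v \in B).
Proof.
by rewrite /atypical in_setD in_setC; case: (v \in A1) => //=; rewrite negbK.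
Qed.

Lemma atypicalN v : v \in O -> (v \notin A1) && (v \notin B).
Proof. by rewrite /atypical in_setD in_setC. Qed.

(** An atypical vertex misses more than |bs|/2 slots, while all vertices outside [B] together miss
    at most 4e|bs|. *)
Lemma card_atypical : #|O| <= 8 * e.
Proof.
have b0 : 0 < size bs.
  have := number_of_blocks; have [_] := le_qe; move: m_large e_gt0 (size bs).
  by move: (q * e); clear; lia.
rewrite -(leq_pmul2r b0); apply: (@leq_trans (\sum_(a in O) 2 * missed H j bs a)).
  rewrite -sum_nat_const; apply: leq_sum => a; rewrite /atypical in_setD in_setC in_typical => /andP[+ aB].
  by rewrite aB /= -ltnNge => /ltnW.
have := sum_missed misses uniq_blocks size_block blocks_sub.
rewrite -big_distrr /= => h; apply: (@leq_trans (2 * (4 * e * size bs))); last by rewrite !mulnA.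
rewrite leq_mul2l /=; apply: leq_trans h.
rewrite big_mkcond [X in _ <= X]big_mkcond; apply: leq_sum => a _.
by rewrite /atypical in_setD in_setC; case: (a \in A1); case: (a \in B).
Qed.

Lemma card_typical : #|A1| + #|O| = #|~: B|.
Proof.
by rewrite /atypical -(cardsID A1 (~: B)) (setIidPr typical_sub).
Qed.

(** * Tiles covering prescribed vertices *)

Lemma pick_B l (F : {set V}) : l <= 200 * (q * e) -> #|F| <= 200 * (q * e) ->
  exists s, [/\ uniq s, size s = l & forall v, v \in s -> (v \in B) && (v \notin F)].
Proof.
move=> h1 h2; apply: fresh_seq; have h3 : 3 * m <= (2 * j + 3) * m.
  by rewrite leq_mul2r addnC leq_addr orbT.
have := leq_trans h3 card_B_large; have := le_qe.2; move: m_large h1 h2.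
by move: (q * e) #|F| #|B|; clear; move=> *; lia.
Qed.

Lemma pick_typical (X F : {set V}) : #|X| <= 200 * (q * e) -> #|F| <= 200 * (q * e) ->
  exists a, [&& a \in A1, a \notin X & a \notin F].
Proof.
move=> h1 h2; have [|a] := @fresh_vertex V A1 (X :|: F); last first.
  by rewrite in_setU negb_or => /and3P[? ? ?]; exists a; apply/and3P.
have [+ _] := leq_card_setU X F; have := card_atypical; have := card_typical; have := le_qe.2.
move: geA m_large h1 h2 e_gt0.
by move: (q * e) #|F| #|X| #|A1| #|~: B| #|X :|: F| #|O|; goal_lia.
Qed.

Definition piece (F : {set V}) (c : nat) (s : seq V) := [/\ uniq s,
  forall v, v \in s -> v \notin F, forall v, v \in s -> (v \in A1) || (v \in B) &
  count [in A1] s = c].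

(* An atypical vertex is covered like a vertex of the small part if it is attachable, and like a vertex
   of [B] if it is pluggable. *)
Definition attachable o := forall F : {set V}, #|F| <= 40 * (q * e) ->
  exists2 s, piece F 1 s & tileable H j (o :: s) /\ size s = 2 * j + 4.

Definition pluggable b := exists2 F : {set V}, #|F| <= 40 * (q * e) &
  forall S, uniq S -> size S = j.+1 -> (forall v, v \in S -> (v \in B) && (v \notin F)) ->
  b \notin S -> #|[set a in A1 | ~~ edge H (a :: b :: S)]| <= 50 * (q * e).

Lemma count_typical_B s : {subset s <= B} -> count [in A1] s = 0.
Proof.
move=> sub; apply/eqP; rewrite -leqn0 leqNgt -has_count; apply/hasPn=> v /sub vB.
by apply: contraL vB => /typicalNB.
Qed.

Lemma card_seq_set (s : seq V) : #|[set z in s]| <= size s.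
Proof. by apply: leq_trans (eq_leq (cardsE _)) (card_size _). Qed.

Lemma pluggable_B b : b \in B -> pluggable b.
Proof.
move=> bB; exists set0; first by rewrite cards0.
move=> S uS sS SB bS; apply: (@leq_trans e); last first.
  by apply: leq_trans le_qe.2 _; apply: leq_pmull.
apply: leq_trans (@misses (b :: S) _ _ _) => //=; rewrite ?bS ?sS //.
  by apply: subset_leq_card; apply/subsetP=> a; rewrite !inE => /andP[/typicalNB-> ->].
by move=> v; rewrite inE => /orP[/eqP->|/SB/andP[]].
Qed.

(** If [o] is not attachable, a set [F] witnesses this. For S in B outside F, the 2m neighbours of o
    S can then hardly lie in B, hence are almost all of the typical vertices, of which there are at
    most 2m + e. *)
Lemma attachable_or_pluggable o : o \in O -> attachable o \/ pluggable o.
Proof.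
move=> oO; have [//|na] := classic (attachable o); [by left|right].
have [oA oB] := andP (atypicalN oO).
have [F leF nex] : exists2 F : {set V}, #|F| <= 40 * (q * e) &
    ~ exists2 s, piece F 1 s & tileable H j (o :: s) /\ size s = 2 * j + 4.
  apply: NNPP => h; apply: na => F leF; apply: NNPP => nex; apply: h; by exists F.
exists F => // S uS sS SB oS; have [q1 q2] := le_qe.
have SsB v : v \in S -> v \in B by move=> /SB/andP[].
pose N := nb H (o :: S).
have cN : 2 * m <= #|N| by apply: card_nb cod _ _ _; rewrite //= ?oS ?sS.
(* Two such neighbours x and y would give the tile with edges x o S, y o S and x y W z, whose only
   typical vertex is z, against the choice of [F]. *)
have few : #|[set v in N | (v \in B) && (v \notin F)]| <= 1.
  rewrite leqNgt; apply/negP=> lt1.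
  have [|[|x [|y [|? ?]]] [] // uxy _ hxy] := @fresh_seq V [set v in N | (v \in B) && (v \notin F)] set0 2.
    by rewrite cards0 addn0.
  have [/hxy hx /hxy hy] : x \in [:: x; y] /\ y \in [:: x; y] by rewrite !inE !eqxx orbT.
  rewrite !inE /= andbT in hx; rewrite !inE /= andbT in hy.
  have /and3P[/andP[xS ex] xB xF] := hx; have /and3P[/andP[yS ey] yB yF] := hy.
  rewrite !negb_or in xS yS; have [xo {}xS] := andP xS; have [yo {}yS] := andP yS.
  have xy : x != y by move: uxy; rewrite /= inE andbT.
  have [||W [uW sW hW]] := @pick_B j (F :|: [set z in x :: y :: S]).
  - by move: q1; move: (q * e); goal_lia.
  - have [+ _] := leq_card_setU F [set z in x :: y :: S]; have := card_seq_set (x :: y :: S).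
    by rewrite /= sS; move: leF q1; move: (q * e); goal_lia.
  have WB v : v \in W -> v \in B by move=> /hW/andP[].
  have WN v : v \in W -> [&& v != x, v != y, v \notin S & v \notin F].
    by move=> /hW/andP[_]; rewrite !inE !negb_or => /and4P[-> -> -> ->].
  have uxyW : uniq (x :: y :: W).
    rewrite /= inE negb_or xy uW andbT /=; apply/andP; split; apply/negP=> /WN.
      by rewrite eqxx.
    by rewrite eqxx andbF.
  have mxyW := misses uxyW; rewrite /= sW in mxyW.
  have [||z /and3P[zA ez zF]] := @pick_typical [set a in ~: B | ~~ edge H (a :: x :: y :: W)] F.
  - apply: leq_trans (mxyW _ _) _ => //; last by move: q2; move: (q * e); goal_lia.
    by move=> v; rewrite !inE => /or3P[/eqP->|/eqP->|/WB].
  - by move: leF; move: (q * e); goal_lia.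
  have zB := typicalNB zA; rewrite !inE zB /= negbK in ez.
  apply: nex; exists (z :: W ++ x :: y :: S).
    split.
    - rewrite /=; apply/andP; split.
        rewrite mem_cat !inE !negb_or; apply/and4P; split.
        + by apply: contra zB => /WB.
        + by apply: contraNneq zB => ->.
        + by apply: contraNneq zB => ->.
        + by apply: contra zB => /SsB.
      apply: uniq_cat_disjoint => //=; first by rewrite inE negb_or xy xS yS uS.
      by move=> v /WN/and4P[h1 h2 h3 _]; rewrite !inE !negb_or h1 h2 h3.
    - move=> v; rewrite inE mem_cat !inE => /or3P[/eqP->|/WN/and4P[]|/or3P[/eqP->|/eqP->|/SB/andP[]]] //.
    - move=> v; rewrite in_cons mem_cat !in_cons.
      by move=> /or3P[/eqP->|/WB->|/or3P[/eqP->|/eqP->|/SsB->]]; rewrite ?zA ?xB ?yB ?orbT.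
    - rewrite /= zA count_typical_B // => v; rewrite mem_cat !inE.
      by move=> /orP[/WB|/or3P[/eqP->|/eqP->|/SsB]].
  split; last by rewrite /= size_cat /= sW sS; goal_lia.
  apply: (@tileable_cons _ H j (o :: S) x y (W ++ [:: z])) => //=; rewrite ?sS ?size_cat ?sW ?addn1 //.
    by rewrite (@edge_perm _ _ _ (z :: x :: y :: W)) //; perm_by_count.
  by perm_by_count.
have sub : N \subset [set a in A1 | edge H (a :: o :: S)] :|: O :|: F :|:
    [set v in N | (v \in B) && (v \notin F)].
  apply/subsetP=> v vN; move: (vN); rewrite [v \in N]inE => /andP[_ ev].
  rewrite inE [v \in [set v in N | _]]inE vN in_setU in_setU [v \in [set a in _ | _]]inE ev andbT.
  have [//|vO] := boolP (v \in O); rewrite ?orbT // orbF.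
  by have := not_atypical vO; case: (v \in A1) => //= ->; case: (v \in F).
have cs := subset_leq_card sub.
have c1 := cardsID [set a | edge H (a :: o :: S)] A1.
have e1 : A1 :&: [set a | edge H (a :: o :: S)] = [set a in A1 | edge H (a :: o :: S)].
  by apply/setP=> a; rewrite !inE.
have e2 : A1 :\: [set a | edge H (a :: o :: S)] = [set a in A1 | ~~ edge H (a :: o :: S)].
  by apply/setP=> a; rewrite !inE andbC.
rewrite e1 e2 in c1.
have [+ _] := leq_card_setU ([set a in A1 | edge H (a :: o :: S)] :|: O :|: F)
  [set v in N | (v \in B) && (v \notin F)].
have [+ _] := leq_card_setU ([set a in A1 | edge H (a :: o :: S)] :|: O) F.
have [+ _] := leq_card_setU [set a in A1 | edge H (a :: o :: S)] O.
move: few c1 cs cN leF card_atypical card_typical leA e_gt0 q2.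
move: (q * e) #|_ :|: _| #|_ :|: _| #|_ :|: _| #|[set a in A1 | edge _ _]| #|[set a in A1 | ~~ _]|.
by move: #|N| #|F| #|O| #|A1| #|~: B| #|[set v in N | _]|; goal_lia.
Qed.

Lemma piece_cat (F : {set V}) c al bl : uniq al -> uniq bl -> size al = c ->
  (forall v, v \in al -> (v \in A1) && (v \notin F)) ->
  (forall v, v \in bl -> (v \in B) && (v \notin F)) -> piece F c (al ++ bl).
Proof.
move=> ua ub sa hA hB; split.
- apply: uniq_cat_disjoint => // v /hA/andP[/typicalNB vB _].
  by apply/negP=> /hB/andP[]; rewrite (negbTE vB).
- by move=> v; rewrite mem_cat => /orP[/hA|/hB] /andP[].
- by move=> v; rewrite mem_cat => /orP[/hA|/hB] /andP[->]; rewrite ?orbT.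
- have cb : count [in A1] bl = 0 by apply: count_typical_B => v /hB/andP[].
  rewrite count_cat cb addn0 -sa; apply/eqP; rewrite -all_count; apply/allP=> v /hA/andP[] //.
Qed.

Lemma misses_typical s : uniq s -> size s = j.+2 -> {subset s <= B} ->
  #|[set a in A1 | ~~ edge H (a :: s)]| <= e.
Proof.
move=> us ss sub; apply: leq_trans (misses us ss sub); apply: subset_leq_card.
by apply/subsetP=> a; rewrite in_set => /andP[/typicalNB aB ea]; rewrite !inE aB.
Qed.

Lemma card_setU_le (A C : {set V}) : #|A :|: C| <= #|A| + #|C|.
Proof. by have [] := leq_card_setU A C. Qed.

(** The tile has edges x a b S, y a b S and x y W z with a and z typical and all vertices other than
    a, z and b in [B]: b replaces a vertex of [B]. *)
Lemma cover_pluggable b (F : {set V}) : b \in O -> pluggable b -> #|F| <= 40 * (q * e) ->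
  exists2 s, piece F 2 s & tileable H j (b :: s) /\ size s = 2 * j + 4.
Proof.
move=> bO [F0 leF0 pb] leF; have [bA bB] := andP (atypicalN bO); have [q1 q2] := le_qe.
have [||L [uL sL hL]] := @pick_B (2 * j + 2) (F :|: F0).
- by move: q1; move: (q * e); goal_lia.
- by have := card_setU_le F F0; move: leF leF0 q1; move: (q * e) #|_ :|: _| #|F| #|F0|; goal_lia.
case: L uL sL hL => [|x [|y R]]; try by move=> _ /=; lia.
move=> uL sR hL; rewrite [size _]/= in sR; pose S := take j R; pose W := drop j R.
have eR : R = S ++ W by rewrite cat_take_drop.
have sS : size S = j by rewrite size_takel; move: sR; goal_lia.
have sW : size W = j by rewrite size_drop; move: sR; goal_lia.
have LB v : v \in x :: y :: R -> v \in B by move=> /hL/andP[].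
have LF v : v \in x :: y :: R -> (v \notin F) && (v \notin F0).
  by move=> /hL/andP[_]; rewrite in_setU negb_or.
have cnt v : count_mem v (x :: y :: R) = count_mem v [:: x; y] + count_mem v S + count_mem v W.
  by rewrite eR /= !count_cat; goal_lia.
have sub l : (forall v, count_mem v l <= count_mem v (x :: y :: R)) ->
    uniq l /\ {subset l <= x :: y :: R}.
  move=> le; split; first exact: uniq_count_le le uL.
  by move=> v; rewrite -!has_pred1 !has_count => /leq_trans; apply.
have [u1 s1] : uniq (x :: S) /\ {subset x :: S <= x :: y :: R}.
  by apply: sub => v; rewrite cnt /=; goal_lia.
have [u2 s2] : uniq (y :: S) /\ {subset y :: S <= x :: y :: R}.
  by apply: sub => v; rewrite cnt /=; goal_lia.
have [u3 s3] : uniq (x :: y :: W) /\ {subset x :: y :: W <= x :: y :: R}.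
  by apply: sub => v; rewrite cnt /=; goal_lia.
have bN (l : seq V) : {subset l <= x :: y :: R} -> b \notin l.
  by move=> sl; apply: contra bB => /sl/LB.
have use (l : seq V) : {subset l <= x :: y :: R} -> forall v, v \in l -> (v \in B) && (v \notin F0).
  by move=> sl v /sl vL; rewrite LB //; case/andP: (LF v vL).
have [sz1 sz2] : size (x :: S) = j.+1 /\ size (y :: S) = j.+1 by rewrite /= sS.
have m1 := pb (x :: S) u1 sz1 (use _ s1) (bN _ s1).
have m2 := pb (y :: S) u2 sz2 (use _ s2) (bN _ s2).
have m3 : #|[set a in A1 | ~~ edge H (a :: x :: y :: W)]| <= e.
  by apply: misses_typical => [||v /s3/LB] //=; rewrite sW.
have [||a /and3P[aA ea aF]] := @pick_typical ([set a in A1 | ~~ edge H (a :: b :: x :: S)] :|: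
    [set a in A1 | ~~ edge H (a :: b :: y :: S)]) F.
- by apply: leq_trans (card_setU_le _ _) _; move: m1 m2; move: (q * e); goal_lia.
- by move: leF; move: (q * e); goal_lia.
rewrite in_setU !in_set aA /= negb_or !negbK in ea; have [ea1 ea2] := andP ea.
have [||z /and3P[zA ez zF]] := @pick_typical [set a in A1 | ~~ edge H (a :: x :: y :: W)] (a |: F).
- by apply: leq_trans m3 _; move: q2; move: (q * e); goal_lia.
- by rewrite cardsU1; move: leF q1; move: (q * e) #|F|; case: (a \notin F); goal_lia.
rewrite in_set zA /= negbK in ez; rewrite in_setU1 negb_or in zF; have [za {}zF] := andP zF.
exists ([:: a; z] ++ x :: y :: R).
  apply: piece_cat => //=.
  - by rewrite inE eq_sym za.
  - by move=> v; rewrite !inE => /orP[] /eqP->; [rewrite aA aF|rewrite zA zF].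
  - by move=> v vL; rewrite LB //; case/andP: (LF v vL).
split; last by rewrite /= sR; goal_lia.
apply: (@tileable_cons _ H j (a :: b :: S) x y (W ++ [:: z])) => /=; rewrite ?sS ?size_cat ?sW ?addn1 //.
- by rewrite (@edge_perm _ _ _ (a :: b :: x :: S)) //; perm_by_count.
- by rewrite (@edge_perm _ _ _ (a :: b :: y :: S)) //; perm_by_count.
- by rewrite (@edge_perm _ _ _ (z :: x :: y :: W)) //; perm_by_count.
- by rewrite eR; perm_by_count.
Qed.

(** The given edge becomes the third edge of the tile. One typical vertex a with S in [B] supplies
    the other two, x a S and y a S, so the tile takes only one typical vertex. *)
Lemma extend_edge x y W (F : {set V}) : edge H (x :: y :: W) -> size W = j.+1 ->
  pluggable x -> pluggable y -> #|F| <= 40 * (q * e) ->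
  exists2 s, piece F 1 s & tileable H j (x :: y :: W ++ s) /\ size s = j + 2.
Proof.
move=> exy sW [Fx leFx px] [Fy leFy py] leF; have [q1 q2] := le_qe.
have [||S [uS sS hS]] := @pick_B j.+1 (F :|: Fx :|: Fy :|: [set z in [:: x; y]]).
- by move: q1; move: (q * e); goal_lia.
- apply: leq_trans (card_setU_le _ _) _; have := card_seq_set [:: x; y].
  have := card_setU_le (F :|: Fx) Fy; have := card_setU_le F Fx.
  move: leF leFx leFy q1; move: (q * e) #|_ :|: _| #|_ :|: _| #|F| #|Fx| #|Fy| #|[set _ in _]|.
  by rewrite /=; goal_lia.
have hS' v : v \in S -> [/\ v \in B, v \notin F, v \notin Fx, v \notin Fy & v \notin [:: x; y]].
  by move=> /hS/andP[-> +]; rewrite !in_setU in_set !negb_or => /andP[/andP[/andP[-> ->] ->] ->].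
have m1 : #|[set a in A1 | ~~ edge H (a :: x :: S)]| <= 50 * (q * e).
  apply: px => // [v /hS'[-> _ -> _ _] //|]; apply/negP=> /hS'[_ _ _ _].
  by rewrite inE eqxx.
have m2 : #|[set a in A1 | ~~ edge H (a :: y :: S)]| <= 50 * (q * e).
  apply: py => // [v /hS'[-> _ _ -> _] //|]; apply/negP=> /hS'[_ _ _ _].
  by rewrite !inE eqxx orbT.
have [||a /and3P[aA ea aF]] := @pick_typical ([set a in A1 | ~~ edge H (a :: x :: S)] :|:
    [set a in A1 | ~~ edge H (a :: y :: S)]) F.
- by apply: leq_trans (card_setU_le _ _) _; move: m1 m2; move: (q * e); goal_lia.
- by move: leF; move: (q * e); goal_lia.
rewrite in_setU !in_set aA /= negb_or !negbK in ea; have [ea1 ea2] := andP ea.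
exists ([:: a] ++ S).
  apply: piece_cat => //=; first by move=> v; rewrite inE => /eqP->; rewrite aA aF.
  by move=> v /hS'[-> -> _ _ _].
split; last by rewrite /= sS addn2.
apply: (@tileable_cons _ H j (a :: S) x y W) => //=; rewrite ?sS //.
- by rewrite (@edge_perm _ _ _ (a :: x :: S)) //; perm_by_count.
- by rewrite (@edge_perm _ _ _ (a :: y :: S)) //; perm_by_count.
- by perm_by_count.
Qed.

Lemma mem_seq_set (s : seq V) v : (v \in [set z in s]) = (v \in s).
Proof. by rewrite inE. Qed.

(** Suppose there is no such tile. Then for most typical x and y the neighbours of x y W lie almost
    all in [B], as a typical one would complete a tile with S as common part. This yields b and z in
    [B] with edges b x w W2 and z x y W1, where b z W1 is also joined to y. The tile with edges x y
    z W1, b y z W1 and x b w W2 contains the typical vertices x, y and w. *)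
Lemma three_typical (F : {set V}) : #|F| <= 40 * (q * e) ->
  exists2 s, piece F 3 s & tileable H j s /\ size s = q.
Proof.
move=> leF; have [q1 q2] := le_qe; apply: NNPP => nex.
have [||S [uS sS hS]] := @pick_B j.+2 F.
- by move: q1; move: (q * e); goal_lia.
- by move: leF; move: (q * e); goal_lia.
have SB v : v \in S -> v \in B by move=> /hS/andP[].
pose F1 := F :|: [set z in S]; have leF1 : #|F1| <= 41 * (q * e).
  have := card_setU_le F [set z in S]; have := card_seq_set S; rewrite sS -/F1.
  by move: leF q1; move: (q * e) #|F1| #|F| #|[set z in S]|; goal_lia.
have [||L [uL sL hL]] := @pick_B (2 * j) F1.
- by move: q1; move: (q * e); goal_lia.
- by move: leF1; move: (q * e); goal_lia.
pose W1 := take j L; pose W2 := drop j L.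
have eL : L = W1 ++ W2 by rewrite cat_take_drop.
have sW1 : size W1 = j by rewrite size_takel; move: sL; goal_lia.
have sW2 : size W2 = j by rewrite size_drop; move: sL; goal_lia.
have [uW1 uW2] : uniq W1 /\ uniq W2 by split; [apply: take_uniq|apply: drop_uniq].
have hW1 v : v \in W1 -> (v \in B) && (v \notin F1) by move=> /mem_take/hL.
have hW2 v : v \in W2 -> (v \in B) && (v \notin F1) by move=> /mem_drop/hL.
pose X := [set a in A1 | ~~ edge H (a :: S)].
have cX : #|X| <= e by apply: misses_typical.
have [||x /and3P[xA xX xF]] := @pick_typical X F.
- by apply: leq_trans cX _; move: q2; move: (q * e); goal_lia.
- by move: leF; move: (q * e); goal_lia.
have [||w /and3P[wA]] := @pick_typical X (x |: F).
- by apply: leq_trans cX _; move: q2; move: (q * e); goal_lia.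
- by rewrite cardsU1; move: leF q1; move: (q * e) #|F|; case: (x \notin F); goal_lia.
rewrite in_setU1 negb_or => wX /andP[wx wF].
have adj a : a \in A1 -> a \notin X -> edge H (a :: S).
  by move=> aA; rewrite in_set aA negbK.
have none y W z : y \in A1 -> y \notin X -> y \notin F -> y != x -> uniq W -> size W = j ->
    (forall v, v \in W -> (v \in B) && (v \notin F1)) ->
    z \in A1 -> z \notin F -> z \notin nb H (x :: y :: W).
  move=> yA yX yF yx uW sW hW zA zF; apply/negP; rewrite inE !in_cons !negb_or.
  move=> /andP[/and3P[zx zy zW] ez]; apply: nex; exists ([:: z; x; y] ++ (S ++ W)).
    apply: piece_cat => //=.
    - by rewrite !inE negb_or zx zy eq_sym yx.
    - apply: uniq_cat_disjoint => // v vS; apply/negP=> /hW/andP[_].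
      by rewrite in_setU negb_or mem_seq_set vS andbF.
    - by move=> v; rewrite !in_cons orbF => /or3P[]/eqP->; rewrite ?zA ?xA ?yA ?zF ?xF ?yF.
    - move=> v; rewrite mem_cat => /orP[/hS//|/hW/andP[->]].
      by rewrite in_setU negb_or => /andP[].
  split; last by rewrite /= size_cat sS sW; goal_lia.
  apply: (@tileable_cons _ H j S x y (W ++ [:: z])); rewrite ?size_cat ?sW ?addn1 ?adj //.
    by rewrite (@edge_perm _ _ _ (z :: x :: y :: W)) //; perm_by_count.
  by perm_by_count.
have many_nb y W (F2 : {set V}) : y \in A1 -> y \notin X -> y \notin F -> y != x -> uniq W ->
    size W = j -> (forall v, v \in W -> (v \in B) && (v \notin F1)) ->
    2 * m <= #|[set v in B | (v \notin F2) && (v \in nb H (x :: y :: W))]| + 8 * e + #|F2| + #|F|.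
  move=> yA yX yF yx uW sW hW.
  have WN v : v \in A1 -> v \notin W.
    by move=> /typicalNB vB; apply: contra vB => /hW/andP[].
  apply: (@leq_trans #|nb H (x :: y :: W)|).
    by apply: card_nb cod _ _ _; rewrite //= ?sW // in_cons negb_or eq_sym yx !WN.
  apply: (@leq_trans #|[set v in B | (v \notin F2) && (v \in nb H (x :: y :: W))] :|: O :|: F2 :|: F|).
    apply: subset_leq_card; apply/subsetP=> v vn; rewrite !in_setU in_set vn andbT.
    have [//|vF] := boolP (v \in F); first by rewrite orbT.
    have [//|vF2] := boolP (v \in F2); first by rewrite orbT.
    have [//|vO] := boolP (v \in O); first by rewrite !orbT.
    rewrite !orbF andbT; case/orP: (not_atypical vO) => // vA.
    by have := none y W v yA yX yF yx uW sW hW vA vF; rewrite vn.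
  apply: leq_trans (card_setU_le _ _) _; rewrite leq_add2r.
  apply: leq_trans (card_setU_le _ _) _; rewrite leq_add2r.
  by apply: leq_trans (card_setU_le _ _) _; rewrite leq_add2l card_atypical.
pose F2 := F1 :|: [set z in L]; have leF2 : #|F2| <= 42 * (q * e).
  have := card_setU_le F1 [set z in L]; have := card_seq_set L; rewrite sL -/F2.
  by move: leF1 q1; move: (q * e) #|F1| #|F2| #|[set z in L]|; goal_lia.
have [b] : exists b, b \in [set v in B | (v \notin F2) && (v \in nb H (x :: w :: W2))].
  apply/card_gt0P; have := many_nb w W2 F2 wA wX wF wx uW2 sW2 hW2.
  by move: leF leF2 q1 q2 m_large e_gt0; move: (q * e) #|F| #|F2| #|[set _ in _ | _]|; goal_lia.
rewrite in_set => /and3P[bB]; rewrite in_setU negb_or mem_seq_set => /andP[bF1 bL].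
rewrite in_set => /andP[]; rewrite !in_cons !negb_or => /and3P[bx bw bW2] eb.
pose Y := [set y in A1 | [&& y \notin X, y \notin F, y != x & y != w]].
pose Zs y := [set v in B | (v \notin b |: F2) && (v \in nb H (x :: y :: W1))].
have cY : m <= #|Y|.
  have : A1 \subset Y :|: (X :|: F :|: [set x; w]).
    apply/subsetP=> v vA; rewrite !in_setU [v \in Y]in_set vA !in_set1.
    by case: (v \in X) => //=; case: (v \in F) => //=; case: (v == x) => //=; case: (v == w).
  move=> /subset_leq_card; have := card_setU_le Y (X :|: F :|: [set x; w]).
  have := card_setU_le (X :|: F) [set x; w]; have := card_setU_le X F.
  have : #|[set x; w]| <= 2 by rewrite cards2; case: (x != w).
  have := card_atypical; have := card_typical; move: geA cX leF q1 q2 m_large e_gt0.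
  move: (q * e) #|_ :|: _| #|_ :|: _| #|_ :|: _| #|X| #|F| #|Y| #|A1| #|O| #|~: B| #|[set x; w]|.
  by goal_lia.
have cZ y : y \in Y -> m <= #|Zs y|.
  rewrite in_set => /and5P[yA yX yF yx yw].
  have := many_nb y W1 (b |: F2) yA yX yF yx uW1 sW1 hW1; rewrite -/(Zs y) cardsU1.
  move: leF leF2 q1 q2 m_large e_gt0; case: (b \notin F2).
    by move: (q * e) #|F| #|F2| #|Zs y|; goal_lia.
  by move: (q * e) #|F| #|F2| #|Zs y|; goal_lia.
(* There are at least m^2 candidate pairs (y, z), but each set b z W1 in [B] misses at most e
   typical y, which excludes at most q m e pairs. *)
have [y [z [yY zZ eyz]]] : exists y z, [/\ y \in Y, z \in Zs y & edge H (y :: b :: z :: W1)].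
  apply: NNPP => nyz.
  have h1 : m * m <= \sum_(y in Y) #|Zs y|.
    apply: (@leq_trans (\sum_(y in Y) m)); first by rewrite sum_nat_const leq_mul2r cY orbT.
    exact: leq_sum.
  have h2 : \sum_(y in Y) #|Zs y| <= q * m * e.
    have -> : \sum_(y in Y) #|Zs y| = \sum_(y in Y) \sum_(z in B) (z \in Zs y : nat).
      apply: eq_bigr => y _; rewrite -sum1_card big_mkcond [RHS]big_mkcond.
      apply: eq_bigr => z _; rewrite [z \in Zs y]in_set.
      by case: (z \in B) => //=; case: (_ && _).
    rewrite exchange_big /=; apply: (@leq_trans (\sum_(z in B) e)); last first.
      by rewrite sum_nat_const leq_mul2r -card_B leq_addr orbT.
    apply: leq_sum => z zB; have [zok|zbad] := boolP (z \in b |: F2).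
      rewrite big1 // => y _; apply/eqP; rewrite eqb0 in_set zok /= andbF //.
    move: zbad; rewrite in_setU1 in_setU negb_or negb_or mem_seq_set => /and3P[zb zF1 zL].
    have W1L v : v \in W1 -> v \in L by move=> /mem_take.
    have := @misses_typical (b :: z :: W1); rewrite /= sW1 in_cons negb_or eq_sym zb uW1 andbT /=.
    move=> /(_ _ erefl _) h; apply: leq_trans (h _ _).
    - rewrite -[X in _ <= X]sum1_card big_mkcond [X in _ <= X]big_mkcond; apply: leq_sum => y _.
      have [yY|//] := boolP (y \in Y); have [zZ|//] := boolP (z \in Zs y).
      have yA : y \in A1 by move: yY; rewrite in_set => /andP[].
      rewrite in_set yA /=; case: (boolP (edge _ _)) => //= ey.
      by case: nyz; exists y, z.
    - by rewrite !(contra (@W1L _)).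
    - move=> v; rewrite !in_cons => /or3P[/eqP->|/eqP->|/hW1/andP[]] //.
  have h3 := leq_trans h1 h2; rewrite mulnAC leq_mul2r in h3.
  by move: h3 m_large e_gt0 q2; case/orP => [/eqP->|]; move: (q * e); goal_lia.
move: yY zZ; rewrite in_set => /and5P[yA yX yF yx yw]; rewrite in_set => /and3P[zB].
rewrite in_setU1 in_setU !negb_or mem_seq_set => /and3P[zb zF1 zL].
rewrite in_set => /andP[]; rewrite !in_cons !negb_or => /and3P[zx zy zW1] ez.
apply: nex; exists ([:: y; x; w] ++ z :: b :: L).
  apply: piece_cat => //=.
  - by rewrite !inE negb_or yx yw eq_sym wx.
  - by rewrite in_cons negb_or zb zL bL uL.
  - by move=> v; rewrite !in_cons orbF => /or3P[]/eqP->; rewrite ?yA ?xA ?wA ?yF ?xF ?wF.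
  - move=> v; rewrite !in_cons => /or3P[/eqP->|/eqP->|/hL/andP[->]]; rewrite ?zB ?bB.
    + by move: zF1; rewrite in_setU negb_or => /andP[].
    + by move: bF1; rewrite in_setU negb_or => /andP[].
    + by rewrite in_setU negb_or => /andP[].
split; last by rewrite /= sL; goal_lia.
apply: (@tileable_cons _ H j (y :: z :: W1) x b (w :: W2)); rewrite /= ?sW1 ?sW2 //.
- by rewrite (@edge_perm _ _ _ (z :: x :: y :: W1)) //; perm_by_count.
- by rewrite (@edge_perm _ _ _ (y :: b :: z :: W1)) //; perm_by_count.
- by rewrite (@edge_perm _ _ _ (b :: x :: w :: W2)) //; perm_by_count.
- by rewrite eL; perm_by_count.
Qed.

(** * Collecting disjoint tiles and correcting the balance *)

Lemma piece_join (F : {set V}) c c' s t : piece F c s -> piece (F :|: [set z in s]) c' t ->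
  piece F (c + c') (s ++ t).
Proof.
move=> [u1 f1 b1 c1] [u2 f2 b2 c2]; split.
- apply: uniq_cat_disjoint => // v vs; apply/negP=> /f2.
  by rewrite in_setU mem_seq_set vs orbT.
- move=> v; rewrite mem_cat => /orP[/f1//|/f2].
  by rewrite in_setU negb_or => /andP[].
- by move=> v; rewrite mem_cat => /orP[/b1|/b2].
- by rewrite count_cat c1 c2.
Qed.

Lemma three_typical_iter d (F : {set V}) : #|F| + q * d <= 40 * (q * e) ->
  exists2 s, piece F (3 * d) s & tileable H j s /\ size s = q * d.
Proof.
elim: d => [|d IH] leF.
  by exists [::]; rewrite ?muln0 //; split=> //; apply: tileable_nil.
have [|s ps [ts ss]] := IH; first by rewrite mulnS in leF; move: leF; move: (q * d) (q * e); goal_lia.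
have [|t pt [tt st]] := @three_typical (F :|: [set z in s]).
  have := card_setU_le F [set z in s]; have := card_seq_set s; rewrite ss.
  move: leF; rewrite mulnS; move: (q * d) (q * e) #|_ :|: _| #|F| #|[set _ in _]|; goal_lia.
exists (s ++ t); first by rewrite mulnSr; apply: piece_join.
by split; [apply: tileable_cat|rewrite size_cat ss st mulnSr].
Qed.

(** An attachable vertex counts as one of the two vertices that its tile takes from the small part,
    so one typical vertex is used with it, and two with any other atypical vertex. *)
Lemma cover_atypical (A2 : {set V}) os (F : {set V}) :
  (forall o, o \in A2 -> attachable o) -> (forall o, o \in os -> o \in O) ->
  (forall o, o \in os -> o \notin A2 -> pluggable o) ->
  #|F| + q * size os <= 40 * (q * e) ->
  exists c s, [/\ piece F c s, tileable H j (os ++ s), size (os ++ s) = q * size os &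
    c + count [in A2] os = 2 * size os].
Proof.
move=> hA2; elim: os => [|o os IH] hO hp leF.
  by exists 0, [::]; rewrite !muln0; split=> //; apply: tileable_nil.
have [|||c [s [ps ts ss ec]]] := IH.
- by move=> z zo; apply: hO; rewrite in_cons zo orbT.
- by move=> z zo; apply: hp; rewrite in_cons zo orbT.
- by rewrite /= mulnS in leF; move: leF; move: (q * size os) (q * e); goal_lia.
have leFs : #|F :|: [set z in s]| <= 40 * (q * e).
  have := card_setU_le F [set z in s]; have := card_seq_set s.
  have : size s <= q * size os by rewrite -ss size_cat leq_addl.
  move: leF; rewrite /= mulnS; move: (q * size os) (q * e) #|_ :|: _| #|F| #|[set _ in _]|; goal_lia.
have oO : o \in O by apply: hO; rewrite mem_head.
have [t [pt tt st]] : exists t, [/\ piece (F :|: [set z in s]) (2 - (o \in A2)) t,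
    tileable H j (o :: t) & size t = 2 * j + 4].
  have [oA|oA] := boolP (o \in A2).
    by have [t pt [tt st]] := hA2 o oA _ leFs; exists t.
  have [t pt [tt st]] := cover_pluggable oO (hp o (mem_head _ _) oA) leFs.
  by exists t; rewrite subn0.
exists (c + (2 - (o \in A2))), (s ++ t); split.
- exact: piece_join.
- apply: tileable_perm _ (tileable_cat ts tt); perm_by_count.
- by move: ss; rewrite /= !size_cat st mulnS; move: (q * size os); goal_lia.
- by rewrite /=; move: ec; case: (o \in A2) => /=; goal_lia.
Qed.

Lemma extend_matching ms (F : {set V}) :
  (forall g, g \in ms -> [/\ size g = j.+3, edge H g & forall v, v \in g -> pluggable v]) ->
  #|F| + q * size ms <= 40 * (q * e) ->
  exists s, [/\ piece F (size ms) s, tileable H j (flatten ms ++ s) &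
    size (flatten ms ++ s) = q * size ms].
Proof.
elim: ms => [|g ms IH] hg leF.
  by exists [::]; rewrite muln0; split=> //; apply: tileable_nil.
have [||s [ps ts ss]] := IH.
- by move=> z zo; apply: hg; rewrite in_cons zo orbT.
- by rewrite /= mulnS in leF; move: leF; move: (q * size ms) (q * e); goal_lia.
have leFs : #|F :|: [set z in s]| <= 40 * (q * e).
  have := card_setU_le F [set z in s]; have := card_seq_set s.
  have : size s <= q * size ms by rewrite -ss size_cat leq_addl.
  move: leF; rewrite /= mulnS; move: (q * size ms) (q * e) #|_ :|: _| #|F| #|[set _ in _]|; goal_lia.
have [sg eg pg] := hg g (mem_head _ _).
have [x [y [W eW]]] : exists x y W, g = x :: y :: W.
  by case: (g) sg => [|x [|y W]] //= _; exists x, y, W.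
subst g; have [||||t pt [tt st]] := @extend_edge x y W (F :|: [set z in s]) eg.
- by case: sg.
- by apply: pg; rewrite mem_head.
- by apply: pg; rewrite !in_cons eqxx orbT.
- by [].
exists (s ++ t); split.
- by rewrite /= -addn1; apply: piece_join.
- by apply: tileable_perm _ (tileable_cat ts tt); rewrite /= ; perm_by_count.
- move: ss sg; rewrite /= !size_cat st mulnS.
  by move: (q * size ms); goal_lia.
Qed.

(** The equation on |A1| says that exactly 2(m - tau) typical vertices remain, two for each of the m
    - tau tiles still to be formed. *)
Lemma finish_extremal S tau : tileable H j S -> uniq S -> (forall o, o \in O -> o \in S) ->
  size S = q * tau -> tau <= 20 * e -> #|A1| + 2 * tau = count [in A1] S + 2 * m ->
  tileable H j (enum V).
Proof.
move=> tS uS OS sS letau cA1; have [q1 q2] := le_qe.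
have leqt : q * tau <= 20 * (q * e) by rewrite mulnCA leq_mul2l letau orbT.
have ltm : tau <= m.
  by apply: leq_trans letau _; move: m_large q2; move: (q * e); goal_lia.
apply: (finish_tiling misses typical_sub uniq_blocks size_block blocks_sub _ tS uS _ _ ltm cV sS).
- by move=> a; rewrite in_typical => /andP[].
- move=> v vS; apply: not_atypical; apply: contra vS; exact: OS.
- have := cardsID [set z in S] A1; have := count_set [in A1] uS.
  have -> : [set z in S | z \in A1] = A1 :&: [set z in S] by apply/setP=> z; rewrite !in_set andbC.
  have -> : A1 :\: [set z in S] = [set v in A1 | v \notin S] by apply/setP=> z; rewrite !in_set andbC.
  move: cA1 ltm; move: #|A1| #|_ :&: _| #|[set _ in _ | _]| (count _ S); goal_lia.
- have := number_of_blocks; rewrite sS; move: leqt q2 m_large e_gt0.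
  by move: (q * e) (q * tau) (size bs); goal_lia.
Qed.

Lemma piece_cons_uniq (F : {set V}) c s t : uniq t -> piece F c s ->
  (forall v, v \in t -> v \in F) -> uniq (t ++ s).
Proof.
move=> ut [us fs _ _] tF; apply: uniq_cat_disjoint => // v vt; apply/negP=> /fs.
by rewrite tF.
Qed.

(** The small part is taken to be [A1] with the attachable vertices [A2]; everything else is
    pluggable and behaves like [B]. Only the difference between |A1 :|: A2| and 2m has to be
    corrected. *)
Theorem extremal_tileable : tileable H j (enum V).
Proof.
have [q1 q2] := le_qe.
have [A2 hA2] := set_of_Prop (fun o => o \in O /\ attachable o).
have A2O o : o \in A2 -> o \in O by move=> /hA2[].
have A2att o : o \in A2 -> attachable o by move=> /hA2[].
have plug o : o \in O -> o \notin A2 -> pluggable o.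
  move=> oO oA; case: (attachable_or_pluggable oO) => // at_.
  by have /hA2 : o \in O /\ attachable o by []; rewrite (negbTE oA).
have cA : #|A1 :|: A2| = #|A1| + #|A2|.
  rewrite cardsU (_ : A1 :&: A2 = set0) ?cards0 ?subn0 //.
  apply/setP=> z; rewrite in_setI in_set0; apply/negP=> /andP[zA /A2O/atypicalN/andP[]].
  by rewrite zA.
have cO := card_atypical; have cT := card_typical.
have cO' : q * #|O| <= 8 * (q * e) by rewrite mulnCA leq_mul2l cO orbT.
have cA2 : #|A2| <= #|O| by apply: subset_leq_card; apply/subsetP.
have count_seq l : uniq l -> (forall v, v \in A2 -> v \in l) -> count [in A2] l = #|A2|.
  by move=> ul sub; rewrite count_set //; apply: eq_card => z; rewrite in_set andb_idl //; apply: sub.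
have cE : size (enum O) = #|O| by rewrite cardE.
have [le2m|lt2m] := leqP (2 * m) #|A1 :|: A2|.
  (* Surplus: each tile with three typical vertices lowers it by one. *)
  set d := #|A1 :|: A2| - 2 * m.
  have dE : #|A1| + #|A2| = 2 * m + d by rewrite -cA /d subnKC.
  have led : d <= e.
    by move: dE cT leA cA2; move: #|A1| #|A2| #|O| #|~: B| (d); goal_lia.
  have leqd : q * d <= q * e by rewrite leq_mul2l led orbT.
  have [|s1 p1 [t1 z1]] := @three_typical_iter d O.
    by move: cO leqd q2; move: (q * d) (q * e) #|O|; goal_lia.
  have [|||c [s2 [p2 t2 z2 ec]]] := @cover_atypical A2 (enum O) (O :|: [set z in s1]) A2att.
  - by move=> o; rewrite mem_enum.
  - by move=> o; rewrite mem_enum; apply: plug.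
  - have := card_setU_le O [set z in s1]; have := card_seq_set s1; rewrite z1 cE.
    by move: cO cO' leqd q2; move: (q * d) (q * e) (q * #|O|) #|O| #|_ :|: _| #|[set _ in _]|; goal_lia.
  rewrite count_seq ?enum_uniq // ?cE in ec; last by move=> v /A2O; rewrite mem_enum.
  have cc1 : count [in A1] s1 = 3 * d by case: p1.
  have cc2 : count [in A1] s2 = c by case: p2.
  have cc3 : count [in A1] (enum O) = 0.
    apply/eqP; rewrite -leqn0 leqNgt -has_count; apply/hasPn=> v; rewrite mem_enum.
    by move=> /atypicalN/andP[].
  apply: (@finish_extremal (enum O ++ s1 ++ s2) (d + #|O|)).
  - by apply: tileable_perm _ (tileable_cat t1 t2); perm_by_count.
  - have p12 := piece_join p1 p2.
    by apply: piece_cons_uniq p12 _ => [|v]; rewrite ?enum_uniq // mem_enum.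
  - by move=> o; rewrite mem_cat mem_enum => ->.
  - move: z2; rewrite !size_cat cE z1 mulnDr.
    by move: (q * d) (q * #|O|); goal_lia.
  - by move: led cO; goal_lia.
  - rewrite !count_cat cc1 cc2 cc3; move: dE ec cA2; clear.
    by move: #|A1| #|A2| #|O| => *; lia.
(* Deficit: every (k-1)-set outside [A1] and [A2] keeps at least t neighbours there, which gives a
   matching of t edges, and a tile extending such an edge uses one vertex of the small part instead
   of two. *)
set t := 2 * m - #|A1 :|: A2|.
have tE : #|A1| + #|A2| + t = 2 * m by rewrite -cA /t subnKC // ltnW.
have let_ : t <= 9 * e.
  by move: tE cT geA cO; move: #|A1| #|A2| #|O| #|~: B| (t); goal_lia.
have leqt : q * t <= 9 * (q * e) by rewrite mulnCA leq_mul2l let_ orbT.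
have plugC v : v \in ~: (A1 :|: A2) -> pluggable v.
  rewrite in_setC in_setU negb_or => /andP[vA1 vA2].
  have [vO|vO] := boolP (v \in O); first exact: plug.
  by apply: pluggable_B; have := not_atypical vO; rewrite (negbTE vA1).
have [||ms [sms ums subms gms]] := @matching_of_codegree V H j (~: (A1 :|: A2)) t.
- move=> s us ss sub; have := card_nb cod us ss.
  have : #|nb H s| <= #|A1 :|: A2| + #|[set v in ~: (A1 :|: A2) | v \in nb H s]|.
    apply: leq_trans (card_setU_le _ _); apply: subset_leq_card; apply/subsetP=> v vn.
    by rewrite in_setU in_set vn andbT in_setC; case: (v \in _).
  by rewrite cA; move: tE; move: #|A1| #|A2| #|nb H s| #|[set _ in _ | _]| (t); goal_lia.
- have h1 : (j + 3) * t <= q * t by rewrite leq_mul2r; apply/orP; right; goal_lia.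
  have h2 : (j + 3) * (j + 2) <= q * q by apply: leq_mul; goal_lia.
  have h3 : 3 * m <= q * m by rewrite leq_mul2r; apply/orP; right; goal_lia.
  have := cardsC (A1 :|: A2); rewrite cV cA.
  move: leqt lt2m cA h1 h2 h3 m_large m_large2 => /[swap].
  by move: (q * t) (q * e) (q * q) (q * m) #|~: (A1 :|: A2)| #|A1| #|A2| (_ * t) (_ * (j + 2)) #|A1 :|: A2|; goal_lia.
have msN v : v \in flatten ms -> (v \notin A1) && (v \notin A2).
  by move=> /subms; rewrite in_setC in_setU negb_or.
pose F := O :|: [set z in flatten ms].
have cF : #|F| <= 8 * e + (j + 3) * t.
  apply: leq_trans (card_setU_le _ _) _; apply: leq_add => //.
  rewrite card_set_seq // (@size_flatten_const _ _ (j + 3)) ?sms // => g /gms[-> _].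
  by rewrite addn3.
have cF' : #|F| <= 17 * (q * e).
  apply: leq_trans cF _; have h1 : (j + 3) * t <= q * t by rewrite leq_mul2r; apply/orP; right; goal_lia.
  by move: h1 leqt q2; move: (_ * t) (q * t) (q * e); goal_lia.
have [||s1 [p1 t1 z1]] := @extend_matching ms F.
- move=> g gin; have [sg eg] := gms g gin; split=> // v vg; apply: plugC; apply: subms.
  by apply/flattenP; exists g.
- by rewrite sms; move: cF' leqt; move: (q * t) (q * e) #|F|; goal_lia.
rewrite sms in p1 z1.
(* Pluggable atypical vertices may lie on the matching; only the others still need tiles of their
   own. *)
pose os := [seq o <- enum O | o \notin flatten ms].
have los : size os <= #|O| by rewrite cardE size_filter count_size.
have leqos : q * size os <= 8 * (q * e) by apply: leq_trans cO'; rewrite leq_mul2l los orbT.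
have osO o : o \in os -> o \in O by rewrite mem_filter mem_enum => /andP[].
have [||c [s2 [p2 t2 z2 ec]]] := @cover_atypical A2 os (F :|: [set z in s1]) A2att osO.
- by move=> o /osO; apply: plug.
- have := card_setU_le F [set z in s1]; have := card_seq_set s1.
  have : size s1 <= q * t by rewrite -z1 size_cat leq_addl.
  by move: cF' leqt leqos; move: (q * t) (q * e) (q * size os) #|F| #|_ :|: _| #|[set _ in _]|; goal_lia.
have uos : uniq os by rewrite filter_uniq ?enum_uniq.
rewrite count_seq // in ec; last first.
  move=> v vA2; rewrite mem_filter mem_enum A2O // andbT.
  by apply/negP=> /msN; rewrite vA2 andbF.
have cc1 : count [in A1] s1 = t by case: p1.
have cc2 : count [in A1] s2 = c by case: p2.
have count0 l : (forall v, v \in l -> v \notin A1) -> count [in A1] l = 0.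
  by move=> h; apply/eqP; rewrite -leqn0 leqNgt -has_count; apply/hasPn.
have cc3 : count [in A1] (flatten ms) = 0 by apply: count0 => v /msN/andP[].
have cc4 : count [in A1] os = 0 by apply: count0 => v /osO/atypicalN/andP[].
apply: (@finish_extremal ((flatten ms ++ os) ++ s1 ++ s2) (t + size os)).
- by apply: tileable_perm _ (tileable_cat t1 t2); perm_by_count.
- have p12 := piece_join p1 p2; apply: piece_cons_uniq p12 _.
    apply: uniq_cat_disjoint => // v vm; by rewrite mem_filter vm.
  by move=> v; rewrite mem_cat in_setU mem_seq_set => /orP[->|/osO->] //; rewrite orbT.
- move=> o oO; rewrite !mem_cat mem_filter mem_enum oO andbT.
  by case: (o \in flatten ms).
- move: z1 z2; rewrite !size_cat mulnDr.
  by move: (q * t) (q * size os); goal_lia.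
- by move: let_ los cO; goal_lia.
- rewrite !count_cat cc1 cc2 cc3 cc4; move: tE ec los cA2; clear.
  by move: #|A1| #|A2| #|O| (size os) (t) => *; lia.
Qed.

End Extremal.

(** * Conclusion *)

(** Without cherries, a (k-1)-set in [B] has at most one neighbour in [B], so it has at least 2m - 1
    of the at most 2m + d vertices outside. This gives the error e = d + 1 of the extremal case. *)
Lemma sparse_set_tileable j (V : finType) (H : hypergraph V) m (B : {set V})
    (q := 2 * j + 5) (N := 2000 * q) :
  #|V| = q * m -> (forall S : {set V}, #|S| = j.+2 -> 2 * m <= codegree H S) ->
  N + 100 * (q * q) <= m -> N * ((2 * j + 3) * m) <= N * #|B| + m ->
  (forall s x y, uniq (s ++ [:: x; y]) -> size s = j.+2 -> {subset s ++ [:: x; y] <= B} ->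
     edge H (x :: s) -> edge H (y :: s) -> False) ->
  tileable H j (enum V).
Proof.
move=> cV cod lem leB free; pose d := m %/ N.
have N0 : 0 < N by rewrite /N /q; lia.
have leB' : (2 * j + 3) * m <= #|B| + d.
  rewrite -leq_subLR /d leq_divRL // mulnC mulnBr leq_subLR; exact: leB.
have leA : #|~: B| <= 2 * m + d.
  have := cardsC B; rewrite cV; move: leB'; rewrite /q; move: #|B| #|~: B| (d); goal_lia.
have dm : 2000 * (q * d) <= m by rewrite mulnA mulnC leq_trunc_div.
have m_nbB s : uniq s -> size s = j.+2 -> {subset s <= B} -> 2 * m <= #|[set a in ~: B | edge H (a :: s)]| + 1.
  move=> us ss sub; apply: leq_trans (card_nb cod us ss) _.
  have few : #|[set v in B | v \in nb H s]| <= 1.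
    rewrite leqNgt; apply/negP=> lt1.
    have [|[|x [|y [|? ?]]] [] // uxy _ hxy] := @fresh_seq V [set v in B | v \in nb H s] set0 2.
      by rewrite cards0 addn0.
    have [/hxy hx /hxy hy] : x \in [:: x; y] /\ y \in [:: x; y] by rewrite !inE !eqxx orbT.
    rewrite !inE /= andbT in hx; rewrite !inE /= andbT in hy.
    have [/and3P[xB xs ex] /and3P[yB ys ey]] := (hx, hy).
    apply: (free s x y) => //.
      apply: uniq_cat_disjoint => // v vs; rewrite !inE negb_or.
      by apply/andP; split; apply: contraTneq vs => ->.
    by move=> v; rewrite mem_cat !inE => /or3P[/sub|/eqP->|/eqP->].
  apply: leq_trans (leq_add (leqnn _) few); apply: leq_trans (card_setU_le _ _).
  apply: subset_leq_card; apply/subsetP=> v; rewrite !inE => /andP[vs ev].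
  by rewrite vs ev; case: (v \in B).
apply: (@extremal_tileable j V H m B d.+1) => //.
- move=> s us ss sub; have := cardsID [set a | edge H (a :: s)] (~: B); have := m_nbB s us ss sub.
  have -> : ~: B :&: [set a | edge H (a :: s)] = [set a in ~: B | edge H (a :: s)].
    by apply/setP=> a; rewrite !inE.
  have -> : ~: B :\: [set a | edge H (a :: s)] = [set a in ~: B | ~~ edge H (a :: s)].
    by apply/setP=> a; rewrite !inE andbC.
  by move: leA; move: #|~: B| #|[set _ in _ | _]| #|[set _ in _ | _]| (d); goal_lia.
- by apply: leq_trans leA _; rewrite addnS.
- have [|s [us ss hs]] := @fresh_seq V B set0 j.+2.
    rewrite cards0 addn0; move: leB' lem dm; rewrite /N /q.
    have : 3 * m <= (2 * j + 3) * m by rewrite leq_mul2r; apply/orP; right; lia.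
    move: (d) #|B| (_ * m) => a b c; clear; nia.
  have /m_nbB := us; move=> /(_ ss) h; have {}h := h (fun v vs => proj1 (andP (hs v vs))).
  have : #|[set a in ~: B | edge H (a :: s)]| <= #|~: B|.
    by apply: subset_leq_card; apply/subsetP=> a; rewrite inE => /andP[].
  by move: h; move: #|~: B| #|[set _ in _ | _]| (d); goal_lia.
- rewrite mulnS; move: lem dm; rewrite /N -/q; move: (q * d) (q * q) (q); goal_lia.
- by apply: leq_trans lem; rewrite leq_addl.
Qed.

Lemma large_tileable j : exists n0, forall (V : finType) (H : hypergraph V) m,
  n0 <= m -> #|V| = (2 * j + 5) * m ->
  (forall S : {set V}, #|S| = j.+2 -> 2 * m <= codegree H S) -> tileable H j (enum V).
Proof.
set q := 2 * j + 5; have q0 : 0 < q by rewrite /q; lia.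
have [C [D dich]] := tiling_or_sparse_set j (2000 * q).
have [N1 abs] := absorbing_set j (D * q) C.
exists (N1 + D + 2000 * q + 100 * (q * q)) => V H m lem cV cod.
(* The codegree 2m is at least |V|/k, because 2k - 1 is less than 2k. *)
have cd : codegree_dense j H.
  move=> S /cod; rewrite cV /q; move: (codegree H S) => c; clear; nia.
have [|Z [uZ sZ absZ]] := abs V H cd.
  rewrite cV; apply: (@leq_trans m); last by rewrite leq_pmull.
  by move: lem; move: (100 * _) (2000 * _); goal_lia.
have leD : D <= m by move: lem; move: (100 * _) (2000 * _); goal_lia.
have leDZ : D * #|[set z in Z]| <= m.
  by rewrite -(leq_pmul2l q0) mulnA (mulnC q) card_set_seq // -cV; exact: sZ.
have [[s [us sZN ts cover]]|[B leB free]] := dich V H m [set z in Z] cV cod leD leDZ.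
- pose U := [seq v <- enum V | (v \notin s) && (v \notin Z)].
  have pV : perm_eq (s ++ U ++ Z) (enum V).
    apply: uniq_perm; rewrite ?enum_uniq //.
      rewrite !cat_uniq us filter_uniq ?enum_uniq // uZ /= andbT; apply/andP; split.
        apply/hasPn=> v; rewrite mem_cat mem_filter => /orP[/andP[/andP[]]//|vZ].
        by apply/negP=> /sZN; rewrite inE vZ.
      by apply/hasPn=> v vZ; rewrite mem_filter vZ andbF.
    move=> v; rewrite !mem_cat mem_filter mem_enum.
    by case: (v \in s); case: (v \in Z).
  have szV : size s + (size U + size Z) = q * m by rewrite -cV cardE -(perm_size pV) !size_cat.
  have dZ : q %| size Z by apply: tileable_size (absZ [::] _ _); rewrite ?dvdn0.
  have dU : q %| size U.
    have : q %| size s + (size U + size Z) by rewrite szV dvdn_mulr.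
    by rewrite dvdn_addr ?(tileable_size ts) // dvdn_addl.
  apply: tileable_perm pV (tileable_cat ts (absZ U dU _)).
  move: cover szV; rewrite cV card_set_seq // -/q; goal_lia.
- apply: (sparse_set_tileable cV cod _ leB free).
  by move: lem; rewrite -/q; move: (100 * _) (2000 * _); goal_lia.
Qed.

Import Order.TTheory GRing.Theory Num.Theory.
Local Open Scope ring_scope.

Theorem theorem1p1 (k : nat) (hk : (3 <= k)%N) :
  exists n0 : nat, forall n : nat, (n0 <= n)%N -> (2 * k - 1 %| n)%N ->
    forall (V : finType) (H : hypergraph V),
      #|V| = n ->
      uniform k H ->
      (2 * n)%N%:R / (2 * k - 1)%N%:R <= (min_codegree k H)%:R :> rat ->
      exists T : {set {set V} * {set {set V}}},
        is_perfect_tiling (gen_triangle k) H T.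
Proof.
case: k hk => [|[|[|j]]] // _; have [n0 h] := large_tileable j.
have qE : (2 * j.+3 - 1 = 2 * j + 5)%N by lia.
exists ((2 * j + 5) * n0)%N => n len dn V H cV _ hdeg.
apply: perfect_tiling_of_tileable.
have q0 : (0 < 2 * j + 5)%N by lia.
move: dn; rewrite qE => /dvdnP[m nE]; rewrite mulnC in nE.
apply: (h V H m) => [||S cS].
- by rewrite -(leq_pmul2l q0) -nE.
- by rewrite cV nE.
- apply: leq_trans (codegree_ge_min H (k := j.+3) cS).
  move: hdeg; rewrite qE ler_pdivrMr ?ltr0n // -natrM ler_nat nE.
  by rewrite mulnCA mulnC leq_pmul2r.
Qed.
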